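(* Assume that there exists a unique invariant probability measure $\mu^\star\in\mathcal{M}_+(\mathbf{X})$. Let $\nu^\star$ be the absolutely continuous part of $\mu^\star$ in its Lebesgue decomposition with respect to $\lambda_{\mathbf{X}}$, and let $\nu_1^\star:=\min\{1,\nu^\star\}$, so that $(\mu^\star,\nu_1^\star,\lambda_{\mathbf{X}}-\nu_1^\star,\mu^\star-\nu_1^\star)$ is the unique optimal solution of $$\rho^\star_{\mathrm{sing}}:=\sup_{\mu,\nu,\hat\nu,\psi\in\mathcal{M}_+(\mathbf{X})}\Big\{\int_{\mathbf{X}}d\nu\;:\;\int_{\mathbf{X}}d\mu=1,\ \mu\text{ is invariant},\ \nu+\psi=\mu,\ \nu+\hat\nu=\lambda_{\mathbf{X}}\Big\}.$$ For every integer $r\ge r_{\min}$, let $(\mathbf{u}^r,\mathbf{v}^r,\hat{\mathbf{v}}^r,\mathbf{y}^r)$ be an arbitrary optimal solution of the semidefinite program (in variables $\mathbf{u},\mathbf{v},\hat{\mathbf{v}},\mathbf{y}\in\mathbb{R}^{\mathbb{N}^n_{2r}}$) $$\begin{aligned}\rho^r_{\mathrm{sing}}:=\sup\ & v_0\\ \text{s.t. }& u_0=1,\quad \mathscr{I}_{\mathbf{u}}(\mathbf{x}^\alpha)=0\ \ \forall\alpha\in A_r,\\ & v_\alpha+y_\alpha=u_\alpha,\quad v_\alpha+\hat v_\alpha=z_\alpha\ \ \forall\alpha\in\mathbb{N}^n_{2r},\\ & \mathbf{M}_{r-r_j}(g_j\mathbf{u}),\ \mathbf{M}_{r-r_j}(g_j\mathbf{v}),\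 \mathbf{M}_{r-r_j}(g_j\hat{\mathbf{v}}),\ \mathbf{M}_{r-r_j}(g_j\mathbf{y})\succeq0,\quad j=0,\dots,m,\end{aligned}$$ and, completing with zeros, consider $\mathbf{u}^r,\mathbf{v}^r,\hat{\mathbf{v}}^r,\mathbf{y}^r$ as elements of $\mathbb{R}[\mathbf{x}]'$ (infinite sequences indexed by $\mathbb{N}^n$, identified with linear functionals on $\mathbb{R}[\mathbf{x}]$). Then the sequence $(\mathbf{u}^r,\mathbf{v}^r,\hat{\mathbf{v}}^r,\mathbf{y}^r)_{r\ge r_{\min}}$ converges pointwise to some $(\mathbf{u}^\star,\mathbf{v}^\star,\hat{\mathbf{v}}^\star,\mathbf{y}^\star)\in(\mathbb{R}[\mathbf{x}]')^4$, that is, for every fixed $\alpha\in\mathbb{N}^n$, $$\lim_{r\to\infty}u^r_\alpha=u^\star_\alpha,\quad \lim_{r\to\infty}v^r_\alpha=v^\star_\alpha,\quad \lim_{r\to\infty}\hat v^r_\alpha=\hat v^\star_\alpha=z_\alpha-v^\star_\alpha,\quad \lim_{r\to\infty}y^r_\alpha=y^\star_\alpha=u^\star_\alpha-v^\star_\alpha .$$ Moreover, $\mathbf{u}^\star$ is the moment sequence of the unique invariant probability measure $\mu^\star$, and $\mathbf{v}^\star,\hat{\mathbf{v}}^\star,\mathbf{y}^\star$ are the respective moment sequences of $\nu_1^\star$, $\hat\nu^\star=\lambda_{\mathbf{X}}-\nu_1^\star$ and $\mu^\star-\nu_1^\star$. In addition, $$\lim_{r\to\infty}\rho^r_{\mathrm{sing}}=\rho^\star_{\mathrm{sing}}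 .$$
   Context: Setting. $f=(f_1,\dots,f_n):\mathbb{R}^n\to\mathbb{R}^n$ is a polynomial map and $\mathbf{X}=\{\mathbf{x}\in\mathbb{R}^n: g_1(\mathbf{x})\ge0,\dots,g_m(\mathbf{x})\ge 0\}$ is a compact set, with $g_1,\dots,g_m\in\mathbb{R}[\mathbf{x}]$; $g_0:=1$. Standing assumptions: for some integer $N$, one of the $g_j$ equals $N-\|\mathbf{x}\|_2^2$; and the moments of the Lebesgue measure on $\mathbf{X}$ are available analytically (i.e. are regarded as known). $\lambda$ is the Lebesgue measure, $\lambda_{\mathbf{X}}$ its restriction to $\mathbf{X}$, and $z_\beta:=\int\mathbf{x}^\beta\,d\lambda_{\mathbf{X}}$. $\mathcal{M}_+(\mathbf{X})$ is the set of finite nonnegative Borel measures supported on $\mathbf{X}$. For a measure $\nu$ with density $h\ge0$ w.r.t. $\lambda_{\mathbf X}$, $\min\{1,\nu\}$ is the measure with density $\mathbf{x}\mapsto\min\{1,h(\mathbf{x})\}$. Invariance. Two cases are treated in parallel, and the result holds in each. Discrete time ($\mathbf{x}_{t+1}=f(\mathbf{x}_t)$): $\mu$ is invariant if $f_\#\mu=\mu$, where $f_\#\mu(\mathbf{A})=\mu(\{\mathbf{x}\in\mathbf{X}: f(\mathbf{x})\in\mathbf{A}\})$ for Borel $\mathbf{A}\subseteq\mathbf{X}$. Continuous time ($\dot{\mathbf{x}}=f(\mathbf{x})$): $\mu$ is invariant if $\mathrm{div}(f\mu)=0$ in the sense of distributions acting on $\mathcal{C}^1(\mathbf{X})$, i.e.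 $\int_{\mathbf{X}} \mathrm{grad}\,v\cdot f\,d\mu=0$ for all $v\in\mathcal{C}^1(\mathbf{X})$. Moment notation. $r_j:=\lceil(\deg g_j)/2\rceil$ (so $r_0=0$), $r_{\min}:=\max\{1,r_1,\dots,r_m\}$, $\mathbb{N}^n_d:=\{\beta\in\mathbb{N}^n:|\beta|:=\sum_i\beta_i\le d\}$. For a real sequence $\mathbf{y}$, $\ell_{\mathbf{y}}(\sum_\beta p_\beta\mathbf{x}^\beta):=\sum_\beta p_\beta y_\beta$. $\mathbf{M}_{r-r_j}(g_j\mathbf{y})$ is the symmetric matrix with rows and columns indexed by $\mathbb{N}^n_{r-r_j}$ and $(\beta,\gamma)$ entry $\ell_{\mathbf{y}}(g_j\,\mathbf{x}^{\beta+\gamma})$. $\succeq0$ means positive semidefinite. For a polynomial $q$, $\mathscr{I}_{\mathbf{u}}(q):=\ell_{\mathbf{u}}(q\circ f)-\ell_{\mathbf{u}}(q)$ in discrete time and $\mathscr{I}_{\mathbf{u}}(q):=\ell_{\mathbf{u}}(\mathrm{grad}\,q\cdot f)$ in continuous time. $A_r$ is the set of $\alpha\in\mathbb{N}^n_{2r}$ for which $\mathscr{I}_{\mathbf{u}}(\mathbf{x}^\alpha)$ only involves moments of degree at most $2r$, i.e. $\deg(\mathbf{x}^\alpha\circ f)\le 2r$ (discrete time), resp. $\deg(\mathrm{grad}(\mathbf{x}^\alpha)\cdot f)\le 2r$ (continuous time). *)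

(* Defs.v *)
From HB Require Import structures.
From mathcomp Require Import all_boot all_order all_algebra.
(* The notations of mpoly clash with those of MathComp-Analysis. *)
From mathcomp Require Import -(notations) mpoly.
From mathcomp Require Import all_classical all_reals all_analysis.
From mathcomp Require Import measurable_realfun.
Import Order.TTheory GRing.Theory Num.Theory numFieldNormedType.Exports.

Set Implicit Arguments.
Unset Strict Implicit.
Unset Printing Implicit Defensive.

Local Open Scope classical_set_scope.
Local Open Scope ring_scope.

(* MathComp-Analysis puts no measurable structure on matrices; here 'M[R]_(m, n),
   hence 'rV[R]_n, carries the Borel sigma-algebra. *)
Section borel_matrix.
Context (R : realType) (m n : nat).

Let opens : set (set 'M[R]_(m, n)) := open.

HB.instance Definition _ := @isMeasurable.Build (sigma_display opens)
  'M[R]_(m, n) <<s opens >> (@sigma_algebra0 _ setT opens)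
  (@sigma_algebraC _ opens) (@sigma_algebra_bigcup _ setT opens).

End borel_matrix.

Section borel_matrix_theory.
Context {R : realType}.

Lemma borel_matrixE m n :
  (measurable : set (set 'M[R]_(m, n))) = <<s (open : set (set 'M[R]_(m, n))) >>.
Proof. by []. Qed.

Lemma open_measurable_matrix m n (A : set 'M[R]_(m, n)) :
  open A -> measurable A.
Proof. by move=> oA; rewrite borel_matrixE; exact: sub_sigma_algebra. Qed.

Lemma continuous_measurable_matrix m n p q (f : 'M[R]_(m, n) -> 'M[R]_(p, q)) :
  continuous f -> measurable_fun setT f.
Proof.
move=> /continuousP cf.
apply: (measurability (open : set (set 'M[R]_(p, q)))) => //.
move=> _ [B oB <-]; rewrite setTI; apply: open_measurable_matrix; exact: cf.
Qed.

Lemma measurable_coord m n (i : 'I_m) (j : 'I_n) :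
  measurable_fun setT (fun x : 'M[R]_(m, n) => x i j).
Proof.
have /continuousP cf := @coord_continuous R m n i j.
apply: (measurability _ (RGenOpens.measurableE R)) => //.
move=> _ [B [a [b ->]] <-]; rewrite setTI; apply: open_measurable_matrix.
by apply: cf; exact: interval_open.
Qed.

Lemma ratr_mx_dense m n (x : 'M[R]_(m, n)) (e : R) : 0 < e ->
  exists q : 'M[rat]_(m, n), ball x e (map_mx ratr q : 'M[R]_(m, n)).
Proof.
move=> e0; have H i j : exists q : rat, ball (x i j) e (ratr q).
  have [||y [xy [q _ qy]]] := @dense_rat R (ball (x i j) e).
    by exists (x i j); exact: ballxx.
    exact: ball_open.
  by exists q; rewrite qy.
exists (\matrix_(i, j) sval (cid (H i j))); split => // i j.
by rewrite !mxE; exact: (svalP (cid (H i j))).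
Qed.

Lemma measurable_matrixP d (T : measurableType d) m n (f : T -> 'M[R]_(m, n)) :
  (forall i j, measurable_fun setT (fun t => f t i j)) -> measurable_fun setT f.
Proof.
move=> mf; apply: (measurability (open : set (set 'M[R]_(m, n)))) => //.
move=> _ [U oU <-]; rewrite setTI.
pose B (q : 'M[rat]_(m, n) * nat) : set 'M[R]_(m, n) :=
  
  ball (map_mx ratr q.1 : 'M[R]_(m, n)) (q.2.+1%:R^-1 : R).
pose F q : set T := [set t | B q `<=` U /\ B q (f t)].
rewrite (_ : _ @^-1` _ = \bigcup_q F q); last first.
  apply/seteqP; split => [t Ut|t [q _ [qU qt]]]; last exact: qU.
  have /nbhs_ballP[e /= e0 eU] : nbhs (f t) U by move: oU; rewrite openE; apply.
  have [k ke] : exists k : nat, k.+1%:R^-1 < e / 2.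
    have [k _ /(_ k (leqnn k)) ke] := near_infty_natSinv_lt (PosNum (divr_gt0 e0 (ltr0n _ 2))).
    by exists k.
  have [|q xq] := @ratr_mx_dense _ _ (f t) k.+1%:R^-1; first by rewrite invr_gt0.
  exists (q, k) => //; split; last by apply: ball_sym.
  move=> y qy; apply: eU; rewrite [e]splitr.
  by apply: ball_triangle; [apply: (le_ball (ltW ke)); exact: xq
                           |exact: (le_ball (ltW ke)) qy].
apply: countable_bigcupT_measurable; first exact: countableP.
move=> q; have [qU|qU] := pselect (B q `<=` U); last first.
  by rewrite (_ : F q = set0)//; apply/seteqP; split => t //= [].
rewrite (_ : F q = \bigcap_(i in [set: 'I_m]) \bigcap_(j in [set: 'I_n])
    ((fun t => f t i j) @^-1` ball (ratr (q.1 i j) : R) (q.2.+1%:R^-1 : R))); last first.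
  apply/seteqP; split => t.
    by move=> [_ [_ qt]] i _ j _; have := qt i j; rewrite mxE.
  move=> qt; split => //; split; first by rewrite invr_gt0.
  by move=> i j; rewrite mxE; exact: qt.
apply: fin_bigcap_measurable => // i _; apply: fin_bigcap_measurable => // j _.
rewrite -[X in measurable X]setTI; apply: mf => //.
exact: measurable_ball.
Qed.

End borel_matrix_theory.

Section lebesgue_rV.
Context {R : realType}.

Definition cons_rV n (p : measurableTypeR R * 'rV[R]_n) : 'rV[R]_n.+1 :=
  \row_j (if unlift ord0 j is Some k then p.2 ord0 k else p.1).

Definition uncons_rV n (v : 'rV[R]_n.+1) : measurableTypeR R * 'rV[R]_n :=
  (v ord0 ord0, \row_k v ord0 (lift ord0 k)).

Lemma cons_rVK n : cancel (@cons_rV n) (@uncons_rV n).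
Proof.
move=> [x v]; congr pair; first by rewrite mxE unlift_none.
by apply/rowP => k; rewrite !mxE liftK.
Qed.

Lemma measurable_cons_rV n : measurable_fun setT (@cons_rV n).
Proof.
apply: measurable_matrixP => i j; under eq_fun do rewrite mxE.
case: unliftP => [k _|_]; last exact: measurable_fst.
exact: (measurableT_comp (@measurable_coord R 1 n ord0 k) measurable_snd).
Qed.

Lemma measurable_uncons_rV n : measurable_fun setT (@uncons_rV n).
Proof.
apply/measurable_fun_pairP; split; first exact: measurable_coord.
apply: measurable_matrixP => i j /=.
under eq_fun do rewrite mxE.
exact: measurable_coord.
Qed.

Section push.
Context n (mu : {sigma_finite_measure set 'rV[R]_n -> \bar R}).

Definition lebesgue_step : set 'rV[R]_n.+1 -> \bar R :=
  pushforward (lebesgue_measure \x mu)%E (@cons_rV n).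

Let step_measure : {measure set 'rV[R]_n.+1 -> \bar R} :=
  measure_function_pushforward__canonical__measure_function_Measure
    (lebesgue_measure \x mu)%E (@measurable_cons_rV n).

HB.instance Definition _ := Measure.copy lebesgue_step step_measure.

Let step_sigma_finite : sigma_finite setT lebesgue_step.
Proof.
have /sigma_finiteP[F [TF ndF Foo]] := sigma_finiteT (@lebesgue_measure R).
have /sigma_finiteP[G [TG ndG Goo]] := sigma_finiteT mu.
exists (fun k => @uncons_rV n @^-1` (F k `*` G k)).
  rewrite -preimage_bigcup; apply/esym/seteqP; split => // v _.
  have : (\bigcup_k F k) (v ord0 ord0) by rewrite -TF.
  have : (\bigcup_k G k) (uncons_rV v).2 by rewrite -TG.
  move=> [k _ Gk] [l _ Fl]; exists (maxn l k) => //; split => /=.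
    by move: Fl; exact/subsetPset/ndF/leq_maxl.
  by move: Gk; exact/subsetPset/ndG/leq_maxr.
move=> k; have [mF Fk] := Foo k; have [mG Gk] := Goo k; split.
  rewrite -[X in measurable X]setTI; apply: measurable_uncons_rV => //.
  exact: measurableX.
rewrite /lebesgue_step /pushforward -comp_preimage.
rewrite (_ : _ \o _ = id) ?preimage_id; last first.
  by apply/funext => x; exact: cons_rVK.
by rewrite product_measure1E// lte_mul_pinfty// ge0_fin_numE.
Qed.

HB.instance Definition _ :=
  Measure_isSigmaFinite.Build _ _ _ lebesgue_step step_sigma_finite.

End push.

(* R^(n+1) is identified with R x R^n; 'rV[R]_0 is a point of measure 1. *)
Fixpoint lebesgue_rV n : {sigma_finite_measure set 'rV[R]_n -> \bar R} :=
  match n with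
  | 0 => dirac (0 : 'rV[R]_0)
  | n'.+1 => lebesgue_step (lebesgue_rV n')
  end.

End lebesgue_rV.

Section setting.
Context {R : realType} {n : nat}.

Definition peval (p : mpoly n R) (x : 'rV[R]_n) : R := meval (x ord0) p.

Definition poly_map (f : n.-tuple (mpoly n R)) (x : 'rV[R]_n) : 'rV[R]_n :=
  \row_i peval (tnth f i) x.

Definition semialgebraic_set m (g : 'I_m -> mpoly n R) : set 'rV[R]_n :=
  [set x | forall j, 0 <= peval (g j) x].

Definition ball_poly (N : int) : mpoly n R :=
  mpolyC n N%:~R - \sum_(i < n) mpolyX R (mnm1 i) ^+ 2.

Lemma measurable_peval (p : mpoly n R) : measurable_fun setT (peval p).
Proof.
rewrite /peval; under eq_fun do rewrite mevalE.
apply: measurable_sum => a; apply: measurable_funM => //.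
apply: measurable_prod => i _; apply: measurable_funX.
exact: measurable_coord.
Qed.

Lemma measurable_semialgebraic_set m (g : 'I_m -> mpoly n R) :
  measurable (semialgebraic_set g).
Proof.
rewrite (_ : semialgebraic_set g =
    \bigcap_(j in [set: 'I_m]) (peval (g j) @^-1` `[0, +oo[)); last first.
  apply/seteqP; split => x /= gx j; first by rewrite /= in_itv /= gx.
  by have := gx j Logic.I; rewrite /= in_itv /= andbT.
apply: fin_bigcap_measurable => // j _; rewrite -[X in measurable X]setTI.
exact: measurable_peval.
Qed.

Definition lebesgue_on m (g : 'I_m -> mpoly n R) : set 'rV[R]_n -> \bar R :=
  mrestr (lebesgue_rV n) (measurable_semialgebraic_set g).

HB.instance Definition _ m (g : 'I_m -> mpoly n R) :=
  Measure.on (lebesgue_on g).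

(* Membership in M_+(X), for a finite Borel measure on R^n and a closed X. *)
Definition supported_on (X : set 'rV[R]_n) (mu : set 'rV[R]_n -> \bar R) :=
  mu (~` X) = 0%E.

Definition same_measure (mu nu : set 'rV[R]_n -> \bar R) :=
  forall A, measurable A -> mu A = nu A.

Definition lebesgue_decomposition (lam mu nu sigma : set 'rV[R]_n -> \bar R) :=
  [/\ same_measure mu (fun A => nu A + sigma A)%E,
      nu `<< lam &
      exists2 B, measurable B & lam B = 0%E /\ sigma (~` B) = 0%E].

Definition has_density (lam nu : set 'rV[R]_n -> \bar R) (h : 'rV[R]_n -> R) :=
  [/\ measurable_fun setT h, forall x, 0 <= h x &
      same_measure nu (fun A => \int[lam]_(x in A) (h x)%:E)%E].

(* nu1 = min {1, nu}; h is determined by nu up to a lam-null set. *)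
Definition is_min1 (lam nu nu1 : set 'rV[R]_n -> \bar R) :=
  exists2 h, has_density lam nu h & has_density lam nu1 (fun x => Num.min 1 (h x)).

Definition moment (mu : {measure set 'rV[R]_n -> \bar R}) (a : multinom n) : R :=
  \int[mu]_x peval (mpolyX R a) x.

Inductive time := Discrete | Continuous.

(* 'D_(delta_mx ord0 i) v is the i-th partial derivative of v. *)
Definition C1 (v : 'rV[R]_n -> R) :=
  (forall x, differentiable v x) /\
  (forall i : 'I_n, continuous ('D_(delta_mx ord0 i) v)).

(* C^1(X) is the set of restrictions to X of C^1 functions on R^n. *)
Definition invariant_measure (t : time) (f : n.-tuple (mpoly n R))
    (X : set 'rV[R]_n) (mu : set 'rV[R]_n -> \bar R) : Prop :=
  match t with
  | Discrete => forall A, measurable A -> A `<=` X ->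
      mu [set x | X x /\ A (poly_map f x)] = mu A
  | Continuous => forall v, C1 v ->
      (\int[mu]_(x in X)
        (\sum_(i < n) 'D_(delta_mx ord0 i) v x * peval (tnth f i) x)%:E = 0)%E
  end.

Definition invariant_probability t f X (mu : probability 'rV[R]_n R) :=
  supported_on X mu /\ invariant_measure t f X mu.

Section lp.
Variables (t : time) (f : n.-tuple (mpoly n R)) (m : nat) (g : 'I_m -> mpoly n R).
Local Notation X := (semialgebraic_set g).
Implicit Types mu nu nuh psi : {finite_measure set 'rV[R]_n -> \bar R}.

Definition lp_feasible mu nu nuh psi :=
  [/\ [/\ supported_on X mu, supported_on X nu, supported_on X nuh &
          supported_on X psi],
      (\int[mu]_(x in X) 1 = 1)%E,
      invariant_measure t f X mu,
      same_measure (fun A => nu A + psi A)%E mu &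
      same_measure (fun A => nu A + nuh A)%E (lebesgue_on g)].

Definition rho_sing : \bar R := ereal_sup
  [set r | exists mu nu nuh psi,
    lp_feasible mu nu nuh psi /\ r = (\int[nu]_(x in X) 1)%E].

Definition lp_optimal mu nu nuh psi :=
  lp_feasible mu nu nuh psi /\ (\int[nu]_(x in X) 1 = rho_sing)%E.

End lp.

(* The zero polynomial gets degree 0. *)
Definition mpoly_deg (p : mpoly n R) : nat := (msize p).-1.

(* ceil (deg p / 2) *)
Definition half_deg (p : mpoly n R) : nat := uphalf (mpoly_deg p).

(* The family (g_0, g_1, ..., g_m), where g_0 = 1. *)
Definition with_g0 m (g : 'I_m -> mpoly n R) (j : 'I_m.+1) : mpoly n R :=
  if unlift ord0 j is Some i then g i else 1.

Definition r_min m (g : 'I_m -> mpoly n R) : nat :=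
  maxn 1 (\max_(j < m) half_deg (g j)).

(* R^(N^n_d): bmultinom n d.+1 is the type of multi-indices of degree <= d. *)
Definition psm (d : nat) := bmultinom n d.+1 -> R.

(* Completion with zeros. *)
Definition ext d (y : psm d) (a : multinom n) : R := oapp y 0 (insub a).

Definition riesz (y : multinom n -> R) (p : mpoly n R) : R :=
  \sum_(a <- msupp p) mcoeff a p * y a.

Definition loc_mx (d : nat) (p : mpoly n R) (y : multinom n -> R) :
    'M[R]_#|{: bmultinom n d.+1}| :=
  \matrix_(i, j) riesz y
    (p * mpolyX R (mnm_add (bmnm (enum_val i)) (bmnm (enum_val j)))).

Definition psd k (M : 'M[R]_k) :=
  M^T = M /\ forall x : 'cV[R]_k, 0 <= (x^T *m M *m x) ord0 ord0.

Definition transport (t : time) (f : n.-tuple (mpoly n R)) (q : mpoly n R) :=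
  match t with
  | Discrete => comp_mpoly f q
  | Continuous => \sum_(i < n) mderiv i q * tnth f i
  end.

Definition inv_func t f (u : multinom n -> R) (q : mpoly n R) : R :=
  match t with
  | Discrete => riesz u (transport t f q) - riesz u q
  | Continuous => riesz u (transport t f q)
  end.

Section sdp.
Variables (t : time) (f : n.-tuple (mpoly n R)) (m : nat) (g : 'I_m -> mpoly n R).
Variable r : nat.
Implicit Types u v vh y : psm (2 * r).

Definition in_A (a : bmultinom n (2 * r).+1) : bool :=
  (mpoly_deg (transport t f (mpolyX R (bmnm a))) <= 2 * r)%N.

Definition loc_psd (y : psm (2 * r)) :=
  forall j : 'I_m.+1,
    psd (loc_mx (r - half_deg (with_g0 g j)) (with_g0 g j) (ext y)).

Definition sdp_feasible u v vh y :=
  [/\ ext u mnm0 = 1,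
      forall a, in_A a -> inv_func t f (ext u) (mpolyX R (bmnm a)) = 0,
      forall a, v a + y a = u a,
      forall a, v a + vh a = moment (lebesgue_on g) (bmnm a) &
      [/\ loc_psd u, loc_psd v, loc_psd vh & loc_psd y]].

Definition rho_sdp : \bar R := ereal_sup
  [set s | exists u v vh y, sdp_feasible u v vh y /\ s = (ext v mnm0)%:E].

Definition sdp_optimal u v vh y :=
  sdp_feasible u v vh y /\ (ext v mnm0)%:E = rho_sdp.

End sdp.

End setting.

(* Main.v *)
(** Optimal pseudo-moment sequences are bounded degree by degree, since the
    ball constraint g_j = N - |x|^2 bounds every moment by the mass. Along any
    ultrafilter on the orders r they therefore converge, and the limit is
    nonnegative on the quadratic module of g. Such a functional L has a
    representing measure on X: after an affine change of variables it is
    nonnegative on the products of the x_i and 1 - x_i, so that the Hausdorff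
    moment problem on the cube can be solved by a limit of Bernstein weights,
    and L (g_j p^2) >= 0 keeps the measure away from {g_j < 0}. The four limit
    measures are feasible for the linear program, because boundedly supported
    measures are determined by their moments and, in continuous time,
    polynomials are dense in C^1. Conversely the moments of the optimal
    solution are feasible for every relaxation, so the limits are optimal, and
    uniqueness identifies them: nu <= mu and nu <= lambda force
    nu <= min {1, nu_star}. As all ultrafilters give the same limits, the
    sequences converge; near-optimal solutions converge in the same way, which
    gives the convergence of the values. *)

Require Import Defs.
From HB Require Import structures.
From mathcomp Require Import all_boot all_order all_algebra.
From mathcomp Require Import ring lra zify.
From mathcomp Require Import -(notations) mpoly.
From mathcomp Require Import all_classical all_reals all_analysis.
From mathcomp Require Import measurable_realfun.
Import Order.TTheory GRing.Theory Num.Theory numFieldNormedType.Exports.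

Set Implicit Arguments.
Unset Strict Implicit.
Unset Printing Implicit Defensive.

Local Open Scope classical_set_scope.
Local Open Scope ring_scope.

(** * Positive functionals on algebras *)

(** The obstacle is multiplicative. The relaxations only give L (g_j p^2) >= 0, whereas Bernstein
    weights are products of many constraints. The bridge is that a q with both q and 1 - q positive
    may be multiplied into any positive element: q is a sum of squares up to a remainder whose
    square L makes arbitrarily small. This plays the role of a Positivstellensatz without any
    certificate.

    The second difficulty is to produce a measure from discrete ones. In place of weak limits, the
    masses of binary cylinders are followed: they are bounded numbers, have limits along an
    ultrafilter and stay additive. Any additive mass on binary words is realised by Lebesgue measure
    on an interval. The limit measure of a cylinder need not be controlled at its boundary, because
    D digits determine every monomial up to a multiple of 2^-D, and moments are all that is asked
    for. *)

Section positive_multipliers.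
Context {R : realType} {A : comAlgType R} (L : {scalar A}).

Definition pos_mult (q : A) := forall p, 0 <= L (q * p ^+ 2).

Lemma pos_multD q1 q2 : pos_mult q1 -> pos_mult q2 -> pos_mult (q1 + q2).
Proof. by move=> h1 h2 p; rewrite mulrDl linearD addr_ge0. Qed.

Lemma pos_multZ c q : 0 <= c -> pos_mult q -> pos_mult (c *: q).
Proof. by move=> c0 h p; rewrite -scalerAl linearZ mulr_ge0. Qed.

Lemma pos_mult_sqr q r : pos_mult q -> pos_mult (q * r ^+ 2).
Proof. by move=> h p; rewrite -mulrA -exprMn. Qed.

Lemma pos_mult_sqr1 r : pos_mult 1 -> pos_mult (r ^+ 2).
Proof. by move=> /(pos_mult_sqr r); rewrite mul1r. Qed.

(* With [q_0 = q] and [q_(k+1) = q_k - q_k ^ 2], one has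
   [q = q_0 ^ 2 + ... + q_(k-1) ^ 2 + q_k]. *)
Fixpoint sqr_remainder (q : A) (k : nat) : A :=
  if k is k'.+1 then sqr_remainder q k' - sqr_remainder q k' ^+ 2 else q.

Lemma sqr_remainderE q k :
  q = \sum_(i < k) sqr_remainder q i ^+ 2 + sqr_remainder q k.
Proof.
elim: k => [|k {1}->]; first by rewrite big_ord0 add0r.
by rewrite big_ord_recr /=; ring.
Qed.

Lemma sqr_remainder_pos q k : pos_mult q -> pos_mult (1 - q) ->
  pos_mult (sqr_remainder q k) /\ pos_mult (1 - sqr_remainder q k).
Proof.
move=> q0 q1; have p1 : pos_mult 1 by rewrite -(subrK q 1); exact: pos_multD.
elim: k => //= k; set r := sqr_remainder q k => -[r0 r1]; split.
  have -> : r - r ^+ 2 = (1 - r) * r ^+ 2 + r * (1 - r) ^+ 2 by ring.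
  by apply: pos_multD; exact: pos_mult_sqr.
have -> : 1 - (r - r ^+ 2) = 1 - r + r ^+ 2 by ring.
by apply: pos_multD => //; exact: pos_mult_sqr1.
Qed.

(** With q = r_0^2 + ... + r_(k-1)^2 + r_k, the squares are absorbed by b, so only L (b r_k p^2)
    could be negative. Cauchy-Schwarz controls it: the numbers L (r_i^2 p^2) have bounded partial
    sums, hence one of them is as small as desired. *)
Lemma pos_multM q b : pos_mult q -> pos_mult (1 - q) -> pos_mult b ->
  pos_mult (q * b).
Proof.
move=> q0 q1 b0 p.
have p1 : pos_mult 1 by rewrite -(subrK q 1); exact: pos_multD.
have rp k := (sqr_remainder_pos k q0 q1).1.
have small (e : R) : 0 < e ->
    exists k, L (sqr_remainder q k ^+ 2 * p ^+ 2) <= e.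
  move=> e0; apply/not_existsP => H.
  have {}H k : e < L (sqr_remainder q k ^+ 2 * p ^+ 2).
    by rewrite ltNge; apply/negP.
  pose N := Num.bound `|L (q * p ^+ 2) / e|.
  have : L (q * p ^+ 2) < N%:R * e.
    rewrite -ltr_pdivrMr//.
    exact: le_lt_trans (ler_norm _) (archi_boundP (normr_ge0 _)).
  apply/negP; rewrite -leNgt [X in L (X * _)](sqr_remainderE q N) mulrDl mulr_suml.
  rewrite linearD linear_sum -[leLHS]addr0 lerD//; last exact: rp.
  rewrite mulr_natl -[X in _ *+ X](card_ord N) -sumr_const ler_sum// => i _.
  exact: ltW.
apply/ler_addgt0Pr => e e0; rewrite -lerBlDr sub0r.
pose B := L (b ^+ 2 * p ^+ 2).
have B0 : 0 <= B by apply: pos_mult_sqr1.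
(* Weight for the Cauchy-Schwarz square (s b + c)^2. It gives s B <= e, while L (c^2 p^2) <= s e by
   the choice of c, so that L (b c p^2) >= - e. Adding 1 covers B = 0. *)
pose s := e / (B + 1).
have s0 : 0 < s by rewrite divr_gt0// ltr_wpDl.
have [k Ck] := small (s * e) (mulr_gt0 s0 e0).
set c := sqr_remainder q k in Ck.
have Lq : L (b * c * p ^+ 2) <= L (q * b * p ^+ 2).
  rewrite [X in _ <= L (X * b * _)](sqr_remainderE q k) -/c mulrDl mulr_suml
    mulrDl mulr_suml linearD.
  rewrite linear_sum (mulrC c) lerDr sumr_ge0// => i _.
  by rewrite (mulrC _ b) -mulrA -exprMn; exact: b0.
apply: le_trans Lq.
have := p1 ((s *: b + c) * p).
have -> : 1 * ((s *: b + c) * p) ^+ 2 =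
    (s *: b) ^+ 2 * p ^+ 2 + (s *: b) * c * p ^+ 2 *+ 2 + c ^+ 2 * p ^+ 2 by ring.
rewrite exprZn -!scalerAl 2!linearD linearMn !linearZ /= -/B => H.
have sB : s * B <= e.
  rewrite /s mulrAC ler_pdivrMr ?ltr_wpDl// mulrDr mulr1 lerDl ltW//.
rewrite -(ler_pM2l s0); nra.
Qed.

End positive_multipliers.

(** * Bounded integrands and finite measures *)

Lemma finite_measure_lty d (T : measurableType d) (R : realType)
  (mu : {finite_measure set T -> \bar R}) A : measurable A -> (mu A < +oo)%E.
Proof. by move=> mA; rewrite ltey_eq fin_num_measure. Qed.

Section bounded_integrals.
Context d (T : measurableType d) (R : realType).
Variables (mu : {measure set T -> \bar R}) (D : set T).
Hypotheses (mD : measurable D) (muD : (mu D < +oo)%E).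
Implicit Types f g : T -> R.

Lemma bounded_integrable f C : measurable_fun D f ->
  (forall x, D x -> `|f x| <= C) -> mu.-integrable D (EFin \o f).
Proof.
move=> mf fC; apply: measurable_bounded_integrable => //.
exists C; split; rewrite ?num_real// => y Cy x Dx; exact: le_trans (fC _ Dx) (ltW Cy).
Qed.

Lemma integrable_Rsum (I : Type) (s : seq I) (F : I -> T -> R) :
  (forall i, mu.-integrable D (EFin \o F i)) ->
  mu.-integrable D (EFin \o (fun x => \sum_(i <- s) F i x)).
Proof.
move=> iF; rewrite (_ : _ \o _ = fun x => (\sum_(i <- s) (EFin \o F i) x)%E).
  exact: integrable_sum.
by apply/funext => x /=; rewrite sumEFin.
Qed.

Lemma Rintegral_sum (I : Type) (s : seq I) (F : I -> T -> R) :
  (forall i, mu.-integrable D (EFin \o F i)) ->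
  \int[mu]_(x in D) (\sum_(i <- s) F i x) = \sum_(i <- s) \int[mu]_(x in D) F i x.
Proof.
move=> iF; elim: s => [|i s IH].
  rewrite big_nil; under eq_Rintegral do rewrite big_nil.
  by rewrite Rintegral_cst// mul0r.
rewrite big_cons; under eq_Rintegral do rewrite big_cons.
by rewrite RintegralD// ?IH//; exact: integrable_Rsum.
Qed.

Lemma Rintegral_dist f g e : mu.-integrable D (EFin \o f) ->
  mu.-integrable D (EFin \o g) -> (forall x, D x -> `|f x - g x| <= e) ->
  `|\int[mu]_(x in D) f x - \int[mu]_(x in D) g x| <= e * fine (mu D).
Proof.
move=> fi gi fg; rewrite -RintegralB//.
have fgi : mu.-integrable D (EFin \o (f \- g)).
  by rewrite (_ : _ \o _ = (EFin \o f) \- (EFin \o g))%E//; exact: integrableB.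
apply: le_trans (le_normr_Rintegral mD fgi) _.
rewrite -Rintegral_cst//; apply: le_Rintegral => //.
  exact: integrable_norm.
by apply: measurable_bounded_integrable => //; exact: bounded_cst.
Qed.

Lemma bounded_cvg_Rintegral (F : nat -> T -> R) f C :
  (forall k, measurable_fun D (F k)) -> measurable_fun D f ->
  (forall k x, D x -> `|F k x| <= C) ->
  (forall x, D x -> F k x @[k --> \oo] --> f x) ->
  \int[mu]_(x in D) F k x @[k --> \oo] --> \int[mu]_(x in D) f x.
Proof.
move=> mF mf FC Ff.
have iC : mu.-integrable D (EFin \o cst C).
  by apply: measurable_bounded_integrable => //; exact: bounded_cst.
have [|||||fi _ H] := @dominated_convergence _ T R mu D mD
  (fun k => EFin \o F k) (EFin \o f) (EFin \o cst C).
- by move=> k; exact/measurable_EFinP.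
- exact/measurable_EFinP.
- by apply: aeW => x Dx; apply: cvg_EFin; [exact: nearW|exact: Ff].
- exact: iC.
- by apply: aeW => x Dx k; rewrite /= lee_fin; exact: FC.
by apply: fine_cvg; rewrite fineK ?integrable_fin_num.
Qed.

Hypothesis muDC : mu (~` D) = 0%E.

Lemma supported_integrable f C : measurable_fun setT f ->
  (forall x, D x -> `|f x| <= C) -> mu.-integrable setT (EFin \o f).
Proof.
move=> mf fC; apply/(negligible_integrable _ _ _ muDC) => //.
- exact: measurableC.
- exact/measurable_EFinP.
- by rewrite setTD setCK; apply: (bounded_integrable _ fC); exact: measurable_funTS.
Qed.

Lemma supported_Rintegral f : mu.-integrable setT (EFin \o f) ->
  \int[mu]_x f x = \int[mu]_(x in D) f x.
Proof.
move=> fi; congr fine.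
rewrite (negligible_integral _ _ fi muDC)//; last exact: measurableC.
by rewrite setTD setCK.
Qed.

End bounded_integrals.

Section finite_pushforward.
Context d d' (T : measurableType d) (U : measurableType d') (R : realType).
Variables (mu : {finite_measure set T -> \bar R}) (f : T -> U).
Hypothesis mf : measurable_fun setT f.

Definition finite_pushforward of measurable_fun setT f : set U -> \bar R :=
  pushforward mu f.

Let push_measure : {measure set U -> \bar R} :=
  measure_function_pushforward__canonical__measure_function_Measure mu mf.

HB.instance Definition _ := Measure.copy (finite_pushforward mf) push_measure.

Let finite_pushforward_fin : fin_num_fun (finite_pushforward mf).
Proof.
move=> A mA; apply: fin_num_measure.
by rewrite -[X in measurable X]setTI; exact: mf.
Qed.

HB.instance Definition _ :=
  Measure_isFinite.Build _ _ _ (finite_pushforward mf) finite_pushforward_fin.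

Lemma Rintegral_pushforward (g : U -> R) : measurable_fun setT g ->
  mu.-integrable setT (EFin \o (g \o f)) ->
  (finite_pushforward mf).-integrable setT (EFin \o g) /\
  \int[finite_pushforward mf]_x g x = \int[mu]_x g (f x).
Proof.
move=> mg gi; have mg' : measurable_fun setT (EFin \o g) by exact/measurable_EFinP.
split; first exact: (integrable_pushforward mf mg').
by congr fine; rewrite [LHS](integral_pushforward mf mg').
Qed.

End finite_pushforward.

Lemma null_setU_ord d (T : measurableType d) (R : realType)
    (mu : {measure set T -> \bar R}) m (A : 'I_m -> set T) (B : set T) :
  (forall j, measurable (A j)) -> (forall j, mu (A j) = 0%E) -> measurable B ->
  (forall x, B x -> exists j, A j x) -> mu B = 0%E.
Proof.
move=> mA A0 mB BA; apply: measure_negligible => //.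
pose F k := if insub k is Some j then A j else set0.
apply: (@negligibleS _ _ _ _ (\bigcup_k F k)).
  by move=> x /BA[j Ajx]; exists (nat_of_ord j) => //; rewrite /F valK.
apply: negligible_bigcup => k; rewrite /F; case: insub => [j|].
  by exists (A j); split.
exact: negligible_set0.
Qed.

(** * Elementary inequalities on the unit interval *)

Section unit_interval_products.
Context {R : realFieldType}.

Lemma prod_unit (I : Type) (s : seq I) (a : I -> R) :
  (forall i, 0 <= a i <= 1) -> 0 <= \prod_(i <- s) a i <= 1.
Proof.
move=> a01; elim: s => [|i s /andP[p0 p1]]; first by rewrite big_nil ler01 lexx.
have /andP[a0 a1] := a01 i.
by rewrite big_cons mulr_ge0//= mulr_ile1.
Qed.

Lemma prod_dist (I : Type) (s : seq I) (a b : I -> R) :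
  (forall i, 0 <= a i <= 1) -> (forall i, 0 <= b i <= 1) ->
  `|\prod_(i <- s) a i - \prod_(i <- s) b i| <= \sum_(i <- s) `|a i - b i|.
Proof.
move=> a01 b01; elim: s => [|i s IH]; first by rewrite !big_nil subrr normr0.
rewrite !big_cons; have /andP[p0 p1] := prod_unit s a01.
have /andP[b0 b1] := b01 i.
set p := \prod_(j <- s) a j in IH p0 p1 *; set q := \prod_(j <- s) b j in IH *.
have -> : a i * p - b i * q = (a i - b i) * p + b i * (p - q) by ring.
apply: le_trans (ler_normD _ _) _; rewrite !normrM (ger0_norm p0) (ger0_norm b0).
by apply: lerD; [rewrite ler_piMr|rewrite (le_trans _ IH)// ler_piMl].
Qed.

Lemma expr_dist (a b : R) k : 0 <= a <= 1 -> 0 <= b <= 1 ->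
  `|a ^+ k - b ^+ k| <= k%:R * `|a - b|.
Proof.
move=> a01 b01.
have := @prod_dist _ (index_iota 0 k) (fun=> a) (fun=> b) (fun=> a01) (fun=> b01).
by rewrite !prodr_const_nat subn0 sumr_const_nat subn0 mulr_natl.
Qed.

Lemma expr_unit (a : R) k : 0 <= a <= 1 -> 0 <= a ^+ k <= 1.
Proof. by move=> /andP[a0 a1]; rewrite exprn_ge0// exprn_ile1. Qed.

Lemma monomial_dist (I : finType) (e : I -> nat) (a b : I -> R) (eps : R) :
  (forall i, 0 <= a i <= 1) -> (forall i, 0 <= b i <= 1) ->
  (forall i, `|a i - b i| <= eps) ->
  `|\prod_i a i ^+ e i - \prod_i b i ^+ e i| <= (\sum_i e i)%:R * eps.
Proof.
move=> a01 b01 ab; apply: le_trans (prod_dist _ _ _) _; try by move=> i; exact: expr_unit.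
rewrite natr_sum mulr_suml ler_sum// => i _.
by apply: le_trans (expr_dist _ (a01 i) (b01 i)) _; rewrite ler_wpM2l.
Qed.

End unit_interval_products.

Section bernoulli.
Context {R : realFieldType}.

Lemma bernoulli_ge (x : R) k : -1 <= x -> 1 + k%:R * x <= (1 + x) ^+ k.
Proof.
move=> x1; elim: k => [|k IH]; first by rewrite mul0r addr0 expr0.
have x10 : 0 <= 1 + x by rewrite addrC -[1]opprK subr_ge0.
have := ler_wpM2l x10 IH; rewrite exprS -natr1.
have : 0 <= k%:R * x ^+ 2 by rewrite mulr_ge0// sqr_ge0.
lra.
Qed.

(** Both signs of t are put into one inequality so that it can be integrated without splitting the
    domain. For t <= 0 the gain is Bernoulli's inequality with exponent 2 s; for t > 0 the minimum
    is 0 and the power is at most 1. *)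
Lemma support_test_bound (C t : R) s : 0 < C -> `|t| <= C ->
  t * ((1 - C^-1 * t) ^+ s) ^+ 2 + s%:R * 2 / C * Num.min t 0 ^+ 2 <= C.
Proof.
move=> C0; rewrite ler_norml => /andP[t1 t2].
have [t0|t0] := lerP t 0.
  have z0 : 0 <= - (C^-1 * t) by rewrite -mulrN mulr_ge0 ?invr_ge0 ?oppr_ge0// ltW.
  have z1 : -1 <= - (C^-1 * t) by rewrite (le_trans _ z0)// lerN10.
  have := ler_wnM2l t0 (bernoulli_ge (s * 2) z1); rewrite exprM.
  have -> : t * (1 + (s * 2)%:R * - (C^-1 * t)) = t - s%:R * 2 / C * t ^+ 2.
    by rewrite natrM; ring.
  lra.
have h0 : 0 <= 1 - C^-1 * t by rewrite subr_ge0 mulrC ler_pdivrMr ?mul1r.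
have h1 : 1 - C^-1 * t <= 1 by rewrite gerBl mulr_ge0 ?invr_ge0 // ltW.
rewrite expr0n mulr0 addr0 (le_trans _ t2)//; apply: ler_piMr; first exact: ltW.
by rewrite -exprM exprn_ile1.
Qed.

End bernoulli.

(** * Limits along ultrafilters *)

Section ultrafilter_limits.
Context {R : realType} {T : Type} (U : set_system T).
Hypothesis UU : UltraFilter U.

Lemma ultra_bounded_cvg (x : T -> R) C :
  (\forall t \near U, `|x t| <= C) -> cvg (x t @[t --> U]).
Proof.
move=> xC; have PU : ProperFilter U by exact: ultra_proper.
have [] := @segment_compact R (- C) C (x @ U) _.
  by apply: filterS xC => t; rewrite /= in_itv /= -ler_norml.
move=> l [_ xl]; apply/cvg_ex; exists l => V Vl.
have [//|UV] := in_ultra_setVsetC (x @^-1` V) UU.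
by have [y [/= + Vy]] := xl (~` V) V UV Vl.
Qed.

End ultrafilter_limits.

Lemma ultra_eventually : exists2 U : set_system nat, UltraFilter U & \oo `<=` U.
Proof. by have [U [UU ooU]] := ultraFilterLemma eventually_filter; exists U. Qed.

(** If x is not eventually in V, the eventual sets cut down to the indices where x avoids V generate
    a proper filter. An ultrafilter above it refines [\oo], and along it x cannot tend to l. *)
Lemma cvg_ultra {R : realType} (x : nat -> R) (l : R) :
  (forall U : set_system nat, UltraFilter U -> \oo `<=` U -> x k @[k --> U] --> l) ->
  x k @[k --> \oo] --> l.
Proof.
move=> H V Vl; apply: contrapT => nV.
pose F := filter_from \oo (fun A => A `&` ~` (x @^-1` V)).
have FF : ProperFilter F.
  apply: filter_from_proper; last first.
    move=> A ooA; apply: contrapT => A0; apply: nV.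
    apply: filterS ooA => k Ak; apply: contrapT => Vk.
    by apply: A0; exists k.
  apply: filter_from_filter; first by exists setT; exact: filterT.
  move=> A B ooA ooB; exists (A `&` B); first exact: filterI.
  by move=> k [[]].
have [U [UU FU]] := ultraFilterLemma FF.
have ooU : \oo `<=` U.
  by move=> A ooA; apply: FU; exists A => // k [].
have UV : U (x @^-1` V) := H U UU ooU V Vl.
have PU : ProperFilter U by exact: ultra_proper.
have UnV : U (~` (x @^-1` V)) by apply: FU; exists setT; [exact: filterT|move=> k []].
by have [k [/=]] := filter_ex (filterI UV UnV).
Qed.

Section finite_sums.
Context {R : realType} {T : Type} (F : set_system T) {FF : Filter F}.

Lemma cvg_Rsum (I : Type) (s : seq I) (x : I -> T -> R) (l : I -> R) :
  (forall i, x i t @[t --> F] --> l i) ->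
  \sum_(i <- s) x i t @[t --> F] --> \sum_(i <- s) l i.
Proof.
move=> xl; elim: s => [|i s IH].
  by rewrite big_nil; under eq_fun do rewrite big_nil; exact: cvg_cst.
by rewrite big_cons; under eq_fun do rewrite big_cons; exact: cvgD.
Qed.

Lemma cvg_Rprod (I : Type) (s : seq I) (x : I -> T -> R) (l : I -> R) :
  (forall i, x i t @[t --> F] --> l i) ->
  \prod_(i <- s) x i t @[t --> F] --> \prod_(i <- s) l i.
Proof.
move=> xl; elim: s => [|i s IH].
  by rewrite big_nil; under eq_fun do rewrite big_nil; exact: cvg_cst.
by rewrite big_cons; under eq_fun do rewrite big_cons; exact: cvgM.
Qed.

End finite_sums.

(** * The Hausdorff moment problem on the cube *)

Section binary_tree.
Context {R : realType} (m : seq bool -> R).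
Hypotheses (m_ge0 : forall w, 0 <= m w)
  (mE : forall w, m w = m (false :: w) + m (true :: w)).

(* Binary words are read from the right: [b :: w] is the word [w] followed by
   the digit [b].  The half-open interval of length [m w] starting at
   [word_left w] is the set of the points whose first digits are [w]. *)
Fixpoint word_left (w : seq bool) : R :=
  if w is b :: w' then word_left w' + (if b then m (false :: w') else 0) else 0.

Fixpoint word (j : nat) (s : R) : seq bool :=
  if j is j'.+1 then
    let w := word j' s in (word_left w + m (false :: w) <= s) :: w
  else [::].

Lemma size_word j s : size (word j s) = j.
Proof. by elim: j => //= j ->. Qed.

Local Notation root := (`[0, m [::][%classic).

Lemma wordP s w : root s ->
  (word (size w) s == w) = (word_left w <= s < word_left w + m w).
Proof.
rewrite /= in_itv /= => s01; elim: w => /= [|b w IH]; first by rewrite add0r s01.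
rewrite eqseq_cons; have [E|E] := eqVneq (word (size w) s) w; last first.
  rewrite andbF; move: IH; rewrite (negbTE E) => IH; apply/esym/negbTE/negP.
  move=> /andP[h1 h2]; have : word_left w <= s < word_left w + m w.
    have := m_ge0 (false :: w); have := m_ge0 (true :: w); rewrite (mE w).
    by case: b {E} h1 h2; lra.
  by rewrite -IH.
move: IH; rewrite E eqxx andbT => /esym/andP[h1]; rewrite (mE w) => h2.
have := m_ge0 (false :: w); have := m_ge0 (true :: w).
case: b => /= t0 f0; rewrite ?addr0;
  have [h|h] := lerP (word_left w + m (false :: w)) s; apply/esym; rewrite eqE /=.
- by rewrite -addrA h2.
- by [].
- by rewrite andbF.
- by rewrite h1.
Qed.

Lemma word_interval w s :
  word_left w <= s < word_left w + m w -> root s.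
Proof.
rewrite /= in_itv /=; elim: w => [|b w IH] /=; first by rewrite add0r.
move=> /andP[h1 h2]; apply: IH.
have := m_ge0 (false :: w); have := m_ge0 (true :: w); rewrite (mE w).
by case: b h1 h2; lra.
Qed.

Lemma lebesgue_root_fin : (lebesgue_measure (root : set R) < +oo)%E.
Proof. by rewrite lebesgue_measure_itv /=; case: ifP => _; rewrite ltry. Qed.

Lemma lebesgue_word w :
  lebesgue_measure (`[word_left w, word_left w + m w[%classic : set R) =
  (m w)%:E.
Proof.
rewrite lebesgue_measure_itv /= lte_fin ltrDl.
case: ltP => [_|mw] /=; first by rewrite -EFinD addrAC subrr add0r.
by congr EFin; apply/le_anti; rewrite m_ge0 mw.
Qed.

Definition word_measure : {finite_measure set (measurableTypeR R) -> \bar R} :=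
  @mfrestr _ (measurableTypeR R) R root lebesgue_measure
    (measurable_itv (`[0, m [::][)) lebesgue_root_fin.

Lemma word_measureE w :
  word_measure (`[word_left w, word_left w + m w[%classic) = (m w)%:E.
Proof.
rewrite /word_measure /mfrestr /mrestr -lebesgue_word; congr lebesgue_measure.
by apply/setIidPl => s /=; rewrite in_itv /=; exact: word_interval.
Qed.

(** A function of the first J digits is a step function on the intervals of the words of length J,
    and the interval of w has length [m w]. *)
Lemma integral_word J (psi : seq bool -> R) :
  word_measure.-integrable root (EFin \o (psi \o word J)) /\
  \int[word_measure]_(s in root) psi (word J s) =
  \sum_(w : J.-tuple bool) psi w * m w.
Proof.
pose I w := `[word_left w, word_left w + m w[%classic.
have E s : root s -> psi (word J s) =
    \sum_(w : J.-tuple bool) psi w * \1_(I w) s.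
  move=> s01; have sz : size (word J s) == J by rewrite size_word.
  have IP (w : J.-tuple bool) : I w s = (word J s == w).
    by rewrite /I /= in_itv /= -wordP// size_tuple.
  rewrite (bigD1 (Tuple sz)) //= big1 ?addr0 => [|w wn]; rewrite indicE.
    by rewrite mem_set ?mulr1// (IP (Tuple sz)) /=.
  rewrite memNset ?mulr0// IP => /eqP sw.
  by move/eqP: wn; apply; apply/val_inj; rewrite /= sw.
have mI w : measurable (I w) by exact: measurable_itv.
have iI (w : J.-tuple bool) : word_measure.-integrable root
    (EFin \o (fun s => psi w * \1_(I w) s)).
  apply: (@bounded_integrable _ _ _ _ _ _ _ _ `|psi w|) => //.
  - exact: finite_measure_lty.
  - apply: measurable_funM; first exact: measurable_cst.
    by apply: measurable_indic; exact: mI.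
  - move=> x _; rewrite normrM -[leRHS]mulr1 ler_wpM2l// indicE ger0_norm//.
    by rewrite lern1 leq_b1.
have iS : word_measure.-integrable root
    (EFin \o (fun s => \sum_(w : J.-tuple bool) psi w * \1_(I w) s)).
  by apply: integrable_Rsum => //; exact: measurable_itv.
split.
  apply: eq_integrable iS => // s; rewrite inE => s01 /=.
  by rewrite E.
transitivity (\int[word_measure]_(s in root)
    (\sum_(w : J.-tuple bool) psi w * \1_(I w) s)).
  by apply: eq_Rintegral => s; rewrite inE; exact: E.
rewrite Rintegral_sum//; apply: eq_bigr => w _.
rewrite RintegralZl//; last first.
  apply: (@bounded_integrable _ _ _ _ _ _ _ _ 1) => //.
  - exact: finite_measure_lty.
  - by apply: measurable_indic; exact: mI.
  - by move=> x _; rewrite indicE ger0_norm// lern1 leq_b1.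
congr (_ * _); rewrite /Rintegral integral_indic//.
rewrite (_ : _ `&` _ = I w); last first.
  by apply/setIidPl => s /=; rewrite in_itv /=; exact: word_interval.
- set E0 := (X in fine X); have -> : E0 = (m w)%:E by exact: word_measureE.
  by [].
- exact: mI.
Qed.

Lemma word_measure_setC : word_measure (~` root) = 0%E.
Proof. by rewrite /= /mfrestr /mrestr setICl measure0. Qed.

Lemma word_measure_root : fine (word_measure root) = m [::].
Proof.
by have := word_measureE [::]; rewrite /= add0r => ->.
Qed.

Lemma measurable_word_test j (P : pred (seq bool)) :
  measurable_fun root (fun s => (P (word j s))%:R : R).
Proof.
have [/(measurable_int word_measure)/measurable_EFinP + _] :=
  integral_word j (fun w => (P w)%:R).
exact.
Qed.

End binary_tree.

Section binary_expansion.
Context {R : realType}.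

Definition binary_sum (b : nat -> bool) (D : nat) : R :=
  \sum_(d < D) (b d)%:R * 2 ^- d.+1.

Lemma binary_sum_le b D k :
  binary_sum b D <= binary_sum b (D + k) <= binary_sum b D + (2 ^- D - 2 ^- (D + k)).
Proof.
elim: k => [|k /andP[h1 h2]]; first by rewrite addn0 subrr addr0 lexx.
rewrite addnS {2 3}/binary_sum !big_ord_recr /= -/(binary_sum b (D + k)).
have e0 : 0 <= 2 ^- (D + k).+1 :> R by rewrite invr_ge0 exprn_ge0.
have eE : 2 ^- (D + k) = 2 * 2 ^- (D + k).+1 :> R.
  by rewrite exprS invfM mulrA divff ?mul1r// pnatr_eq0.
by case: (b _); rewrite ?mul1r ?mul0r; move: h1 h2; rewrite eE; lra.
Qed.

Lemma binary_sum_ge0 b D : 0 <= binary_sum b D.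
Proof.
by rewrite sumr_ge0// => i _; rewrite mulr_ge0// invr_ge0 exprn_ge0.
Qed.

Lemma binary_sum_le1 b D : binary_sum b D <= 1.
Proof.
have /andP[_] := binary_sum_le b 0 D; rewrite add0n {2}/binary_sum big_ord0.
move=> /le_trans; apply; rewrite add0r expr0 invr1 gerBl invr_ge0.
by rewrite exprn_ge0.
Qed.

Definition binary_value (b : nat -> bool) : R := limn (binary_sum b).

Lemma is_cvg_binary_sum b : cvgn (binary_sum b).
Proof.
apply: nondecreasing_is_cvgn; last first.
  by exists 1 => _ [D _ <-]; exact: binary_sum_le1.
move=> D E DE; rewrite -(subnKC DE).
by have /andP[] := binary_sum_le b D (E - D).
Qed.

Lemma binary_value_approx b D : `|binary_value b - binary_sum b D| <= 2 ^- D.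
Proof.
have cb := @is_cvg_binary_sum b.
have H E : (D <= E)%N -> binary_sum b D <= binary_sum b E <= binary_sum b D + 2 ^- D.
  move=> DE; rewrite -(subnKC DE).
  have /andP[-> h] := binary_sum_le b D (E - D); apply: (le_trans h).
  by rewrite lerD2l gerBl invr_ge0 exprn_ge0.
rewrite ger0_norm ?subr_ge0; last first.
  by apply: limr_ge => //; exists D => // E /= /H /andP[].
by rewrite lerBlDl; apply: limr_le => //; exists D => // E /= /H /andP[].
Qed.

Lemma binary_value_itv b : 0 <= binary_value b <= 1.
Proof.
have cb := @is_cvg_binary_sum b; apply/andP; split.
  by apply: limr_ge => //; apply: nearW => D; exact: binary_sum_ge0.
by apply: limr_le => //; apply: nearW => D; exact: binary_sum_le1.
Qed.

End binary_expansion.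

Section tree_measure.
Context {R : realType} {n : nat} (m : seq bool -> R).
Hypotheses (m_ge0 : forall w, 0 <= m w)
  (mE : forall w, m w = m (false :: w) + m (true :: w)).

Definition word_digit (w : seq bool) (j : nat) : bool :=
  nth false w (size w - j.+1).

(* The digits of the n coordinates are interleaved in a single word: the d-th
   digit of the i-th coordinate is the letter [pickle (d, i)]. *)
Definition word_coord (w : seq bool) (D : nat) (i : 'I_n) : R :=
  binary_sum (fun d => word_digit w (pickle (d, i))) D.

Local Notation root := (`[0, m [::][%classic).

Let bit (j : nat) (s : R) : bool := head false (word m j.+1 s).

Lemma word_digitE N j s : (j < N)%N -> word_digit (word m N s) j = bit j s.
Proof.
rewrite /word_digit size_word; elim: N => // N IH.
rewrite ltnS leq_eqVlt => /predU1P[->|jN]; first by rewrite subnn.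
by rewrite subSS -(IH jN) -subnSK.
Qed.

Let coord (i : 'I_n) (s : R) : R := binary_value (fun d => bit (pickle (d, i)) s).

Let measurable_coord i : measurable_fun root (coord i).
Proof.
apply: (measurable_fun_cvg (h := fun D s =>
  binary_sum (fun d => bit (pickle (d, i)) s) D)).
  move=> D; apply: measurable_sum => d; apply: measurable_funM; last exact: measurable_cst.
  exact: (measurable_word_test m_ge0 mE _ (head false)).
by move=> s _; exact: is_cvg_binary_sum.
Qed.

(** Coordinates are set to 0 outside [root]: the map is then measurable on the whole line and takes
    values in the cube everywhere. *)
Let point (s : R) : 'rV[R]_n := \row_i (coord i \_ root) s.

Let measurable_point : measurable_fun [set: measurableTypeR R] point.
Proof.
apply: measurable_matrixP => i j; under eq_fun do rewrite mxE.
have mroot : measurable (root : set (measurableTypeR R)) := measurable_itv _.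
exact: (measurable_restrictT (coord j) mroot).1.
Qed.

Definition unit_cube : set 'rV[R]_n := [set x | forall i, 0 <= x ord0 i <= 1].

Let pointP s : unit_cube (point s).
Proof.
move=> i; rewrite mxE /patch; case: ifPn => _; last by rewrite lexx ler01.
exact: binary_value_itv.
Qed.

(** The measure is the image of Lebesgue measure on [root] under [point]. The first N letters
    contain D digits of every coordinate; truncating to these digits moves a monomial by at most its
    degree times 2^-D and turns its integral into a finite sum. *)
Lemma tree_measure : exists mu : {finite_measure set 'rV[R]_n -> \bar R},
  mu (~` unit_cube) = 0%E /\
  forall (a : multinom n) D N, (forall d (i : 'I_n), (d < D)%N -> (pickle (d, i) < N)%N) ->
  `|moment mu a -
    \sum_(w : N.-tuple bool) (\prod_i word_coord w D i ^+ a i) * m w| <=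
    (\sum_i a i)%:R * 2 ^- D * m [::].
Proof.
exists (finite_pushforward (word_measure m) measurable_point); split.
  rewrite /= /finite_pushforward /pushforward.
  rewrite (_ : _ @^-1` _ = set0) ?measure0//.
  by apply/seteqP; split=> // s /=; apply; exact: pointP.
move=> a D N DN.
have mpe : measurable_fun setT (fun x : 'rV[R]_n => peval (mpolyX R a) x).
  exact: measurable_peval.
have pe_unit x : unit_cube x -> `|peval (mpolyX R a) x| <= 1.
  move=> x01; rewrite /peval mevalX ger0_norm.
    by have /andP[] := prod_unit (index_enum 'I_n) (fun i => expr_unit (a i) (x01 i)).
  by apply: prodr_ge0 => i _; have /andP[] := expr_unit (a i) (x01 i).
have mroot : measurable (root : set (measurableTypeR R)) := measurable_itv _.
have pi : (word_measure m).-integrable setT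
    (EFin \o ((fun x => peval (mpolyX R a) x) \o point)).
  apply: (@bounded_integrable _ _ _ _ _ _ _ _ 1) => //.
  - exact: finite_measure_lty.
  - exact: measurableT_comp.
  - by move=> s _; apply: pe_unit; exact: pointP.
rewrite /moment (Rintegral_pushforward measurable_point mpe pi).2.
have rC := word_measure_setC m.
rewrite (supported_Rintegral mroot rC pi).
pose psi w := \prod_i word_coord w D i ^+ a i.
have [wi <-] := integral_word m_ge0 mE N psi.
rewrite -[X in _ <= _ * X](word_measure_root m_ge0 mE).
apply: Rintegral_dist => //.
- exact: finite_measure_lty.
- exact: (integrableS measurableT mroot (@subsetT _ _) pi).
- move=> s rs; rewrite /= /peval mevalX; apply: monomial_dist => i.
  + exact: pointP.
  + by rewrite /word_coord binary_sum_ge0 binary_sum_le1.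
  + rewrite mxE patchE mem_set//.
    rewrite (_ : word_coord _ _ _ = binary_sum (fun d => bit (pickle (d, i)) s) D).
      exact: binary_value_approx.
    by apply: eq_bigr => d _; rewrite word_digitE// DN.
Qed.
End tree_measure.

(** * Bernstein weights and the expansions of their nodes *)

Lemma mul_bin_ffact k j b : (b <= j)%N ->
  ('C(k, j) * j ^_ b = k ^_ b * 'C(k - b, j - b))%N.
Proof.
elim: b => [|b IH] bj; first by rewrite !ffactn0 !subn0 muln1 mul1n.
rewrite !ffactnSr mulnA IH ?(ltnW bj)// -!mulnA; congr (_ * _)%N.
have -> : (j - b = (j - b.+1).+1)%N by rewrite subnSK.
by rewrite mulnC -mul_bin_diag -subnS.
Qed.

(** These are the factorial moments of the binomial law. Falling factorials make them exact: they
    come out of the binomial coefficient and leave the expansion of (x + y)^(k - b) = 1. The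
    identity is used both for polynomials and for numbers, hence the general ring. *)
Lemma sum_bernstein_ffact (A : comPzRingType) (x y : A) k b : x + y = 1 ->
  \sum_(j < k.+1) (x ^+ j * y ^+ (k - j) *+ 'C(k, j)) *+ (j ^_ b) =
  x ^+ b *+ (k ^_ b).
Proof.
move=> xy; have [bk|kb] := leqP b k; last first.
  rewrite ffact_small// mulr0n big1// => j _; rewrite ffact_small ?mulr0n//.
  exact: leq_trans (ltn_ord j) kb.
rewrite -(big_mkord xpredT
  (fun j => (x ^+ j * y ^+ (k - j) *+ 'C(k, j)) *+ (j ^_ b))).
rewrite (big_cat_nat (leq0n b)) ?(leqW bk)//= big_nat big1 ?add0r; last first.
  by move=> j /andP[_ jb]; rewrite ffact_small ?mulr0n.
rewrite -{1}[b]add0n big_addn big_mkord.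
transitivity (\sum_(j < (k.+1 - b)) (x ^+ b *+ k ^_ b) *
    (y ^+ (k - b - j) * x ^+ j *+ 'C(k - b, j))).
  apply: eq_bigr => j _; rewrite -mulrnA mul_bin_ffact ?leq_addl// addnK.
  rewrite exprD [in X in y ^+ X]addnC subnDA mulrnAl mulrnAr -mulrnA mulnC.
  by congr (_ *+ _); rewrite -mulrA mulrCA [y ^+ _ * _]mulrC.
rewrite -mulr_sumr subSn// -exprDn addrC xy expr1n mulr1.
by [].
Qed.

Section ffact_ratio.
Context {R : realFieldType}.

(** For b <= k, the coefficient of x^b on the j-th Bernstein polynomial of degree k. *)
Definition ffact_ratio (k b j : nat) : R := (j ^_ b)%:R / (k ^_ b)%:R.

Lemma ffact_ratioE k b j :
  ffact_ratio k b j = \prod_(i <- iota 0 b) ((j - i)%:R / (k - i)%:R).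
Proof.
rewrite /ffact_ratio big_split /= prodfV -!natr_prod.
have E m : (m ^_ b = \prod_(i <- iota 0 b) (m - i))%N.
  by rewrite ffact_prod -(big_mkord xpredT (fun i => m - i)%N) /index_iota subn0.
by rewrite -!E.
Qed.

Lemma ffact_ratio_itv k b j : (j <= k)%N -> 0 <= ffact_ratio k b j <= 1.
Proof.
move=> jk; rewrite ffact_ratioE; apply: prod_unit => i.
rewrite divr_ge0//=; have [ki|ik] := leqP k i.
  by rewrite (eqP ki) invr0 mulr0.
by rewrite ler_pdivrMr ?ltr0n ?subn_gt0// mul1r ler_nat leq_sub2r.
Qed.

(** The two products are compared factor by factor. The node is j / (k + 1) and not j / k so that it
    stays below 1, where its binary digits are given by integer division. *)
Lemma ffact_ratio_approx k b j : (j <= k)%N -> (b < k)%N ->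
  `|ffact_ratio k b j - (j%:R / k.+1%:R) ^+ b| <= b%:R * (b.+1%:R / (k - b)%:R).
Proof.
move=> jk bk; rewrite ffact_ratioE.
rewrite (_ : _ ^+ b = \prod_(i <- iota 0 b) (j%:R / k.+1%:R)); last first.
  by have := prodr_const_nat 0 b (j%:R / k.+1%:R : R); rewrite /index_iota subn0.
apply: le_trans (prod_dist _ _ _) _.
- move=> i; rewrite divr_ge0//=; have [ki|ik] := leqP k i.
    by rewrite (eqP ki) invr0 mulr0.
  by rewrite ler_pdivrMr ?ltr0n ?subn_gt0// mul1r ler_nat leq_sub2r.
- move=> _; rewrite divr_ge0//= ler_pdivrMr// mul1r ler_nat.
  exact: leq_trans jk (leqnSn _).
set c := _ / (k - b)%:R.
have -> : b%:R * c = \sum_(i <- iota 0 b) c.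
  by have := sumr_const_nat b 0 c; rewrite /index_iota subn0 mulr_natl => ->.
rewrite big_seq [leRHS]big_seq; apply: ler_sum => i.
rewrite mem_iota add0n => /andP[_ ib]; rewrite /c.
have kb0 : 0 < (k - b)%:R :> R by rewrite ltr0n subn_gt0.
(* For j < i the truncated difference j - i is 0, and j / (k + 1) is small by itself since j < b. *)
have [ij|ji] := leqP i j; last first.
  have /eqP -> : (j - i == 0)%N by rewrite subn_eq0 ltnW.
  rewrite mul0r sub0r normrN ger0_norm ?divr_ge0//.
  rewrite ler_pM// ?invr_ge0// ?ler_nat ?lef_pV2 ?posrE ?ltr0n// ?ler_nat; lia.
have ki : (i < k)%N by lia.
have e : (j - i)%:R / (k - i)%:R - j%:R / k.+1%:R =
    (j%:R * i.+1%:R - i%:R * k.+1%:R) / ((k - i)%:R * k.+1%:R) :> R.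
  rewrite !natrB ?(ltnW ki)// -!natr1; field.
  by rewrite natr1 pnatr_eq0 -natrB ?(ltnW ki)// pnatr_eq0 subn_eq0 -ltnNge ki.
rewrite e normrM [`|_^-1|]ger0_norm ?invr_ge0 ?mulr_ge0// -!natrM.
apply: (@le_trans _ _ ((i.+1 * k.+1)%:R / ((k - i) * k.+1)%:R)).
  rewrite ler_wpM2r ?invr_ge0// ler_norml; apply/andP; split.
    by rewrite lerNl opprB lerBlDr -natrD ler_nat; nia.
  by rewrite lerBlDr -natrD ler_nat; nia.
rewrite !natrM -mulf_div divff ?pnatr_eq0// mulr1.
by rewrite ler_pM// ?invr_ge0// ?ler_nat ?lef_pV2 ?posrE ?ltr0n// ?ler_nat; lia.
Qed.

End ffact_ratio.

Section dyadic_digits.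

(* The d-th binary digit of the rational j / (k + 1) of [0, 1). *)
Definition ratio_digit (k j d : nat) : bool := odd ((2 ^ d.+1 * j) %/ k.+1).

Lemma binary_sum_ratio {R : realType} k j D : (j <= k)%N ->
  binary_sum (ratio_digit k j) D = ((2 ^ D * j) %/ k.+1)%:R / 2 ^+ D :> R.
Proof.
move=> jk; elim: D => [|D IH].
  by rewrite /binary_sum big_ord0 expn0 mul1n divn_small ?mul0r// ltnS.
rewrite /binary_sum big_ord_recr /= -/(binary_sum _ D) IH /ratio_digit.
set q := (_ %/ _)%N; set q' := (2 ^ D.+1 * j %/ k.+1)%N.
(* The quotient at depth D.+1 is the quotient at depth D followed by one more binary digit, its
   parity. *)
have e : q'./2 = q by rewrite /q' /q -divn2 -divnMA expnS -mulnA [(k.+1 * 2)%N]mulnC divnMA mulKn.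
have -> : q'%:R = (odd q')%:R + 2 * q%:R :> R.
  by rewrite -{1}(odd_double_half q') e natrD -mul2n natrM.
rewrite exprS; field.
by rewrite expf_neq0//= pnatr_eq0.
Qed.

Lemma binary_sum_ratio_approx {R : realType} k j D : (j <= k)%N ->
  `|binary_sum (ratio_digit k j) D - j%:R / k.+1%:R| <= 2 ^- D :> R.
Proof.
move=> jk; rewrite binary_sum_ratio//.
set q := (_ %/ _)%N.
have D0 : 0 < 2 ^+ D :> R by rewrite exprn_gt0.
have [h1 h2] : (q * k.+1 <= 2 ^ D * j)%N /\ (2 ^ D * j < q.+1 * k.+1)%N.
  by rewrite leq_trunc_div ltn_ceil.
rewrite distrC ler_norml; apply/andP; split.
  apply: (@le_trans _ _ 0); first by rewrite oppr_le0 invr_ge0 ltW.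
  by rewrite subr_ge0 ler_pdivrMr// mulrAC ler_pdivlMr// -natrX -!natrM ler_nat [(j * _)%N]mulnC.
rewrite lerBlDr -[X in _ <= X + _]mul1r -mulrDl ler_pdivrMr// mulrAC ler_pdivlMr//.
by rewrite addrC natr1 -natrX -!natrM ler_nat [(j * _)%N]mulnC ltnW.
Qed.

End dyadic_digits.

Section hausdorff_moments.
Context {R : realType} {n : nat} (L : {scalar mpoly n R}).
Local Notation X i := (mpolyX R (mnm1 i) : mpoly n R).
Hypothesis L_ge0 : forall j l : 'I_n -> nat,
  0 <= L (\prod_i (X i ^+ j i * (1 - X i) ^+ l i)).

(** The mass of the k-th discrete measure at the node with coordinates J i / (k + 1). *)
Definition bernstein_weight k (J : {ffun 'I_n -> 'I_k.+1}) : R :=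
  L (\prod_i (X i ^+ J i * (1 - X i) ^+ (k - J i) *+ 'C(k, J i))).

Lemma bernstein_weight_ge0 k (J : {ffun 'I_n -> 'I_k.+1}) : 0 <= bernstein_weight J.
Proof.
by rewrite /bernstein_weight prodrMn linearMn mulrn_wge0.
Qed.

Lemma sum_bernstein_weight k (b : 'I_n -> nat) : (forall i, b i <= k)%N ->
  \sum_J bernstein_weight J * \prod_i ffact_ratio k (b i) (J i : 'I_k.+1) =
  L (\prod_i X i ^+ b i).
Proof.
move=> bk.
transitivity (L (\sum_(J : {ffun 'I_n -> 'I_k.+1}) \prod_i
    (ffact_ratio k (b i) (J i) *:
      (X i ^+ J i * (1 - X i) ^+ (k - J i) *+ 'C(k, J i))))).
  rewrite linear_sum; apply: eq_bigr => J _.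
  by rewrite [in RHS]scaler_prod linearZ /= mulrC.
congr (L _).
rewrite -(bigA_distr_bigA (fun i (j : 'I_k.+1) => ffact_ratio k (b i) j *:
  (X i ^+ j * (1 - X i) ^+ (k - j) *+ 'C(k, j)))).
apply: eq_bigr => i _.
have kb0 : (k ^_ b i)%:R != 0 :> R by rewrite pnatr_eq0 -lt0n ffact_gt0.
apply: (scalerI kb0); rewrite [in RHS]scaler_nat -(@sum_bernstein_ffact _ _ (1 - X i)); last first.
  by rewrite addrC subrK.
rewrite scaler_sumr; apply: eq_bigr => j _.
by rewrite scalerA /ffact_ratio mulrC divfK// scaler_nat.
Qed.

(** The letters follow the interleaving of [word_coord]. A position that codes no pair (d, i) is
    never read back, and gets [false]. *)
Definition node_letter k (J : {ffun 'I_n -> 'I_k.+1}) (j : nat) : bool :=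
  if unpickle j is Some (d, i) then ratio_digit k (J i) d else false.

Definition node_word k (J : {ffun 'I_n -> 'I_k.+1}) (N : nat) : seq bool :=
  rev (mkseq (node_letter J) N).

Lemma size_node_word k (J : {ffun 'I_n -> 'I_k.+1}) N : size (node_word J N) = N.
Proof. by rewrite size_rev size_mkseq. Qed.

Lemma node_wordS k (J : {ffun 'I_n -> 'I_k.+1}) N :
  node_word J N.+1 = node_letter J N :: node_word J N.
Proof. by rewrite /node_word mkseqS rev_rcons. Qed.

Lemma word_coord_node k (J : {ffun 'I_n -> 'I_k.+1}) N D i :
  (forall d, (d < D)%N -> (pickle (d, i) < N)%N) ->
  word_coord (node_word J N) D i = binary_sum (ratio_digit k (J i)) D :> R.
Proof.
move=> DN; apply: eq_bigr => d _; congr (_%:R * _).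
have dN := DN d (ltn_ord d).
rewrite /word_digit size_node_word nth_rev ?size_mkseq ?subnKC//; last by lia.
rewrite nth_mkseq; last by lia.
rewrite (_ : N - (N - (pickle (nat_of_ord d, i)).+1).+1 = pickle (nat_of_ord d, i))%N.
  by rewrite /node_letter pickleK.
by lia.
Qed.

(** The mass of the cylinder of w under the k-th discrete measure. Its additivity relates three
    numbers only, so it survives any pointwise limit in k. *)
Definition node_mass k (w : seq bool) : R :=
  \sum_J bernstein_weight J * (node_word (J : {ffun 'I_n -> 'I_k.+1}) (size w) == w)%:R.

Lemma node_mass_ge0 k w : 0 <= node_mass k w.
Proof.
by apply: sumr_ge0 => J _; rewrite mulr_ge0 ?ler0n// bernstein_weight_ge0.
Qed.

Lemma node_massE k w :
  node_mass k w = node_mass k (false :: w) + node_mass k (true :: w).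
Proof.
rewrite /node_mass -big_split /=; apply: eq_bigr => J _.
rewrite -mulrDr node_wordS !eqseq_cons -natrD; congr (_ * _%:R).
by case: (node_letter _ _); case: (_ == _).
Qed.

Lemma sum_bernstein_weight1 k :
  \sum_J bernstein_weight (J : {ffun 'I_n -> 'I_k.+1}) = L 1.
Proof.
have := @sum_bernstein_weight k (fun=> 0%N) (fun=> leq0n _).
rewrite [Y in L Y]big1 => [<-|i _]; last by rewrite expr0.
apply: eq_bigr => J _; rewrite big1 ?mulr1// => i _.
by rewrite /ffact_ratio !ffactn0 divff.
Qed.

Lemma node_mass_le k w : node_mass k w <= L 1.
Proof.
rewrite -(sum_bernstein_weight1 k); apply: ler_sum => J _.
by rewrite ler_piMr ?bernstein_weight_ge0// lern1 leq_b1.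
Qed.

Lemma sum_node_mass k N (psi : seq bool -> R) :
  \sum_(w : N.-tuple bool) psi w * node_mass k w =
  \sum_J bernstein_weight J * psi (node_word (J : {ffun 'I_n -> 'I_k.+1}) N).
Proof.
under eq_bigr do rewrite /node_mass mulr_sumr.
rewrite exchange_big; apply: eq_bigr => J _ /=.
have sz : size (node_word J N) == N by rewrite size_node_word.
rewrite (bigD1 (Tuple sz)) //= big1 ?addr0 => [|w wn].
  by rewrite size_node_word eqxx mulr1 mulrC.
rewrite size_tuple; have [E|_] := eqVneq; last by rewrite !mulr0.
by move/eqP: wn; case; apply/val_inj; rewrite /= E.
Qed.

(** The first error truncates the expansions of the nodes, the second replaces factorial moments by
    powers. Twice the degree being below k gives k - a_i >= (k + 1) / 2, whence the factor 2 / (k +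
    1). *)
Lemma sum_node_mass_approx (a : multinom n) D N k :
  (forall d (i : 'I_n), (d < D)%N -> (pickle (d, i) < N)%N) ->
  ((\sum_i a i).*2 < k)%N ->
  `|\sum_(w : N.-tuple bool) (\prod_i word_coord w D i ^+ a i) * node_mass k w -
    L (mpolyX R a)| <=
  (\sum_i a i)%:R * (2 ^- D + (\sum_i a i).+1%:R * (2 * k.+1%:R^-1)) * L 1.
Proof.
set s := (\sum_i a i)%N => DN sk.
have as_ i : (a i <= s)%N by rewrite /s (bigD1 i)//= leq_addr.
rewrite (sum_node_mass k N (fun w => \prod_i word_coord w D i ^+ a i)).
rewrite mpolyXE_id -(@sum_bernstein_weight k a); last first.
  by move=> i; have := as_ i; lia.
rewrite -sumrB; apply: le_trans (ler_norm_sum _ _ _) _.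
rewrite mulrC -(sum_bernstein_weight1 k) mulr_suml; apply: ler_sum => J _.
rewrite -mulrBr normrM ger0_norm ?bernstein_weight_ge0//.
rewrite ler_wpM2l ?bernstein_weight_ge0//.
set p := \prod_i _; set q := \prod_i _.
(* The monomial at the exact node, halfway between the truncated node and the factorial ratios. *)
pose c := \prod_i ((J i)%:R / k.+1%:R : R) ^+ a i.
have Jk i : (J i <= k)%N by rewrite -ltnS.
have J01 i : 0 <= (J i)%:R / k.+1%:R <= (1 : R).
  rewrite divr_ge0//= ler_pdivrMr// mul1r ler_nat.
  exact: leq_trans (Jk i) (leqnSn _).
rewrite -(subrKA c) mulrDr; apply: le_trans (ler_normD _ _) _.
apply: lerD.
  apply: monomial_dist => i.
    by rewrite binary_sum_ge0 binary_sum_le1.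
  exact: J01.
  rewrite word_coord_node; last by move=> d; exact: DN.
  exact: binary_sum_ratio_approx.
rewrite distrC; apply: le_trans (prod_dist _ _ _) _.
- by move=> i; exact: ffact_ratio_itv.
- by move=> i; apply: expr_unit; exact: J01.
rewrite /s natr_sum mulr_suml; apply: ler_sum => i _.
have ai := as_ i.
apply: le_trans (ffact_ratio_approx _ _) _ => //; first by lia.
rewrite ler_wpM2l// -/s; apply: ler_pM; rewrite ?invr_ge0//.
  by rewrite ler_nat ltnS.
have ka0 : 0 < (k - a i)%:R :> R by rewrite ltr0n subn_gt0; lia.
rewrite ler_pdivlMr ?ltr0n// mulrC ler_pdivrMr// -natrM ler_nat; lia.
Qed.

(** The depth D is kept fixed while k tends to infinity along an ultrafilter, which removes the
    error of order 1 / k; D grows afterwards. *)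
Lemma hausdorff_moment_problem :
  exists mu : {finite_measure set 'rV[R]_n -> \bar R},
    mu (~` unit_cube) = 0%E /\ forall a, moment mu a = L (mpolyX R a).
Proof.
have [U UU ooU] := ultra_eventually.
have PU : ProperFilter U by exact: ultra_proper.
have cm w : cvg (node_mass k w @[k --> U]).
  apply: (@ultra_bounded_cvg _ _ _ _ _ (L 1)) => //; apply: nearW => k.
  by rewrite ger0_norm ?node_mass_ge0// node_mass_le.
pose m w := lim (node_mass k w @[k --> U]).
have m_ge0 w : 0 <= m w.
  by apply: limr_ge; [exact: cm|apply: nearW => k; exact: node_mass_ge0].
have mE w : m w = m (false :: w) + m (true :: w).
  apply: cvg_lim => //; under eq_fun do rewrite node_massE.
  by apply: cvgD; exact: cm.
have m_le w : m w <= L 1.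
  by apply: limr_le; [exact: cm|apply: nearW => k; exact: node_mass_le].
have [mu [muC muP]] := @tree_measure R n m m_ge0 mE.
exists mu; split=> // a.
set s := (\sum_i a i)%N.
(* The factor 2 counts two truncations to D digits: of the points in [tree_measure] and of the
   nodes. *)
suff H D : `|moment mu a - L (mpolyX R a)| <= s%:R * L 1 * 2 * 2 ^- D.
  apply/eqP; rewrite -subr_eq0 -normr_le0.
  have : s%:R * L 1 * 2 * 2 ^- D @[D --> \oo] --> (s%:R * L 1 * 2 * 0 : R).
    apply: cvgMr; under eq_fun do rewrite -exprVn; apply: cvg_expr.
    by rewrite ger0_norm ?invr_ge0// invf_lt1 ?ltr1n.
  rewrite mulr0 => /cvgr_to_ge; apply; apply: nearW => D; exact: H.
pose N := (\max_(d < D) \max_(i < n) (pickle (nat_of_ord d, i)).+1)%N.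
have DN d (i : 'I_n) : (d < D)%N -> (pickle (d, i) < N)%N.
  move=> dD; apply: leq_trans (leq_bigmax (Ordinal dD)).
  exact: leq_trans (leq_bigmax i).
have H1 := muP a D N DN.
pose S := \sum_(w : N.-tuple bool) (\prod_i word_coord w D i ^+ a i) * m w.
have H2 : `|S - L (mpolyX R a)| <= s%:R * (2 ^- D + s.+1%:R * (2 * 0)) * L 1.
  have c1 : (\sum_(w : N.-tuple bool)
      (\prod_i word_coord w D i ^+ a i) * node_mass k w) @[k --> U] --> S.
    by apply: cvg_Rsum => w; apply: cvgMr; exact: cm.
  have c2 : k.+1%:R^-1 @[k --> U] --> (0 : R).
    by apply: cvg_trans (@cvg_harmonic R); move=> A; exact: ooU.
  have c3 : `|(\sum_(w : N.-tuple bool)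
      (\prod_i word_coord w D i ^+ a i) * node_mass k w) - L (mpolyX R a)|
      @[k --> U] --> `|S - L (mpolyX R a)|.
    by apply: cvg_norm; apply: cvgB => //; exact: cvg_cst.
  have c4 : s%:R * (2 ^- D + s.+1%:R * (2 * k.+1%:R^-1)) * L 1 @[k --> U] -->
      s%:R * (2 ^- D + s.+1%:R * (2 * 0)) * L 1.
    apply: cvgMl; apply: cvgMr; apply: cvgD; first exact: cvg_cst.
    by do 2 apply: cvgMr.
  apply: (ler_cvg_to c3 c4); apply: ooU; exists (s.*2.+1) => // k /= sk.
  exact: sum_node_mass_approx.
rewrite -(subrKA S); apply: le_trans (ler_normD _ _) _.
have L10 : 0 <= L 1 by rewrite (le_trans (m_ge0 [::])).
have e0 : 0 <= s%:R * 2 ^- D :> R by rewrite mulr_ge0 ?invr_ge0 ?exprn_ge0.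
have : s%:R * 2 ^- D * m [::] <= s%:R * 2 ^- D * L 1 by rewrite ler_wpM2l.
rewrite 2!mulr0 addr0 in H2; move: H1 H2; rewrite -/s -/S; lra.
Qed.

End hausdorff_moments.

(** * Integrals of polynomials *)

Section polynomial_integrals.
Context {R : realType} {n : nat}.
Implicit Types (p q : mpoly n R) (x : 'rV[R]_n).

Lemma pevalD p q x : peval (p + q) x = peval p x + peval q x.
Proof. exact: rmorphD. Qed.

Lemma pevalN p x : peval (- p) x = - peval p x.
Proof. exact: rmorphN. Qed.

Lemma pevalM p q x : peval (p * q) x = peval p x * peval q x.
Proof. exact: rmorphM. Qed.

Lemma peval1 x : peval 1 x = 1.
Proof. exact: rmorph1. Qed.

Lemma pevalC c x : peval (mpolyC n c) x = c.
Proof. exact: mevalC. Qed.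

Lemma pevalXn p k x : peval (p ^+ k) x = peval p x ^+ k.
Proof. exact: rmorphXn. Qed.

Lemma pevalZ c p x : peval (c *: p) x = c * peval p x.
Proof. exact: mevalZ. Qed.

Lemma peval_sum (I : Type) (s : seq I) (F : I -> mpoly n R) x :
  peval (\sum_(i <- s) F i) x = \sum_(i <- s) peval (F i) x.
Proof. exact: rmorph_sum. Qed.

Lemma peval_prod (I : Type) (s : seq I) (P : pred I) (F : I -> mpoly n R) x :
  peval (\prod_(i <- s | P i) F i) x = \prod_(i <- s | P i) peval (F i) x.
Proof. exact: rmorph_prod. Qed.

Lemma peval_coord i x : peval (mpolyX R (mnm1 i)) x = x ord0 i.
Proof. exact: mevalXU. Qed.

Lemma peval_comp (f : n.-tuple (mpoly n R)) p x :
  peval (comp_mpoly f p) x = peval p (poly_map f x).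
Proof.
by rewrite /peval comp_mpoly_meval; apply: meval_eq => i; rewrite mxE.
Qed.

Lemma pevalE p x :
  peval p x = \sum_(a <- msupp p) mcoeff a p * peval (mpolyX R a) x.
Proof.
by rewrite {1}[p]mpolyE peval_sum; apply: eq_bigr => a _; rewrite pevalZ.
Qed.

Lemma peval_continuous p : continuous (peval p).
Proof.
move=> x; rewrite /peval; under eq_fun do rewrite mevalE.
apply: (cvg_Rsum (F := nbhs x)) => a; apply: cvgM; first exact: cvg_cst.
apply: (cvg_Rprod (F := nbhs x)) => i.
elim: (a i) => [|k IH]; first by rewrite expr0; exact: cvg_cst.
rewrite exprS; under eq_fun do rewrite exprS; apply: cvgM => //.
exact: coord_continuous.
Qed.

Definition box (b : R) : set 'rV[R]_n := [set x | forall i, `|x ord0 i| <= b].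

Lemma measurable_box b : measurable (box b).
Proof.
rewrite (_ : box b =
    \bigcap_(i in [set: 'I_n]) ((fun x => x ord0 i) @^-1` [set y | `|y| <= b])).
  apply: fin_bigcap_measurable => // i _; rewrite -[X in measurable X]setTI.
  apply: measurable_coord => //.
  rewrite (_ : [set y | _] = `[- b, b]%classic); first exact: measurable_itv.
  by apply/seteqP; split => y /=; rewrite in_itv /= ler_norml.
by apply/seteqP; split => x /= bx i; [move=> _|]; apply: bx.
Qed.

Lemma le_box b c : b <= c -> box b `<=` box c.
Proof. by move=> bc x bx i; exact: le_trans (bx i) bc. Qed.

Lemma peval_bounded p b : exists C, forall x, box b x -> `|peval p x| <= C.
Proof.
exists (\sum_(a <- msupp p) `|mcoeff a p| * \prod_i `|b| ^+ a i) => x bx.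
rewrite /peval mevalE; apply: le_trans (ler_norm_sum _ _ _) _.
apply: ler_sum => a _; rewrite normrM ler_wpM2l// normr_prod.
apply: ler_prod => i _; rewrite normr_ge0/= normrX lerXn2r ?nnegrE//.
exact: le_trans (bx i) (ler_norm b).
Qed.

Lemma riesz_linear (y : multinom n -> R) : linear_for *%R (riesz y).
Proof.
move=> c p q.
(* The index list depends on the polynomial, so the three sums are first extended to a common list
   of monomials. *)
have rieszE r (s : seq (multinom n)) : uniq s -> {subset msupp r <= s} ->
    riesz y r = \sum_(a <- s) mcoeff a r * y a.
  move=> us rs; rewrite /riesz.
  rewrite [RHS](bigID (fun a => a \in msupp r)) /= [X in _ + X]big1 ?addr0; last first.
    by move=> a /memN_msupp_eq0 ->; rewrite mul0r.
  rewrite -[RHS]big_filter; apply: perm_big; apply: uniq_perm.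
  - exact: msupp_uniq.
  - exact: filter_uniq.
  - by move=> a; rewrite mem_filter; case: (boolP (a \in msupp r)) => // /rs ->.
pose s := undup (msupp (c *: p + q) ++ msupp p ++ msupp q).
rewrite !(rieszE _ s) ?undup_uniq//; last 3 first.
- by move=> a; rewrite mem_undup !mem_cat => ->; rewrite !orbT.
- by move=> a; rewrite mem_undup !mem_cat => ->; rewrite !orbT.
- by move=> a; rewrite mem_undup !mem_cat => ->.
rewrite mulr_sumr -big_split /=; apply: eq_bigr => a _.
by rewrite mcoeffD mcoeffZ mulrDl mulrA.
Qed.

HB.instance Definition _ (y : multinom n -> R) :=
  GRing.isLinear.Build R (mpoly n R) R *%R (riesz y) (riesz_linear y).

Lemma rieszX (y : multinom n -> R) a : riesz y (mpolyX R a) = y a.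
Proof. by rewrite /riesz msuppX big_seq1 mcoeffX eqxx mul1r. Qed.

Lemma scalar_riesz (L : {scalar mpoly n R}) p :
  L p = riesz (fun a => L (mpolyX R a)) p.
Proof.
by rewrite {1}[p]mpolyE linear_sum; apply: eq_bigr => a _; rewrite linearZ.
Qed.

Definition bounded_support (mu : set 'rV[R]_n -> \bar R) :=
  exists2 b, mu (~` box b) = 0%E & (mu (box b) < +oo)%E.

Section bounded_support.
Variable mu : {measure set 'rV[R]_n -> \bar R}.
Hypothesis mub : bounded_support mu.

Lemma integrable_bounded_on (h : 'rV[R]_n -> R) : measurable_fun setT h ->
  (forall b, exists C, forall x, box b x -> `|h x| <= C) ->
  mu.-integrable setT (EFin \o h).
Proof.
move=> mh bh; have [b bC boo] := mub; have [C hC] := bh b.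
exact: (supported_integrable (measurable_box b) boo bC mh hC).
Qed.

Lemma integrable_peval p : mu.-integrable setT (EFin \o peval p).
Proof.
by apply: integrable_bounded_on; [exact: measurable_peval|exact: peval_bounded].
Qed.

Lemma Rintegral_peval p : \int[mu]_x peval p x = riesz (moment mu) p.
Proof.
under eq_Rintegral do rewrite pevalE.
rewrite Rintegral_sum//.
  by apply: eq_bigr => a _; rewrite RintegralZl//; exact: integrable_peval.
move=> a; under [X in _.-integrable _ X]eq_fun do rewrite /= -pevalZ.
exact: integrable_peval.
Qed.

End bounded_support.

End polynomial_integrals.

(** * Representing measures of positive functionals *)

Lemma measurable_unit_cube {R : realType} {n : nat} :
  measurable (unit_cube : set 'rV[R]_n).
Proof.
rewrite (_ : unit_cube =
    \bigcap_(i in [set: 'I_n]) ((fun x => x ord0 i) @^-1` `[0, 1])); last first.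
  apply/seteqP; split => x /= x01 i.
    by move=> _; rewrite /= in_itv /= x01.
  by have := x01 i Logic.I; rewrite /= in_itv.
apply: fin_bigcap_measurable => // i _; rewrite -[Y in measurable Y]setTI.
by apply: measurable_coord => //; exact: measurable_itv.
Qed.

Section putinar.
Context {R : realType} {n : nat} (L : {scalar mpoly n R}).
Local Notation X i := (mpolyX R (mnm1 i) : mpoly n R).
Hypothesis L1 : pos_mult L 1.
Variable N : int.
Hypothesis LN : pos_mult L (ball_poly N).

(** Chosen to be positive with square at least N, whatever the sign of N. *)
Let a : R := `|N|%:~R + 1.

Let a_gt0 : 0 < a.
Proof. by rewrite ltr_wpDl// ler0z. Qed.

Let a_sqr : 0 <= a ^+ 2 - N%:~R.
Proof.
have : (N%:~R : R) <= `|N|%:~R by rewrite ler_int ler_norm.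
have : 0 <= (`|N|%:~R : R) by rewrite ler0z.
rewrite /a; nra.
Qed.

Let pos_sqr p : pos_mult L (p ^+ 2).
Proof. exact: pos_mult_sqr1. Qed.

Let pos_mult0 : pos_mult L 0.
Proof. by move=> p; rewrite mul0r linear0. Qed.

Let pos_sqrB i : pos_mult L (mpolyC n (a ^+ 2) - X i ^+ 2).
Proof.
have -> : mpolyC n (a ^+ 2) - X i ^+ 2 =
    (a ^+ 2 - N%:~R) *: 1 + ball_poly N + \sum_(l < n | l != i) X l ^+ 2.
  rewrite /ball_poly (bigD1 i)//= -mul_mpolyC mulr1 rmorphB /=; ring.
apply: pos_multD; first by apply: pos_multD LN; exact: pos_multZ a_sqr L1.
by elim/big_ind: _ => [|p q|j _]; [exact: pos_mult0|exact: pos_multD|exact: pos_sqr].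
Qed.

(* [y i] is the i-th coordinate of the affine map sending the cube [-a, a]^n,
   which contains the semialgebraic set, to the unit cube. *)
Let y i : mpoly n R := (2 * a)^-1 *: (mpolyC n a + X i).

Let pos_y i : pos_mult L (y i) /\ pos_mult L (1 - y i).
Proof.
have a2 : 0 <= (2 * a)^-1 by rewrite invr_ge0 mulr_ge0// ltW.
(* A linear factor is not a square, but 2 a (a + s x) = (a + s x)^2 + (a^2 - x^2) when s is a sign.
   The cases s = 1 and s = -1 give y and 1 - y. *)
have pos s : s ^+ 2 = 1 -> pos_mult L (mpolyC n a + s *: X i).
  move=> s1; have -> : mpolyC n a + s *: X i =
      (2 * a)^-1 *: ((mpolyC n a + s *: X i) ^+ 2 + (mpolyC n (a ^+ 2) - X i ^+ 2)).
    apply: (@scalerI _ _ (2 * a)); first by rewrite mulf_neq0 ?pnatr_eq0 ?gt_eqF.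
    rewrite scalerA divff ?scale1r ?mulf_neq0 ?pnatr_eq0 ?gt_eqF//.
    rewrite sqrrD exprZn s1 scale1r rmorphXn /= -!mul_mpolyC rmorphM rmorph_nat.
    ring.
  by apply: pos_multZ => //; apply: pos_multD; [exact: pos_sqr|exact: pos_sqrB].
split.
  by apply: pos_multZ => //; rewrite -[X i]scale1r; apply: pos; rewrite expr1n.
have -> : 1 - y i = (2 * a)^-1 *: (mpolyC n a + (-1) *: X i).
  apply: (@scalerI _ _ (2 * a)); first by rewrite mulf_neq0 ?pnatr_eq0 ?gt_eqF.
  rewrite scalerBr !scalerA divff ?scale1r ?mulf_neq0 ?pnatr_eq0 ?gt_eqF//.
  by rewrite scaleN1r -mul_mpolyC mulr1 rmorphM rmorph_nat; ring.
by apply: pos_multZ => //; apply: pos; rewrite sqrrN expr1n.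
Qed.

(** The factors are multiplied in one at a time by [pos_multM], whose complement condition holds
    because y_i and 1 - y_i are both positive. *)
Let pos_prod (j l : 'I_n -> nat) : 0 <= L (\prod_i (y i ^+ j i * (1 - y i) ^+ l i)).
Proof.
suff /(_ 1) : pos_mult L (\prod_i (y i ^+ j i * (1 - y i) ^+ l i)).
  by rewrite expr1n mulr1.
have posX p k q : pos_mult L p -> pos_mult L (1 - p) -> pos_mult L q ->
    pos_mult L (p ^+ k * q).
  move=> p0 p1 q0; elim: k => [|k IH]; first by rewrite expr0 mul1r.
  by rewrite exprS -mulrA; exact: pos_multM.
elim/big_rec: _ => // i p _ p0; have [y0 y1] := pos_y i.
rewrite -mulrA; apply: (posX) => //; apply: posX => //.
by rewrite opprB addrC subrK.
Qed.

Let yt : n.-tuple (mpoly n R) := [tuple y i | i < n].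
Let L' (p : mpoly n R) : R := L (comp_mpoly yt p).

Let L'_linear : linear_for *%R L'.
Proof. by move=> c p q; rewrite /L' !linearP. Qed.

HB.instance Definition _ := GRing.isLinear.Build R (mpoly n R) R *%R L' L'_linear.

Let xt : n.-tuple (mpoly n R) := [tuple (2 * a) *: X i - mpolyC n a | i < n].

Let compK p : comp_mpoly yt (comp_mpoly xt p) = p.
Proof.
rewrite (comp_mpolyEX p) raddf_sum [RHS]mpolyE; apply: eq_bigr => b _ /=.
rewrite !linearZ /=; congr (_ *: _).
rewrite comp_mpolyX rmorph_prod [in RHS]mpolyXE_id; apply: eq_bigr => i _.
rewrite rmorphXn; congr (_ ^+ _).
rewrite tnth_mktuple /= comp_mpolyB comp_mpolyZ comp_mpolyC comp_mpolyXU -tnth_nth.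
rewrite tnth_mktuple scalerA divff ?mulf_neq0 ?pnatr_eq0 ?gt_eqF// scale1r.
by rewrite [_ + X i]addrC addrK.
Qed.

(** The functional [L'] meets the positivity hypothesis on the unit cube. Its measure there is
    carried to the box by x = 2 a y - a, the inverse of the affine map used to define [L']. *)
Lemma representing_measure_box : exists mu : {finite_measure set 'rV[R]_n -> \bar R},
  mu (~` box a) = 0%E /\ forall p, \int[mu]_x peval p x = L p.
Proof.
have [|nu [nuC nuE]] := @hausdorff_moment_problem R n L'.
  move=> j l; rewrite /=/L';rewrite rmorph_prod; have := pos_prod j l.
  congr (0 <= L _); apply: eq_bigr => i _.
  rewrite rmorphM !rmorphXn rmorphB rmorph1 /= comp_mpolyXU -tnth_nth.
  by rewrite tnth_mktuple.
have cube_box : (unit_cube : set 'rV[R]_n) `<=` box 1.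
  by move=> x x01 i; have /andP[x0 x1] := x01 i; rewrite ger0_norm.
have nub : bounded_support nu.
  exists 1; last by apply: finite_measure_lty; exact: measurable_box.
  apply/eqP; rewrite -measure_le0 -nuC le_measure// ?inE.
  - by apply: measurableC; exact: measurable_box.
  - by apply: measurableC; exact: measurable_unit_cube.
  - exact: subsetC.
have mA : measurable_fun setT (poly_map xt).
  apply: measurable_matrixP => i j; under eq_fun do rewrite mxE.
  exact: measurable_peval.
have mup p : \int[finite_pushforward nu mA]_x peval p x = L p.
  have pi : nu.-integrable setT (EFin \o (peval p \o poly_map xt)).
    rewrite (_ : _ \o _ = EFin \o peval (comp_mpoly xt p)).
      exact: integrable_peval.
    by apply/funext => x /=; rewrite peval_comp.
  rewrite (Rintegral_pushforward mA (measurable_peval p) pi).2.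
  under eq_Rintegral do rewrite -peval_comp.
  rewrite Rintegral_peval// -[in RHS](compK p) -/(L' _) [RHS]scalar_riesz.
  by congr riesz; apply/funext => b; rewrite nuE.
exists (finite_pushforward nu mA); split=> //.
apply: (subset_measure0 _ _ _ nuC).
- rewrite -[Y in measurable Y]setTI; apply: (mA) => //.
  by apply: measurableC; exact: measurable_box.
- by apply: measurableC; exact: measurable_unit_cube.
move=> x /= + x01; apply=> i; rewrite mxE tnth_mktuple.
rewrite pevalD pevalN pevalZ pevalC peval_coord ler_norml.
by have /andP[x0 x1] := x01 i; move: a_gt0 x0 x1; nra.
Qed.

End putinar.

Section support.
Context {R : realType} {n : nat}.
Variable mu : {finite_measure set 'rV[R]_n -> \bar R}.
Hypothesis mub : bounded_support mu.

(* Since (1 - q / C) ^ 2s <= 1 where q >= 0 and (1 - q / C) ^ 2s >= - 2s q / C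
   where q < 0, the integral of q (1 - q / C) ^ 2s tends to -oo with s unless
   q >= 0 almost everywhere. *)
Lemma support_nonneg (q : mpoly n R) :
  (forall p, 0 <= \int[mu]_x peval (q * p ^+ 2) x) ->
  mu [set x | peval q x < 0] = 0%E.
Proof.
move=> qpos; have [b bC boo] := mub.
have [C' qC'] := peval_bounded q b; pose C := `|C'| + 1.
have C0 : 0 < C by rewrite ltr_wpDl.
have qC x : box b x -> `|peval q x| <= C.
  move=> /qC' h; rewrite (le_trans h)// (le_trans (ler_norm _))//.
  by rewrite lerDl.
pose w x := Num.min (peval q x) 0 ^+ 2.
have mw : measurable_fun setT w.
  apply: measurable_funX; apply: measurable_minr => //.
  exact: measurable_peval.
have wC x : box b x -> `|w x| <= C ^+ 2.
  move=> /qC hC; rewrite /w ger0_norm ?sqr_ge0//; move: hC.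
  rewrite ler_norml => /andP[h1 h2]; case: (leP (peval q x) 0) => h; first by nra.
  by rewrite expr0n sqr_ge0.
have wi := supported_integrable (measurable_box b) boo bC mw wC.
have bound s : s%:R * 2 / C * (\int[mu]_x w x) <= C * fine (mu setT).
  pose p : mpoly n R := (1 - C^-1 *: q) ^+ s.
  have := qpos p; set I := Rintegral _ _ _ => I0.
  rewrite -RintegralZl// -Rintegral_cst//.
  rewrite -[leLHS]add0r; apply: le_trans (lerD I0 (lexx _)) _.
  have wi' : mu.-integrable setT (EFin \o (fun x => s%:R * 2 / C * w x)).
    exact: (integrableZl measurableT (s%:R * 2 / C) wi).
  rewrite /I -RintegralD//; last exact: integrable_peval.
  have iD : mu.-integrable setT (EFin \o (fun x => peval (q * p ^+ 2) x +
      s%:R * 2 / C * w x)).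
    exact: (integrableD measurableT (integrable_peval mub _) wi').
  have iC : mu.-integrable setT (EFin \o cst C).
    exact: finite_measure_integrable_cst.
  rewrite (supported_Rintegral (measurable_box b) bC iD).
  rewrite (supported_Rintegral (measurable_box b) bC iC).
  apply: le_Rintegral.
  - exact: measurable_box.
  - exact: (integrableS measurableT (measurable_box b) (@subsetT _ _) iD).
  - exact: (integrableS measurableT (measurable_box b) (@subsetT _ _) iC).
  move=> x /qC; rewrite /w pevalM !pevalXn pevalD pevalN pevalZ peval1.
  exact: support_test_bound.
have w0 : \int[mu]_x w x = 0.
  apply/le_anti/andP; split; last by apply: Rintegral_ge0 => x _; exact: sqr_ge0.
  rewrite leNgt; apply/negP => I0.
  pose K := C * fine (mu setT) / (2 / C * \int[mu]_x w x).
  have d0 : 0 < 2 / C * \int[mu]_x w x by rewrite mulr_gt0// divr_gt0.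
  have := archi_boundP (normr_ge0 K); rewrite ltNge => /negP; apply.
  apply: le_trans (ler_norm K).
  by rewrite /K ler_pdivlMr// mulrA mulrA; exact: bound.
have : (\int[mu]_x `|(w x)%:E| = 0)%E.
  under eq_integral => x _ do rewrite gee0_abs ?lee_fin ?sqr_ge0//.
  by rewrite -[LHS]fineK ?integrable_fin_num//; congr EFin; exact: w0.
move/ae_eq_integral_abs => [//||N [mN N0 sN]].
  exact/measurable_EFinP.
apply: (subset_measure0 _ mN _ N0).
  rewrite [X in measurable X](_ : _ = peval q @^-1` `]-oo, 0[); last first.
    by apply/seteqP; split => x /=; rewrite in_itv.
  rewrite -[X in measurable X]setTI; exact: measurable_peval.
move=> x /= qx; apply: sN => /= /(_ Logic.I) [] /eqP.
by rewrite /w min_l ?ltW// sqrf_eq0 lt_eqF.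
Qed.

End support.

Section representing_measure.
Context {R : realType} {n m : nat} (g : 'I_m -> mpoly n R).

Lemma representing_measure (L : {scalar mpoly n R}) (j0 : 'I_m) (N : int) :
  g j0 = ball_poly N -> pos_mult L 1 -> (forall j, pos_mult L (g j)) ->
  exists mu : {finite_measure set 'rV[R]_n -> \bar R},
    [/\ supported_on (semialgebraic_set g) mu, bounded_support mu &
        forall p, \int[mu]_x peval p x = L p].
Proof.
move=> gj0 L1 Lg; have LN : pos_mult L (ball_poly N) by rewrite -gj0.
have [mu [muC muE]] := representing_measure_box L1 LN.
have mub : bounded_support mu.
  by exists (`|N|%:~R + 1) => //; apply: finite_measure_lty; exact: measurable_box.
exists mu; split=> //.
have mneg j : measurable [set x | peval (g j) x < 0].
  rewrite [X in measurable X](_ : _ = peval (g j) @^-1` `]-oo, 0[); last first.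
    by apply/seteqP; split => x /=; rewrite in_itv.
  rewrite -[X in measurable X]setTI; exact: measurable_peval.
apply: (null_setU_ord mneg).
- by move=> j; apply: support_nonneg => // p; rewrite muE; exact: Lg.
- by apply: measurableC; exact: measurable_semialgebraic_set.
- move=> x /= /existsNP[j /negP]; rewrite -ltNge => gx.
  by exists j.
Qed.

End representing_measure.

(** * Determinacy of moments of boundedly supported measures *)

Section threshold.
Context {R : realType}.

(* These polynomials converge on [0, 1] to the indicator of [0, 1 / 2]. *)
Definition threshold k (t : R) : R :=
  (1 - t ^+ (k + k * k)) ^+ (2 ^ (k * k)).

Lemma threshold_itv k t : 0 <= t <= 1 -> 0 <= threshold k t <= 1.
Proof.
move=> t01; apply: expr_unit; have /andP[h0 h1] := expr_unit (k + k * k) t01.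
by rewrite subr_ge0 h1 gerBl h0.
Qed.

(** This identity dictates the exponents of [threshold]. Up to t = 1 / 2 included, (2 t)^k t is at
    most 1 / 2, thanks to the extra factor t; beyond 1 / 2 it exceeds 2 for large k. The outer k-th
    power turns both cases into a rate 2^-k. *)
Let scaleE k (t : R) :
  (2 ^ (k * k))%:R * t ^+ (k + k * k) = ((2 * t) ^+ k * t) ^+ k.
Proof. by rewrite natrX exprD !exprMn -!exprM; ring. Qed.

Let threshold_le k t : 0 <= t <= 1 / 2 -> 1 - 2 ^- k <= threshold k t.
Proof.
move=> /andP[t0 t12]; have t01 : 0 <= t <= 1 by apply/andP; split; lra.
have /andP[s0 s1] := expr_unit (k + k * k) t01.
have h : -1 <= - t ^+ (k + k * k) by rewrite lerN2.
apply: le_trans (bernoulli_ge _ h); rewrite mulrN lerD2l lerN2 scaleE.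
have t20 : 0 <= (2 * t) ^+ k by rewrite exprn_ge0// mulr_ge0.
rewrite -exprVn; apply: lerXn2r; rewrite ?nnegrE ?mulr_ge0//.
apply: (@le_trans _ _ t); last by lra.
by rewrite ler_piMl// exprn_ile1 ?mulr_ge0//; lra.
Qed.

(** Since (1 - s) (1 + s) <= 1, an upper bound on (1 - s)^M follows from a lower bound on (1 + s)^M,
    where Bernoulli applies. The constant 4 makes (2 t)^k t at least 2. *)
Let threshold_gt k t : 0 <= t <= 1 -> 4 <= (2 * t) ^+ k -> 1 / 2 < t ->
  threshold k t <= 2 ^- k.
Proof.
move=> t01 h4 t12; have /andP[s0 s1] := expr_unit (k + k * k) t01.
set s := t ^+ (k + k * k) in s0 s1; set M := (2 ^ (k * k))%N.
have Ms : 2 ^+ k <= (1 + s) ^+ M.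
  have h : -1 <= s by rewrite (le_trans _ s0)// lerN10.
  apply: le_trans (bernoulli_ge M h).
  rewrite -[leLHS]add0r lerD// /s scaleE.
  have t0 : 0 <= t by case/andP: t01.
  by apply: lerXn2r; rewrite ?nnegrE ?mulr_ge0//; nra.
have p0 : 0 < (1 + s) ^+ M by apply: lt_le_trans Ms; rewrite exprn_gt0.
apply: (@le_trans _ _ ((1 + s) ^- M)); last by rewrite lef_pV2// posrE exprn_gt0.
rewrite -[leRHS]div1r ler_pdivlMr// /threshold -/s -/M -exprMn.
by rewrite exprn_ile1//; nra.
Qed.

Lemma threshold_cvg (t : R) : 0 <= t <= 1 ->
  threshold k t @[k --> \oo] --> (((t <= 1 / 2)%R)%:R : R).
Proof.
move=> t01; have h2 : 2 ^- k @[k --> \oo] --> (0 : R).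
  under eq_fun do rewrite -exprVn; apply: cvg_expr.
  by rewrite ger0_norm ?invr_ge0// invf_lt1 ?ltr1n.
have [t12|t12] := lerP t (1 / 2).
  have h1 : 1 - 2 ^- k @[k --> \oo] --> (1 : R).
    by rewrite -[X in _ --> X]subr0; apply: cvgB => //; exact: cvg_cst.
  apply: (squeeze_cvgr _ h1 (cvg_cst (1 : R))); apply: nearW => k.
  have /andP[_ ->] := threshold_itv k t01.
  by rewrite threshold_le//; case/andP: t01 => -> _.
apply: (squeeze_cvgr _ (cvg_cst (0 : R)) h2).
have d0 : 0 < 2 * t - 1 by lra.
(* By Bernoulli (2 t)^k >= 1 + k (2 t - 1), which reaches 4 as soon as k >= 3 / (2 t - 1). *)
exists (Num.bound (3 / (2 * t - 1))) => // k /= hk.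
have /andP[-> _] := threshold_itv k t01.
apply: threshold_gt => //.
have h : -1 <= 2 * t - 1 by lra.
have := bernoulli_ge k h; rewrite [1 + (2 * t - 1)]addrC subrK => /(le_trans _); apply.
have : 3 / (2 * t - 1) <= k%:R.
  apply: ltW; apply: lt_le_trans (archi_boundP _) _; last by rewrite ler_nat.
  by rewrite divr_ge0// ltW.
rewrite ler_pdivrMr//; lra.
Qed.

End threshold.

Section determinacy.
Context {R : realType} {n : nat}.
Implicit Types (c : 'I_n -> R) (x : 'rV[R]_n).

Definition lower_orthant c : set 'rV[R]_n := [set x | forall i, x ord0 i <= c i].

Lemma measurable_lower_orthant c : measurable (lower_orthant c).
Proof.
rewrite (_ : lower_orthant c =
    \bigcap_(i in [set: 'I_n]) ((fun x => x ord0 i) @^-1` `]-oo, c i])).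
  apply: fin_bigcap_measurable => // i _; rewrite -[X in measurable X]setTI.
  by apply: measurable_coord => //; exact: measurable_itv.
apply/seteqP; split => x /= xc i; first by move=> _; rewrite /= in_itv /=.
by have := xc i Logic.I; rewrite /= in_itv.
Qed.

Definition orthants : set (set 'rV[R]_n) := [set A | exists c, A = lower_orthant c].

Lemma setI_closed_orthants : setI_closed orthants.
Proof.
move=> _ _ [c ->] [d ->]; exists (fun i => Num.min (c i) (d i)).
apply/seteqP; split => x /=.
  by move=> [xc xd] i; rewrite le_min xc xd.
by move=> xcd; split=> i; have := xcd i; rewrite le_min => /andP[].
Qed.

(** For the nontrivial inclusion, the identity map from the sigma-algebra of orthants is measurable
    because its coordinates are. *)
Lemma measurable_orthants : (measurable : set (set 'rV[R]_n)) = <<s orthants >>.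
Proof.
apply/seteqP; split => A; last first.
  move=> sA; apply: sA; split; first exact: sigma_algebra_measurable.
  by move=> _ [c ->]; exact: measurable_lower_orthant.
move=> mA; have mid : measurable_fun setT
    (idfun : g_sigma_algebraType orthants -> 'rV[R]_n).
  apply: measurable_matrixP => i j.
  have -> : i = ord0 by apply: ord_inj; case: i => -[].
  apply: (measurability _ (RGenOInfty.measurableE R)) => //.
  move=> _ [_ [a ->] <-]; rewrite setTI.
  (* A half-space x_j <= a is the union of the orthants bounded by a in direction j and by k in all
     others. *)
  rewrite (_ : _ @^-1` _ = ~` \bigcup_k lower_orthant
      (fun l => if l == j then a else k%:R)); last first.
    apply/seteqP; split => x /=; rewrite in_itv /= andbT.
      move=> ax [k _ /(_ j)]; rewrite eqxx leNgt => /negP; exact.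
    move=> nx; rewrite ltNge; apply/negP => xa; apply: nx.
    exists (\sum_l Num.bound `|x ord0 l|)%N => // l; case: ifPn => [/eqP ->//|lj].
    apply: le_trans (ler_norm _) _; apply: ltW.
    apply: lt_le_trans (archi_boundP (normr_ge0 _)) _; rewrite ler_nat.
    rewrite (_ : Num.bound `|x ord0 l| = Num.bound `|(`|x ord0 l|)|); last by rewrite normr_id.
    by rewrite (bigD1 l) //= normr_id leq_addr.
  apply: measurableC; apply: bigcupT_measurable => k.
  by apply: sub_sigma_algebra; eexists.
have := mid measurableT A mA; rewrite setTI preimage_id; exact.
Qed.

Section box_approximation.
Variable b : R.

(* An affine polynomial with values in [0, 1] on the box, and at most 1 / 2
   exactly where the i-th coordinate is at most c. *)
Let affine i (c : R) : mpoly n R :=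
  mpolyC n (1 / 2) + (2 * (`|b| + `|c| + 1))^-1 *: (mpolyX R (mnm1 i) - mpolyC n c).

Let affine_itv i (c : R) x : box b x -> 0 <= peval (affine i c) x <= 1.
Proof.
move=> /(_ i) xb; rewrite pevalD pevalC pevalZ pevalD pevalN pevalC peval_coord.
set d := _ + 1; have d0 : 0 < d by rewrite /d ltr_wpDl.
have : `|x ord0 i - c| <= d.
  rewrite (le_trans (ler_normB _ _))// /d -addrA lerD//.
    by rewrite (le_trans xb)// ler_norm.
  by rewrite lerDl.
move=> h; have : `|(2 * d)^-1 * (x ord0 i - c)| <= 1 / 2.
  have e0 : 0 <= (2 * d)^-1 by rewrite invr_ge0 mulr_ge0// ltW.
  rewrite normrM (ger0_norm e0) [leLHS]mulrC.
  by rewrite ler_pdivrMr ?mulr_gt0//; lra.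
by rewrite ler_norml => /andP[h1 h2]; apply/andP; split; lra.
Qed.

Let affine_le i (c : R) x : (peval (affine i c) x <= 1 / 2) = (x ord0 i <= c).
Proof.
rewrite pevalD pevalC pevalZ pevalD pevalN pevalC peval_coord.
by rewrite gerDl pmulr_rle0 ?subr_le0// invr_gt0 mulr_gt0// ltr_wpDl.
Qed.

Definition orthant_poly c k : mpoly n R :=
  \prod_i (1 - affine i (c i) ^+ (k + k * k)) ^+ (2 ^ (k * k)).

Lemma orthant_polyE c k x :
  peval (orthant_poly c k) x = \prod_i threshold k (peval (affine i (c i)) x).
Proof.
rewrite peval_prod; apply: eq_bigr => i _.
by rewrite pevalXn pevalD pevalN peval1 pevalXn.
Qed.

Lemma orthant_poly_itv c k x : box b x -> 0 <= peval (orthant_poly c k) x <= 1.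
Proof.
by move=> bx; rewrite orthant_polyE; apply: prod_unit => i;
  apply: threshold_itv; exact: affine_itv.
Qed.

Lemma orthant_poly_cvg c x : box b x ->
  peval (orthant_poly c k) x @[k --> \oo] --> (\1_(lower_orthant c) x : R).
Proof.
move=> bx; under eq_fun do rewrite orthant_polyE.
rewrite (_ : \1_(lower_orthant c) x = \prod_i ((x ord0 i <= c i)%R)%:R).
  apply: cvg_Rprod => i; rewrite -affine_le; apply: threshold_cvg.
  exact: affine_itv.
rewrite indicE; have [xc|xc] := pselect (lower_orthant c x).
  by rewrite mem_set// big1// => i _; rewrite xc.
rewrite memNset//; move/existsNP: xc => [i /negP/negbTE xc].
by rewrite (bigD1 i)//= xc mul0r.
Qed.

End box_approximation.

(** Orthants are stable under intersection, so agreement on them suffices. On a box the indicator of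
    an orthant is a bounded pointwise limit of polynomials, and dominated convergence concludes. *)
Lemma moment_determinacy (m1 m2 : {finite_measure set 'rV[R]_n -> \bar R}) :
  bounded_support m1 -> bounded_support m2 ->
  (forall a, moment m1 a = moment m2 a) -> same_measure m1 m2.
Proof.
move=> mb1 mb2 m12 A mA.
apply: (measure_unique orthants (fun k => lower_orthant (fun=> k%:R))) => //.
- exact: measurable_orthants.
- exact: setI_closed_orthants.
- by move=> k; eexists.
- apply/seteqP; split=> // x _.
  exists (\sum_l Num.bound `|x ord0 l|)%N => // l.
  apply: le_trans (ler_norm _) _; apply: ltW.
  apply: lt_le_trans (archi_boundP (normr_ge0 _)) _; rewrite ler_nat.
  by rewrite (bigD1 l) //= leq_addr.
- move=> _ [c ->].
  have [b1 b1C _] := mb1; have [b2 b2C _] := mb2.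
  (* The approximating polynomials depend on the box, so both measures must be placed in the same
     one. *)
  pose b := Num.max b1 b2.
  have bE (mu : {finite_measure set 'rV[R]_n -> \bar R}) b' : b' <= b ->
      mu (~` box b') = 0%E ->
      [/\ mu (~` box b) = 0%E, mu (lower_orthant c) =
          (\int[mu]_(x in box b) (\1_(lower_orthant c) x))%:E
      & forall k, \int[mu]_(x in box b) peval (orthant_poly b c k) x
         = riesz (moment mu) (orthant_poly b c k)].
    move=> b'b muC.
    have muCb : mu (~` box b) = 0%E.
      apply: subset_measure0 muC; [| |exact/subsetC/le_box];
        by apply: measurableC; exact: measurable_box.
    have mub : bounded_support mu.
      by exists b => //; apply: finite_measure_lty; exact: measurable_box.
    split=> // [|k].
      rewrite -supported_Rintegral//.
      - rewrite /Rintegral integral_indic ?setIT ?fineK ?fin_num_measure//;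
          exact: measurable_lower_orthant.
      - exact: measurable_box.
      - by apply: integrable_indic; exact: measurable_lower_orthant.
    rewrite -Rintegral_peval// [RHS](supported_Rintegral (measurable_box b) muCb)//.
    exact: integrable_peval.
  have [m1C E1 r1] := bE m1 b1 ltac:(by rewrite le_max lexx) b1C.
  have [m2C E2 r2] := bE m2 b2 ltac:(by rewrite le_max lexx orbT) b2C.
  apply: (eq_trans E1); apply: (eq_trans _ (esym E2)); congr EFin.
  have lim (mu : {finite_measure set 'rV[R]_n -> \bar R}) :
      \int[mu]_(x in box b) peval (orthant_poly b c k) x @[k --> \oo] -->
      \int[mu]_(x in box b) (\1_(lower_orthant c) x).
    apply: (@bounded_cvg_Rintegral _ _ _ _ _ _ _ _ _ 1).
    - exact: measurable_box.
    - apply: finite_measure_lty; exact: measurable_box.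
    - by move=> k; apply: measurable_funTS; exact: measurable_peval.
    - by apply: measurable_indic; exact: measurable_lower_orthant.
    - move=> k x bx; have /andP[h0 h1] := orthant_poly_itv c k bx.
      by rewrite ger0_norm.
    - by move=> x bx; exact: orthant_poly_cvg.
  have l1 := lim m1; have l2 := lim m2.
  have E : (fun k => \int[m1]_(x in box b) peval (orthant_poly b c k) x) =
      (fun k => \int[m2]_(x in box b) peval (orthant_poly b c k) x).
    apply/funext => k; rewrite r1 r2; congr riesz.
    by apply/funext => a; exact: m12.
  rewrite E in l1; apply: cvg_unique l1 l2; exact: Rhausdorff.
- by move=> k; apply: finite_measure_lty; exact: measurable_lower_orthant.
Qed.

End determinacy.

(** * Approximation of C^1 functions by Bernstein polynomials *)

Section bernstein_basis.

Definition bern {A : comPzRingType} (k j : nat) (x : A) : A :=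
  x ^+ j * (1 - x) ^+ (k - j) *+ 'C(k, j).

Section moments.
Context {R : realFieldType}.
Implicit Types (u : R).

Lemma bern_ge0 k j u : 0 <= u <= 1 -> 0 <= bern k j u.
Proof.
by move=> /andP[u0 u1]; rewrite mulrn_wge0// mulr_ge0 ?exprn_ge0 ?subr_ge0.
Qed.

Lemma bern_small k j u : (k < j)%N -> bern k j u = 0.
Proof. by move=> kj; rewrite /bern bin_small. Qed.

Lemma sum_bern_ffact k u b :
  \sum_(j < k.+1) bern k j u * (j ^_ b)%:R = u ^+ b * (k ^_ b)%:R.
Proof.
have u1 : u + (1 - u) = 1 by rewrite addrC subrK.
rewrite [RHS]mulr_natr -(sum_bernstein_ffact k b u1).
by apply: eq_bigr => j _; rewrite mulr_natr.
Qed.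

Lemma sum_bern k u : \sum_(j < k.+1) bern k j u = 1.
Proof.
have := sum_bern_ffact k u 0; rewrite expr0 ffactn0 mulr1 => <-.
by apply: eq_bigr => j _; rewrite ffactn0 mulr1.
Qed.

(** The centre c is left free: in the direction of differentiation the weights have degree K, with
    mean K u, but the grid of step 2 b / (K + 1) calls for the centre (K + 1) u. *)
Lemma bern_second_moment k u c : \sum_(j < k.+1) bern k j u * (j%:R - c) ^+ 2 =
  u ^+ 2 * (k%:R * (k%:R - 1)) + u * k%:R * (1 - 2 * c) + c ^+ 2.
Proof.
have ff2 m : (m ^_ 2)%:R = m%:R * (m%:R - 1) :> R.
  rewrite ffactnS ffactn1 natrM; case: m => [|m]; first by rewrite !mul0r.
  by rewrite -[m.+1%:R]natr1 addrK.
transitivity (\sum_(j < k.+1) bern k j u * (j ^_ 2)%:R +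
    (1 - 2 * c) * (\sum_(j < k.+1) bern k j u * (j ^_ 1)%:R) +
    c ^+ 2 * (\sum_(j < k.+1) bern k j u)).
  rewrite !mulr_sumr -!big_split /=; apply: eq_bigr => j _.
  by rewrite ff2 ffactn1; ring.
rewrite !sum_bern_ffact sum_bern ff2 ffactn1; ring.
Qed.

End moments.

Section derivative.
Context {R : realType} {n : nat}.
Implicit Types (p : mpoly n R).

Lemma mderiv_exp i p k : mderiv i (p ^+ k) = mderiv i p * p ^+ k.-1 *+ k.
Proof.
elim: k => [|k IH]; first by rewrite expr0 mulr0n -mpolyC1 mderivC.
rewrite exprS mderivM IH; case: k {IH} => [|k] /=.
  by rewrite expr0 mulr0n !mulr0 addr0 mulr1 mulr1n.
rewrite mulrnAr mulrCA -exprS [in RHS]mulrS.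
by [].
Qed.

Lemma peval_bern k j p x : peval (bern k j p) x = bern k j (peval p x).
Proof. by rewrite /peval rmorphMn rmorphM !rmorphXn rmorphB rmorph1. Qed.

Definition bern_pred {A : comPzRingType} (k j : nat) (x : A) : A :=
  if j is j'.+1 then bern k j' x else 0.

Lemma peval_bern_pred k j p x :
  peval (bern_pred k j p) x = bern_pred k j (peval p x).
Proof. by case: j => [|j] /=; [exact: rmorph0|exact: peval_bern]. Qed.

Lemma mderiv_bern i p k j : (j <= k.+1)%N ->
  mderiv i (bern k.+1 j p) = mderiv i p * (bern_pred k j p - bern k j p) *+ k.+1.
Proof.
move=> jk; rewrite /bern mderivMn mderivM !mderiv_exp mderivB -mpolyC1 mderivC.
rewrite mpolyC1 sub0r.
have e1 : mderiv i p * p ^+ j.-1 *+ j * (1 - p) ^+ (k.+1 - j) *+ 'C(k.+1, j) =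
    mderiv i p * bern_pred k j p *+ k.+1.
  case: j jk => [|j] jk; first by rewrite mulr0n mul0r !mul0rn mulr0 mul0rn.
  rewrite /= subSS /bern mulrnAl -mulrnA -mul_bin_diag /=.
  by rewrite mulrnAr -mulrnA mulrA mulnC.
have e2 : p ^+ j * (- mderiv i p * (1 - p) ^+ (k.+1 - j).-1 *+ (k.+1 - j))
    *+ 'C(k.+1, j) = - (mderiv i p * bern k j p *+ k.+1).
  rewrite [LHS](_ : _ = - (mderiv i p * (p ^+ j * (1 - p) ^+ (k - j)))
      *+ ((k.+1 - j) * 'C(k.+1, j))).
    by rewrite -mul_bin_down /= mulNrn mulnC [in RHS]/bern mulrnAr -mulrnA.
  rewrite mulrnAr -mulrnA (_ : (k.+1 - j).-1 = (k - j)%N) ?subSKn//.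
  by congr (_ *+ _); ring.
by rewrite mulrnDl e1 e2 mulrBr mulrnBl.
Qed.

End derivative.
End bernstein_basis.

(** * Partial derivatives of multivariate Bernstein polynomials *)

Section bernstein_operator.
Context {R : realType} {n : nat} (v : 'rV[R]_n -> R) (b : R).
Hypothesis b_gt0 : 0 < b.

Let unit_coord i : mpoly n R := (2 * b)^-1 *: (mpolyX R (mnm1 i) + mpolyC n b).

Let u (x : 'rV[R]_n) i : R := (x ord0 i + b) / (2 * b).

Let peval_unit_coord i x : peval (unit_coord i) x = u x i.
Proof. by rewrite pevalZ pevalD pevalC peval_coord mulrC. Qed.

Let u_itv x i : box b x -> 0 <= u x i <= 1.
Proof.
move=> /(_ i); rewrite ler_norml => /andP[h1 h2]; apply/andP; split.
  by apply: divr_ge0; [lra|rewrite mulr_ge0// ltW].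
by rewrite ler_pdivrMr ?mulr_gt0// mul1r; lra.
Qed.

Definition grid_point k (J : {ffun 'I_n -> 'I_k.+1}) : 'rV[R]_n :=
  \row_i (2 * b * (J i)%:R / k%:R - b).

(** The degree K + 1 in each variable avoids a division by zero at K = 0, and leaves degree K in the
    direction of differentiation. *)
Definition bernstein_poly K : mpoly n R :=
  \sum_(J : {ffun 'I_n -> 'I_K.+2})
    v (grid_point J) *: \prod_l bern K.+1 (J l) (unit_coord l).

Let mderiv_unit_coord i l :
  mderiv i (unit_coord l) = mpolyC n ((2 * b)^-1 * (l == i)%:R).
Proof.
rewrite mderivZ mderivD mderivC addr0 mderivX mnm1E.
have [->|_] := eqVneq l i; last by rewrite scale0r scaler0 mulr0 mpolyC0.
rewrite scale1r (_ : mnm_sub _ _ = mnm0) ?mpolyX0 ?mulr1 -?alg_mpolyC//.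
by apply/mnmP => j; rewrite mnmBE mnm0E subnn.
Qed.

Let mderiv_prod_one i (a : 'I_n -> mpoly n R) :
  (forall l, l != i -> mderiv i (a l) = 0) ->
  mderiv i (\prod_l a l) = mderiv i (a i) * \prod_(l | l != i) a l.
Proof.
move=> a0; rewrite (bigD1 i)//= mderivM [X in _ + _ * X](_ : _ = 0) ?mulr0 ?addr0//.
elim/big_ind : _ => [|p q p0 q0|l]; last exact: a0.
  by rewrite -mpolyC1 mderivC.
by rewrite mderivM p0 q0 mul0r mulr0 addr0.
Qed.

Section partial_derivative.
Variables (K : nat) (i : 'I_n) (x : 'rV[R]_n).

Definition bernstein_weight1 l j : R :=
  if l == i then bern K j (u x l) else bern K.+1 j (u x l).

Let weight (J : {ffun 'I_n -> 'I_K.+2}) : R := \prod_l bernstein_weight1 l (J l).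

(** The successor is cyclic so that it is a bijection and can reindex sums. The wrap from K + 1 to 0
    is harmless, since the degree K weight at K + 1 vanishes. *)
Definition grid_succ (J : {ffun 'I_n -> 'I_K.+2}) : {ffun 'I_n -> 'I_K.+2} :=
  [ffun l => if l == i then ordS (J l) else J l].

Let grid_succ_bij : bijective grid_succ.
Proof.
exists (fun J : {ffun 'I_n -> 'I_K.+2} =>
  [ffun l => if l == i then ord_pred (J l) else J l]) => J; apply/ffunP => l;
  by rewrite !ffunE; case: eqP => // _; rewrite ?ordSK ?ord_predK.
Qed.

Let bern_pred_ordS (j : 'I_K.+2) (y : R) : bern_pred K (ordS j) y = bern K j y.
Proof.
have [jK|Kj] := ltnP j K.+1; first by rewrite /= modn_small.
have jE : nat_of_ord j = K.+1 by apply/eqP; rewrite eqn_leq Kj -ltnS ltn_ord.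
by rewrite /= jE modnn bern_small.
Qed.

(** Summation by parts: the derivative of a Bernstein polynomial is a difference of consecutive
    weights, and shifting the index moves the difference onto v, as a difference quotient along the
    grid. *)
Lemma peval_mderiv_bernstein :
  peval (mderiv i (bernstein_poly K)) x =
  \sum_J weight J *
    (K.+1%:R / (2 * b) * (v (grid_point (grid_succ J)) - v (grid_point J))).
Proof.
pose rest (J : {ffun 'I_n -> 'I_K.+2}) := \prod_(l | l != i) bern K.+1 (J l) (u x l).
have weightE J : weight J = bern K (J i) (u x i) * rest J.
  rewrite /weight (bigD1 i)//= /bernstein_weight1 eqxx; congr (_ * _).
  by apply: eq_bigr => l /negbTE ->.
transitivity (\sum_(J : {ffun 'I_n -> 'I_K.+2}) K.+1%:R / (2 * b) *
    (v (grid_point J) * bern_pred K (J i) (u x i) * rest J -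
     v (grid_point J) * bern K (J i) (u x i) * rest J)).
  rewrite linear_sum peval_sum; apply: eq_bigr => J _.
  rewrite linearZ /= pevalZ mderiv_prod_one => [|l li].
    rewrite mderiv_bern; last by rewrite -ltnS.
    rewrite mderiv_unit_coord eqxx mulr1 pevalM peval_prod.
    rewrite [X in _ * (_ * X) = _](_ : _ = rest J); last first.
      by apply: eq_bigr => l _; rewrite peval_bern peval_unit_coord.
    rewrite -mulr_natl !pevalM pevalD pevalN pevalC.
    rewrite peval_bern peval_bern_pred peval_unit_coord /peval rmorph_nat.
    by rewrite invfM; ring.
  rewrite mderiv_bern; last by rewrite -ltnS.
  by rewrite mderiv_unit_coord (negbTE li) mulr0 mpolyC0 mul0r mul0rn.
rewrite -mulr_sumr sumrB (reindex grid_succ) /=; last exact: onW_bij grid_succ_bij.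
rewrite -sumrB mulr_sumr; apply: eq_bigr => J _.
rewrite weightE ffunE eqxx bern_pred_ordS (_ : rest (grid_succ J) = rest J).
  ring.
by apply: eq_bigr => l /negbTE li; rewrite ffunE li.
Qed.

Hypothesis xb : box b x.

Let weight1_ge0 l j : 0 <= bernstein_weight1 l j.
Proof.
by rewrite /bernstein_weight1; case: ifP => _; apply: bern_ge0; exact: u_itv.
Qed.

Let weight_ge0 J : 0 <= weight J.
Proof. by apply: prodr_ge0 => l _; exact: weight1_ge0. Qed.

Let weight_last (J : {ffun 'I_n -> 'I_K.+2}) : J i = K.+1 :> nat -> weight J = 0.
Proof.
move=> Ji; rewrite /weight (bigD1 i)//= /bernstein_weight1 eqxx Ji.
by rewrite bern_small// mul0r.
Qed.

Let sum_weight1 l : \sum_(j < K.+2) bernstein_weight1 l j = 1.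
Proof.
rewrite /bernstein_weight1; case: (l == i); last exact: sum_bern.
by rewrite big_ord_recr /= (@bern_small _ K K.+1)// addr0 sum_bern.
Qed.

Let weight_marginal l (phi : nat -> R) :
  \sum_J weight J * phi (J l) = \sum_(j < K.+2) bernstein_weight1 l j * phi j.
Proof.
transitivity (\sum_(J : {ffun 'I_n -> 'I_K.+2})
    \prod_k (bernstein_weight1 k (J k) * (if k == l then phi (J k) else 1))).
  apply: eq_bigr => J _; rewrite big_split /=; congr (_ * _).
  by rewrite (bigD1 l)//= eqxx big1 ?mulr1// => k /negbTE ->.
rewrite -(bigA_distr_bigA (fun k (j : 'I_K.+2) =>
  bernstein_weight1 k j * (if k == l then phi j else 1))).
rewrite (bigD1 l)//= [X in _ * X]big1 ?mulr1 => [|k /negbTE kl].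
  by apply: eq_bigr => j _; rewrite eqxx.
by under eq_bigr do rewrite kl mulr1; exact: sum_weight1.
Qed.

Let sum_weight : \sum_J weight J = 1.
Proof.
have := weight_marginal i (fun=> 1); under eq_bigr do rewrite mulr1.
by move=> ->; under eq_bigr do rewrite mulr1; exact: sum_weight1.
Qed.

(** The weights form a product law, so only its l-th marginal matters: a binomial variance, plus a
    squared bias when l = i. *)
Let weight_second_moment l :
  \sum_J weight J * (grid_point J ord0 l - x ord0 l) ^+ 2 <=
  4 * b ^+ 2 * K.+1%:R^-1.
Proof.
have K0 : K.+1%:R != 0 :> R by rewrite pnatr_eq0.
have b0 : b != 0 by rewrite gt_eqF.
pose c := (2 * b / K.+1%:R) ^+ 2.
have E j : (2 * b * j%:R / K.+1%:R - b - x ord0 l) ^+ 2 =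
    c * (j%:R - K.+1%:R * u x l) ^+ 2.
  rewrite /c -exprMn; congr (_ ^+ 2); rewrite /u.
  by field; rewrite b0 addrC natr1.
under eq_bigr do rewrite mxE E mulrCA.
rewrite -mulr_sumr (weight_marginal l (fun j => (j%:R - K.+1%:R * u x l) ^+ 2)).
have -> : 4 * b ^+ 2 * K.+1%:R^-1 = c * K.+1%:R by rewrite /c; field; rewrite addrC natr1.
apply: ler_wpM2l; first exact: sqr_ge0.
have /andP[u0 u1] := u_itv l xb.
have k0 : 0 <= K%:R :> R by [].
rewrite /bernstein_weight1; case: (l == i).
  rewrite big_ord_recr /= (@bern_small _ K K.+1)// mul0r addr0 bern_second_moment -[K.+1%:R]natr1.
  set k := K%:R in k0 *; set w := u x l in u0 u1 *.
  have -> : w ^+ 2 * (k * (k - 1)) + w * k * (1 - 2 * ((k + 1) * w)) +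
    ((k + 1) * w) ^+ 2 = k * (w * (1 - w)) + w ^+ 2 by ring.
  by apply: lerD; [rewrite ler_piMr//|]; nra.
rewrite bern_second_moment -[K.+1%:R]natr1.
set k := K%:R in k0 *; set w := u x l in u0 u1 *.
have -> : w ^+ 2 * ((k + 1) * (k + 1 - 1)) + w * (k + 1) * (1 - 2 * ((k + 1) * w)) +
  ((k + 1) * w) ^+ 2 = (k + 1) * (w * (1 - w)) by ring.
by rewrite ler_piMr//; nra.
Qed.

Let grid_box (J : {ffun 'I_n -> 'I_K.+2}) : box b (grid_point J).
Proof.
move=> l; rewrite mxE ler_norml -mulrA.
have h0 : 0 <= (J l)%:R / K.+1%:R :> R by rewrite divr_ge0.
have h1 : (J l)%:R / K.+1%:R <= 1 :> R.
  by rewrite ler_pdivrMr// mul1r ler_nat -ltnS.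
set r := _ / _ in h0 h1 *; have := b_gt0; have : 0 <= b * r by rewrite mulr_ge0// ltW.
have : b * r <= b by rewrite ler_piMr// ltW.
by move=> *; apply/andP; split; lra.
Qed.

Let grid_succE (J : {ffun 'I_n -> 'I_K.+2}) : (J i < K.+1)%N ->
  grid_point (grid_succ J) =
  (2 * b / K.+1%:R) *: delta_mx ord0 i + grid_point J.
Proof.
move=> Ji; apply/rowP => l; rewrite !mxE !ffunE eqxx /= eq_sym.
have [->|_] := eqVneq l i; last by rewrite mulr0 add0r.
by rewrite /= modn_small// mulr1 -natr1; ring.
Qed.

Let shift_coord (s : R) (z : 'rV[R]_n) l :
  (s *: delta_mx ord0 i + z) ord0 l = s * (l == i)%:R + z ord0 l.
Proof. by rewrite !mxE eqxx. Qed.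

Variable Dv : 'rV[R]_n -> R.
Hypothesis mvt : forall y h, 0 <= h ->
  exists2 s, 0 <= s <= h & v (h *: delta_mx ord0 i + y) - v y =
    h * Dv (s *: delta_mx ord0 i + y).

(** The mean value hypothesis turns the difference quotient into a value of [Dv] between
    neighbouring nodes. The last node in direction i has no right neighbour in the box, but its
    weight is 0. *)
Let intermediate (J : {ffun 'I_n -> 'I_K.+2}) : exists xi : 'rV[R]_n,
  [/\ box b xi, forall l, `|xi ord0 l - grid_point J ord0 l| <= 2 * b / K.+1%:R &
  weight J * (K.+1%:R / (2 * b) * (v (grid_point (grid_succ J)) - v (grid_point J)))
    = weight J * Dv xi].
Proof.
have h0 : 0 <= 2 * b / K.+1%:R by rewrite divr_ge0 ?mulr_ge0// ltW.
have [Ji|Ji] := ltnP (J i) K.+1; last first.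
  exists (grid_point J); split=> //.
    by move=> l; rewrite subrr normr0.
  by rewrite weight_last ?mul0r//; apply/eqP; rewrite eqn_leq Ji -ltnS ltn_ord.
rewrite grid_succE//.
have [s /andP[s0 sh] ->] := mvt (grid_point J) h0.
exists (s *: delta_mx ord0 i + grid_point J); split.
- move=> l; have := grid_box J l; have := grid_box (grid_succ J) l.
  rewrite grid_succE// !shift_coord !ler_norml => /andP[a1 a2] /andP[a3 a4].
  have c1 : s * (l == i)%:R <= 2 * b / K.+1%:R * (l == i)%:R by rewrite ler_wpM2r.
  have c2 : 0 <= s * (l == i)%:R by rewrite mulr_ge0.
  apply/andP; split; first by rewrite (le_trans a3)// lerDr.
  by apply: le_trans a2; rewrite lerD2r.
- move=> l; rewrite shift_coord addrK normrM ger0_norm// normr_nat.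
  by case: (l == i); rewrite ?mulr1// mulr0.
- congr (_ * _); rewrite mulrA [X in X * _](_ : _ = 1) ?mul1r//.
  by field; rewrite (gt_eqF b_gt0) addrC natr1 pnatr_eq0.
Qed.

Variable C : R.
Hypothesis DvC : forall y, box b y -> `|Dv y| <= C.

Lemma peval_mderiv_bernstein_bound :
  `|peval (mderiv i (bernstein_poly K)) x| <= C.
Proof.
rewrite peval_mderiv_bernstein; apply: le_trans (ler_norm_sum _ _ _) _.
rewrite -[leRHS]mul1r -[X in _ <= X * _]sum_weight mulr_suml.
apply: ler_sum => J _.
have [xi [xib _ ->]] := intermediate J.
by rewrite normrM ger0_norm// ler_wpM2l//; exact: DvC.
Qed.

(** Chebyshev's argument: an intermediate point near x costs at most e, a far one at most 2 C, which
    is below 2 C / d^2 times its squared distance to x. The weighted squared distances are of order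
    1 / (K + 1). *)
Lemma peval_mderiv_bernstein_approx e d : 0 < e -> 0 < d ->
  (forall y : 'rV[R]_n, (forall l, `|y ord0 l - x ord0 l| < d) -> `|Dv y - Dv x| <= e) ->
  `|peval (mderiv i (bernstein_poly K)) x - Dv x| <=
    e + 2 * C / d ^+ 2 * n%:R * (16 * b ^+ 2) * K.+1%:R^-1.
Proof.
move=> e0 d0 H; rewrite peval_mderiv_bernstein.
rewrite -[X in `|_ - X|]mul1r -[X in `|_ - X * _|]sum_weight mulr_suml -sumrB.
apply: le_trans (ler_norm_sum _ _ _) _.
have C0 : 0 <= C by exact: le_trans (normr_ge0 _) (DvC xb).
pose q := 2 * b / K.+1%:R.
have q0 : 0 <= q by rewrite divr_ge0 ?mulr_ge0// ltW.
pose a := 2 * C / d ^+ 2.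
have a0 : 0 <= a by apply: divr_ge0; [exact: mulr_ge0|exact: sqr_ge0].
apply: (@le_trans _ _ (\sum_J weight J * (e + a *
    \sum_l (2 * (grid_point J ord0 l - x ord0 l) ^+ 2 + 2 * q ^+ 2)))).
  apply: ler_sum => J _; have [xi [xib xig ->]] := intermediate J.
  rewrite -mulrBr normrM ger0_norm// ler_wpM2l//.
  apply: (@le_trans _ _ (e + a * \sum_l (xi ord0 l - x ord0 l) ^+ 2)); last first.
    rewrite lerD2l ler_wpM2l//; apply: ler_sum => l _.
    have := xig l; rewrite -/q ler_norml => /andP[q1 q2].
    set z := xi _ _ in q1 q2 *; set g := grid_point _ _ _ in q1 q2 *.
    have : (z - g) ^+ 2 <= q ^+ 2 by nra.
    have := sqr_ge0 ((z - g) - (g - x ord0 l)); nra.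
  have S0 : 0 <= \sum_l (xi ord0 l - x ord0 l) ^+ 2.
    by apply: sumr_ge0 => l _; exact: sqr_ge0.
  have [near|/existsNP[l /negP]] := pselect (forall l, `|xi ord0 l - x ord0 l| < d).
    by rewrite (le_trans (H _ near))// lerDl mulr_ge0.
  rewrite -leNgt => far.
  apply: (@le_trans _ _ (2 * C)).
    rewrite (le_trans (ler_normB _ _))// mulrC mulr_natr mulr2n.
    by apply: lerD; exact: DvC.
  rewrite -[leLHS]add0r lerD ?(ltW e0)// /a -mulrA ler_peMr ?mulr_ge0//.
  rewrite mulrC ler_pdivlMr ?exprn_gt0// mul1r.
  rewrite (bigD1 l)//= -[leLHS]addr0 lerD//; last first.
    by apply: sumr_ge0 => k _; exact: sqr_ge0.
  by rewrite -[leRHS]real_normK ?num_real// lerXn2r// nnegrE ltW.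
rewrite (eq_bigr (fun J => weight J * e + a * \sum_l
    (2 * (weight J * (grid_point J ord0 l - x ord0 l) ^+ 2) +
      2 * q ^+ 2 * weight J))); last first.
  move=> J _; rewrite mulrDr; congr (_ + _).
  rewrite mulrCA; congr (_ * _); rewrite mulr_sumr; apply: eq_bigr => l _; ring.
rewrite big_split /= -mulr_suml sum_weight mul1r lerD2l -mulr_sumr -/a.
have -> : a * n%:R * (16 * b ^+ 2) * K.+1%:R^-1 =
  a * (n%:R * (16 * b ^+ 2 * K.+1%:R^-1)) by rewrite !mulrA.
rewrite ler_wpM2l// exchange_big /= [leRHS]mulr_natl -[X in _ <= _ *+ X]card_ord.
rewrite -sumr_const.
apply: ler_sum => l _; rewrite big_split /= -!mulr_sumr sum_weight mulr1.
(* The constant 16 is 8 from twice the second moment plus 8 from 2 q^2, where one of the two factors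
   1 / (K + 1) is dropped. *)
apply: (@le_trans _ _ (2 * (4 * b ^+ 2 * K.+1%:R^-1) + 2 * q ^+ 2)).
  by rewrite lerD2r ler_wpM2l//; exact: weight_second_moment.
have -> : 16 * b ^+ 2 * K.+1%:R^-1 =
  2 * (4 * b ^+ 2 * K.+1%:R^-1) + 8 * b ^+ 2 * K.+1%:R^-1 by ring.
rewrite lerD2l /q.
have i0 : 0 <= K.+1%:R^-1 :> R by rewrite invr_ge0.
have i1 : K.+1%:R^-1 <= 1 :> R by rewrite invf_le1// ler1n.
have -> : 2 * (2 * b / K.+1%:R) ^+ 2 =
  8 * b ^+ 2 * K.+1%:R^-1 * K.+1%:R^-1 by ring.
by rewrite ler_piMr// mulr_ge0// mulr_ge0// sqr_ge0.
Qed.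

End partial_derivative.

End bernstein_operator.

Section C1_functions.
Context {R : realType} {n : nat}.
Implicit Types (v : 'rV[R]_n -> R) (i : 'I_n).
Local Notation e i := (delta_mx ord0 i : 'rV[R]_n).

Lemma is_derive_line v i y (s : R) : derivable v (s *: e i + y) (e i) ->
  is_derive s 1 (fun r => v (r *: e i + y)) ('D_(e i) v (s *: e i + y)).
Proof.
move=> dv.
have E : (fun h : R => h^-1 *: (((fun r => v (r *: e i + y)) \o shift s) (h *: 1) -
    v (s *: e i + y))) =
  (fun h => h^-1 *: ((v \o shift (s *: e i + y)) (h *: e i) - v (s *: e i + y))).
  apply/funext => h /=; congr (_ *: (v _ - _)).
  by rewrite [h *: 1]mulr1 scalerDl addrA.
by apply: DeriveDef; [rewrite /derivable E|rewrite /derive E].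
Qed.

Lemma C1_mvt v i y (h : R) : C1 v -> 0 <= h ->
  exists2 s, 0 <= s <= h &
    v (h *: e i + y) - v y = h * 'D_(e i) v (s *: e i + y).
Proof.
move=> [dv _] h0.
have cont : {within `[0, h], continuous (fun r : R => v (r *: e i + y))}.
  apply: continuous_subspaceT => r.
  apply: (@continuous_comp _ _ _ (fun r : R => r *: e i + y) v).
    by apply: cvgD; [apply: cvgZr_tmp|]; [exact: cvg_id|exact: cvg_cst].
  exact: differentiable_continuous.
have [s|s sh E] := @MVT_segment R (fun r => v (r *: e i + y))
    (fun s => 'D_(e i) v (s *: e i + y)) 0 h h0 _ cont.
  move=> _; apply: is_derive_line; exact: diff_derivable.
exists s; first by move: sh; rewrite in_itv.
by move: E; rewrite scale0r add0r subr0 mulrC.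
Qed.

Lemma compact_box (b : R) : compact (box b : set 'rV[R]_n).
Proof.
rewrite (_ : box b = [set x : 'rV[R]_n | forall i, `[- b, b]%classic (x ord0 i)]).
  by apply: (@rV_compact _ _ (fun=> `[- b, b]%classic)) => _; exact: segment_compact.
by apply/seteqP; split=> x /= bx i; have := bx i; rewrite in_itv /= ler_norml.
Qed.

Lemma continuous_box_bounded (h : 'rV[R]_n -> R) b : continuous h ->
  exists C, forall x, box b x -> `|h x| <= C.
Proof.
move=> ch; have /compact_bounded[C [_ hC]] : compact (h @` box b).
  apply: continuous_compact (@compact_box b).
  exact: continuous_subspaceT.
exists (C + 1) => x bx; apply: (hC (C + 1)); first by rewrite ltrDl.
by exists x.
Qed.

Lemma C1_bernstein_cvg v i b x : C1 v -> 0 < b -> box b x ->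
  peval (mderiv i (bernstein_poly v b K)) x @[K --> \oo] --> 'D_(e i) v x.
Proof.
move=> vC1 b0 bx; have [_ cD] := vC1.
have [C DC] := continuous_box_bounded b (cD i).
apply/cvgrPdist_le => eps eps0.
have e20 : 0 < eps / 2 by rewrite divr_gt0.
have /cvgrPdist_le /(_ _ e20) /nbhs_ballP[d /= d0 xd] := cD i x.
have H (y : 'rV[R]_n) : (forall l, `|y ord0 l - x ord0 l| < d) ->
    `|'D_(e i) v y - 'D_(e i) v x| <= eps / 2.
  move=> yx; rewrite distrC; apply: xd; split=> // k l.
  have -> : k = ord0 by apply: ord_inj; case: k => -[].
  by rewrite /ball /= distrC.
pose Q := 2 * C / d ^+ 2 * n%:R * (16 * b ^+ 2).
have Q0 : Q * K.+1%:R^-1 @[K --> \oo] --> (Q * 0 : R).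
  by apply: cvgMr; exact: cvg_harmonic.
rewrite mulr0 in Q0.
have /cvgrPdist_le /(_ _ e20) := Q0; apply: filterS => K /=.
rewrite sub0r normrN => QK.
have mvt y h := @C1_mvt v i y h vC1.
rewrite distrC; apply: le_trans
  (peval_mderiv_bernstein_approx b0 K bx mvt DC e20 d0 H) _.
rewrite -/Q [leRHS]splitr lerD2l.
exact: le_trans (ler_norm _) QK.
Qed.

Lemma C1_bernstein_bounded v i b : C1 v -> 0 < b ->
  exists C, forall K x, box b x ->
    `|peval (mderiv i (bernstein_poly v b K)) x| <= C.
Proof.
move=> vC1 b0; have [_ cD] := vC1.
have [C DC] := continuous_box_bounded b (cD i).
exists C => K x bx; apply: (peval_mderiv_bernstein_bound b0 K bx _ DC) => y h.
exact: C1_mvt.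
Qed.

End C1_functions.

Lemma continuous_measurable_rV {R : realType} {n : nat} (k : 'rV[R]_n -> R) :
  continuous k -> measurable_fun setT k.
Proof.
move=> /continuousP ck; apply: (measurability _ (RGenOpens.measurableE R)) => //.
move=> _ [B [l [r ->]] <-]; rewrite setTI; apply: open_measurable_matrix.
by apply: ck; exact: interval_open.
Qed.

Section continuous_time.
Context {R : realType} {n : nat}.
Variables (f : n.-tuple (mpoly n R)) (mu : {finite_measure set 'rV[R]_n -> \bar R}).
Hypothesis mub : bounded_support mu.

Lemma C1_flux_continuous v : C1 v -> continuous
  (fun x => \sum_(i < n) 'D_(delta_mx ord0 i) v x * peval (tnth f i) x).
Proof.
move=> [_ cD] x; apply: (cvg_Rsum (F := nbhs x)) => i; apply: cvgM; first exact: cD.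
exact: peval_continuous.
Qed.

(** The partial derivatives of the Bernstein polynomials of v converge pointwise to those of v and
    are uniformly bounded on the box, so that dominated convergence passes the polynomial identities
    to v. *)
Lemma C1_invariance : (forall p, \int[mu]_x peval (transport Defs.Continuous f p) x = 0) ->
  forall v, C1 v ->
  \int[mu]_x (\sum_(i < n) 'D_(delta_mx ord0 i) v x * peval (tnth f i) x) = 0.
Proof.
move=> inv v vC1; have [b' bC' boo] := mub; have [_ cD] := vC1.
pose b := `|b'| + 1; have b0 : 0 < b by rewrite ltr_wpDl.
have b'b : b' <= b by rewrite (le_trans (ler_norm _))// lerDl.
have bC : mu (~` box b) = 0%E.
  apply: subset_measure0 bC'; [| |exact/subsetC/le_box];
    by apply: measurableC; exact: measurable_box.
pose h x := \sum_(i < n) 'D_(delta_mx ord0 i) v x * peval (tnth f i) x.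
have ch : continuous h by exact: C1_flux_continuous.
have mc := @continuous_measurable_rV.
have mbox := @measurable_box R n b.
pose V K i := mderiv i (bernstein_poly v b K).
pose hk K x := \sum_(i < n) peval (V K i) x * peval (tnth f i) x.
have hkE K x : hk K x = peval (transport Defs.Continuous f (bernstein_poly v b K)) x.
  by rewrite /= peval_sum; apply: eq_bigr => i _; rewrite pevalM.
have [C hkC] : exists C, forall K x, box b x -> `|hk K x| <= C.
  have [c cP] := choice (fun i => C1_bernstein_bounded i vC1 b0).
  have [d dP] := choice (fun i => peval_bounded (tnth f i) b).
  exists (\sum_i c i * d i) => K x bx; apply: le_trans (ler_norm_sum _ _ _) _.
  apply: ler_sum => i _; rewrite normrM ler_pM//; first exact: cP.
  exact: dP.
have [D hD] := continuous_box_bounded b ch.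
have hi := supported_integrable mbox (finite_measure_lty mu mbox) bC (mc _ _ h ch) hD.
rewrite -/(h _) (supported_Rintegral mbox bC hi).
have lim : \int[mu]_(x in box b) hk K x @[K --> \oo] --> \int[mu]_(x in box b) h x.
  apply: (@bounded_cvg_Rintegral _ _ _ _ _ _ _ _ _ C) => //.
  - exact: finite_measure_lty.
  - move=> K; apply: measurable_funTS; rewrite (_ : hk K = peval
      (transport Defs.Continuous f (bernstein_poly v b K))); last exact/funext.
    exact: measurable_peval.
  - by apply: measurable_funTS; exact: mc.
  - move=> x bx; apply: cvg_Rsum => i; apply: cvgM; last exact: cvg_cst.
    exact: C1_bernstein_cvg.
have E : (fun K => \int[mu]_(x in box b) hk K x) = (fun=> 0).
  apply/funext => K; under eq_Rintegral do rewrite hkE.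
  rewrite -(supported_Rintegral mbox bC) ?inv//; exact: integrable_peval.
by rewrite E in lim; apply: cvg_unique lim (cvg_cst _); exact: Rhausdorff.
Qed.

End continuous_time.

(** * The linear program over measures *)

Section measure_difference.
Context d (T : measurableType d) (R : realType).
Variables m1 m2 : {finite_measure set T -> \bar R}.

(* The difference is truncated at 0 because a measure has to be nonnegative
   also on non-measurable sets. *)
Definition measure_diff of (forall A, measurable A -> (m2 A <= m1 A)%E) :=
  fun A : set T => (Num.max 0 (fine (m1 A) - fine (m2 A)))%:E.

Hypothesis m21 : forall A, measurable A -> (m2 A <= m1 A)%E.
Local Notation md := (measure_diff m21).

Let mdE A : measurable A -> md A = (fine (m1 A) - fine (m2 A))%:E.
Proof.
move=> mA; congr EFin; apply/max_idPr; rewrite subr_ge0.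
by apply: fine_le; rewrite ?fin_num_measure// m21.
Qed.

Lemma measure_diffE A : measurable A -> md A = (m1 A - m2 A)%E.
Proof. by move=> mA; rewrite mdE// EFinB !fineK// fin_num_measure. Qed.

Let md0 : md set0 = 0%E.
Proof. by rewrite mdE// !measure0 subrr. Qed.

Let md_ge0 A : (0 <= md A)%E.
Proof. by rewrite lee_fin le_max lexx. Qed.

Let md_sigma_additive : semi_sigma_additive md.
Proof.
move=> F mF tF mUF; rewrite mdE//.
rewrite (_ : (fun k => _) = fun k => ((\sum_(0 <= i < k) fine (m1 (F i))) -
    (\sum_(0 <= i < k) fine (m2 (F i))))%:E); last first.
  apply/funext => k; rewrite -sumrB -sumEFin; apply: eq_bigr => i _.
  exact: mdE.
apply: cvg_EFin; first exact: nearW.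
have H (m : {finite_measure set T -> \bar R}) :
    \sum_(0 <= i < k) fine (m (F i)) @[k --> \oo] --> fine (m (\bigcup_k F k)).
  have := @measure_semi_sigma_additive _ _ _ m F mF tF mUF.
  rewrite -[X in _ --> X -> _]fineK ?fin_num_measure// => /fine_cvg.
  rewrite [X in X @ _ --> _ -> _](_ : _ = fun k => \sum_(0 <= i < k) fine (m (F i)))//.
  apply/funext => k /=; by rewrite sum_fine// => i _; exact: fin_num_measure.
exact: cvgB.
Qed.

HB.instance Definition _ := isMeasure.Build _ _ _ md md0 md_ge0 md_sigma_additive.

Let md_fin : fin_num_fun md.
Proof. by move=> A mA; rewrite mdE. Qed.

HB.instance Definition _ := Measure_isFinite.Build _ _ _ md md_fin.

End measure_difference.

Section lebesgue_on.
Context {R : realType}.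

Lemma lebesgue_rV_box n (b : R) : (lebesgue_rV n (box b) < +oo)%E.
Proof.
elim: n => [|n IH].
  by rewrite /= (le_lt_trans (probability_le1 _ (measurable_box b)))// ltry.
rewrite /= /lebesgue_step /pushforward.
rewrite (_ : _ @^-1` _ = `[- b, b]%classic `*` box b); last first.
  apply/seteqP; split => -[y x] /=.
    move=> bx; split.
      have := bx ord0; rewrite mxE unlift_none /= in_itv /= ler_norml.
      exact.
    by move=> i; have := bx (lift ord0 i); rewrite mxE liftK.
  move=> [by_ bx] i; rewrite mxE; case: unliftP => [k _|_] /=; first exact: bx.
  by move: by_; rewrite /= in_itv /= ler_norml.
rewrite product_measure1E//; last exact: measurable_box.
have itv_fin : (lebesgue_measure (`[(- b)%R, b]%classic : set R) < +oo)%E.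
  by rewrite lebesgue_measure_itv /=; case: ifP => _; rewrite ltry.
by apply: lte_mul_pinfty => //; rewrite ge0_fin_numE//; exact: itv_fin.
Qed.

End lebesgue_on.

Section ball_constraint.
Context {R : realType} {n m : nat} (g : 'I_m -> mpoly n R).
Local Notation X := (semialgebraic_set g).

Lemma semialgebraic_set_box j (N : int) :
  g j = ball_poly N -> X `<=` box (`|N|%:~R + 1).
Proof.
move=> gj x /= /(_ j); rewrite gj /ball_poly pevalD pevalN pevalC peval_sum.
under eq_bigr do rewrite pevalXn peval_coord.
move=> h i; have N0 : 0 <= (`|N|%:~R : R) by rewrite ler0z.
rewrite -(@ler_pXn2r _ 2) ?nnegrE ?addr_ge0// real_normK ?num_real//.
apply: (@le_trans _ _ (N%:~R)).
  rewrite -subr_ge0 (le_trans h)// lerD2l lerN2 (bigD1 i)//= lerDl sumr_ge0//.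
  by move=> k _; exact: sqr_ge0.
apply: (@le_trans _ _ `|N|%:~R); first by rewrite ler_int ler_norm.
nra.
Qed.

Hypothesis hball : exists (j : 'I_m) (N : int), g j = ball_poly N.

Lemma supported_bounded (mu : {finite_measure set 'rV[R]_n -> \bar R}) :
  supported_on X mu -> bounded_support mu.
Proof.
move=> muC; have [j [N gj]] := hball; exists (`|N|%:~R + 1).
  apply: subset_measure0 muC.
  - by apply: measurableC; exact: measurable_box.
  - by apply: measurableC; exact: measurable_semialgebraic_set.
  - by apply: subsetC; exact: semialgebraic_set_box gj.
by apply: finite_measure_lty; exact: measurable_box.
Qed.

Lemma lebesgue_semialgebraic_fin : (lebesgue_rV n X < +oo)%E.
Proof.
have [j [N gj]] := hball.
apply: le_lt_trans (lebesgue_rV_box n (`|N|%:~R + 1)).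
apply: le_measure; rewrite ?inE.
- exact: measurable_semialgebraic_set.
- exact: measurable_box.
- exact: semialgebraic_set_box gj.
Qed.

Definition finite_lebesgue_on : {finite_measure set 'rV[R]_n -> \bar R} :=
  mfrestr (measurable_semialgebraic_set g) lebesgue_semialgebraic_fin.

Lemma lebesgue_on_supported : supported_on X (lebesgue_on g).
Proof. by rewrite /supported_on /lebesgue_on /mrestr setICl measure0. Qed.

End ball_constraint.

Section unit_mass.
Context d (T : measurableType d) (R : realType).
Variable mu : {finite_measure set T -> \bar R}.
Hypothesis mu1 : mu setT = 1%E.

(** Carrying the proof as an argument lets the copy be a probability, to which the uniqueness of the
    invariant probability applies. *)
Definition unit_mass of mu setT = 1%E : set T -> \bar R := mu.

HB.instance Definition _ := Measure.copy (unit_mass mu1) mu.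

HB.instance Definition _ := Measure_isProbability.Build _ _ _ (unit_mass mu1) mu1.

End unit_mass.

Section dominated_measures.
Context d (T : measurableType d) (R : realType).

(** Domination on the complement of A becomes the reverse inequality on A once the total masses
    agree. This makes the optimal [nu] unique. *)
Lemma le_measure_eq (m1 m2 : {finite_measure set T -> \bar R}) :
  (forall A, measurable A -> (m1 A <= m2 A)%E) -> m1 setT = m2 setT ->
  forall A, measurable A -> m1 A = m2 A.
Proof.
move=> m12 mT A mA; apply/eqP; rewrite eq_le m12//=.
have AC (m : {finite_measure set T -> \bar R}) : m A = (m setT - m (~` A))%E.
  have mAC : measurable (~` A) by exact: measurableC.
  by rewrite -(setUv A) measureU ?setICr// addeK// fin_num_measure.
rewrite (AC m1) (AC m2) mT leeB// m12//; exact: measurableC.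
Qed.

End dominated_measures.

Section linear_program.
Context {R : realType} {n : nat} (t : time) (f : n.-tuple (mpoly n R)).
Context {m : nat} (g : 'I_m -> mpoly n R).
Local Notation X := (semialgebraic_set g).
Local Notation lam := (lebesgue_on g).
Implicit Types mu nu nuh psi : {finite_measure set 'rV[R]_n -> \bar R}.

Let mX : measurable X := measurable_semialgebraic_set g.

Lemma supported_mass mu : supported_on X mu -> mu X = mu setT.
Proof.
move=> muC; rewrite -(setUv X) measureU ?setICr//; last exact: measurableC.
by rewrite [X in (_ + X)%E]muC adde0.
Qed.

Lemma integral_mass mu : (\int[mu]_(x in X) 1 = mu X)%E.
Proof. by rewrite integral_cst// mul1e. Qed.

Variable mustar : probability 'rV[R]_n R.
Hypothesis huniq : forall mu : probability 'rV[R]_n R,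
  invariant_probability t f X mu -> same_measure mu mustar.

Lemma lp_feasible_mu mu nu nuh psi :
  lp_feasible t f g mu nu nuh psi -> same_measure mu mustar.
Proof.
move=> [[muC _ _ _] muX inv _ _].
have mu1 : mu setT = 1%E by rewrite -supported_mass// -integral_mass.
by have := huniq (mu := unit_mass mu1); apply; split.
Qed.

Variables nustar sigma nu1 : {finite_measure set 'rV[R]_n -> \bar R}.
Hypothesis hdec : lebesgue_decomposition lam mustar nustar sigma.
Hypothesis hmin : is_min1 lam nustar nu1.

Lemma nu1_le_lebesgue A : measurable A -> (nu1 A <= lam A)%E.
Proof.
move=> mA; have [h [mh h0 _] [mh1 h10 ->//]] := hmin.
rewrite -[leRHS]mul1e -integral_cst//; apply: ge0_le_integral => //.
- by move=> x _; rewrite lee_fin.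
- by apply/measurable_EFinP; exact: measurable_funTS.
- by move=> x _; rewrite lee_fin ge_min lexx.
Qed.

Lemma nu1_le_nustar A : measurable A -> (nu1 A <= nustar A)%E.
Proof.
move=> mA; have [h [mh h0 ->//] [mh1 h10 ->//]] := hmin.
apply: ge0_le_integral => //.
- by move=> x _; rewrite lee_fin.
- by apply/measurable_EFinP; exact: measurable_funTS.
- by apply/measurable_EFinP; exact: measurable_funTS.
- by move=> x _; rewrite lee_fin ge_min lexx orbT.
Qed.

Lemma nu1_le_mustar A : measurable A -> (nu1 A <= mustar A)%E.
Proof.
move=> mA; have [-> // _ _] := hdec.
by apply: le_trans (nu1_le_nustar mA) _; rewrite leeDl.
Qed.

Lemma lp_feasible_le mu nu nuh psi : lp_feasible t f g mu nu nuh psi ->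
  forall A, measurable A -> (nu A <= nu1 A)%E.
Proof.
move=> hfeas; have muE := lp_feasible_mu hfeas.
case: hfeas => [_ _ _ numu nulam] A mA.
have nu_lam E : measurable E -> (nu E <= lam E)%E.
  by move=> mE; rewrite -nulam// leeDl.
have nu_mustar E : measurable E -> (nu E <= mustar E)%E.
  by move=> mE; rewrite -muE// -numu// leeDl.
have [mustarE _ [B mB [lamB sigB]]] := hdec.
have [h [mh h0 nustarE] [mh1 h10 nu1E]] := hmin.
have mlow : measurable [set x | h x <= 1].
  rewrite [Y in measurable Y](_ : _ = h @^-1` `]-oo, 1]).
    by rewrite -[Y in measurable Y]setTI; exact: mh.
  by apply/seteqP; split => x /=; rewrite in_itv.
(* The set A is cut in three. Off B the singular part vanishes, so where h <= 1 the bound by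
   [mustar] is the one by [nu1]; where h > 1 the density of [nu1] is 1 and the bound by [lam]
   serves; B itself is [lam]-null. *)
pose E := A `\` B.
pose E1 := E `&` [set x | h x <= 1].
pose E2 := E `\` [set x | h x <= 1].
have mE : measurable E by exact: measurableD.
have mE1 : measurable E1 by exact: measurableI.
have mE2 : measurable E2 by exact: measurableD.
have split_ (nu' : {finite_measure set 'rV[R]_n -> \bar R}) :
    nu' A = (nu' E1 + nu' E2 + nu' (A `&` B))%E.
  by rewrite (measureDI nu' mA mB) -/E (measureDI nu' mE mlow) [X in (X + _)%E]addeC.
have le1 : (nu E1 <= nu1 E1)%E.
  apply: (le_trans (nu_mustar _ mE1)); rewrite mustarE//.
  have -> : sigma E1 = 0%E.
    apply: subset_measure0 sigB => //; first exact: measurableC.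
    by move=> x [[]].
  rewrite adde0 nustarE// nu1E// le_eqVlt; apply/orP; left; apply/eqP.
  by apply: eq_integral => x; rewrite inE => -[_ /= hx]; rewrite min_r.
have le2 : (nu E2 <= nu1 E2)%E.
  apply: (le_trans (nu_lam _ mE2)).
  rewrite nu1E// -[leLHS]mul1e -integral_cst// le_eqVlt; apply/orP; left; apply/eqP.
  apply: eq_integral => x; rewrite inE => -[_ /= /negP]; rewrite -ltNge => hx.
  by rewrite min_l// ltW.
have leB : (nu (A `&` B) <= nu1 (A `&` B))%E.
  apply: le_trans (nu_lam _ _) _; first exact: measurableI.
  rewrite (_ : lam (A `&` B) = 0%E)//.
  by apply: subset_measure0 lamB => //; exact: measurableI.
by rewrite split_ (split_ nu1) leeD// leeD.
Qed.

Hypothesis hball : exists (j : 'I_m) (N : int), g j = ball_poly N.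
Hypothesis hinv : invariant_probability t f X mustar.

Let nu1_le_finite A : measurable A -> (nu1 A <= finite_lebesgue_on hball A)%E.
Proof. exact: nu1_le_lebesgue. Qed.

Definition lp_nuhat : {finite_measure set 'rV[R]_n -> \bar R} :=
  measure_diff nu1_le_finite.

Definition lp_psi : {finite_measure set 'rV[R]_n -> \bar R} :=
  measure_diff nu1_le_mustar.

Lemma lp_nuhatE : same_measure lp_nuhat (fun A => lam A - nu1 A)%E.
Proof. by move=> A mA; exact: measure_diffE. Qed.

Lemma lp_psiE : same_measure lp_psi (fun A => mustar A - nu1 A)%E.
Proof. by move=> A mA; exact: measure_diffE. Qed.

Let supported_le (m1 m2 : set 'rV[R]_n -> \bar R) :
  (forall A, (0 <= m1 A)%E) -> (forall A, measurable A -> (m1 A <= m2 A)%E) ->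
  supported_on X m2 -> supported_on X m1.
Proof.
move=> m10 m12 m2C; apply/eqP; rewrite eq_le m10 andbT -[leRHS]m2C m12//.
exact: measurableC.
Qed.

Lemma lp_feasible_star : lp_feasible t f g mustar nu1 lp_nuhat lp_psi.
Proof.
have [muC inv] := hinv.
have nu1C : supported_on X nu1 by exact: supported_le nu1_le_mustar muC.
split=> //.
- split=> //.
  + apply: (supported_le _ _ (lebesgue_on_supported g)) => // A mA.
    by rewrite lp_nuhatE// leeBlDr ?fin_num_measure// leeDl.
  + apply: (supported_le _ _ muC) => // A mA.
    by rewrite lp_psiE// leeBlDr ?fin_num_measure// leeDl.
- by rewrite integral_mass supported_mass//; exact: (probability_setT mustar).
- by move=> A mA; rewrite lp_psiE// addeC subeK// fin_num_measure.
- by move=> A mA; rewrite lp_nuhatE// addeC subeK// fin_num_measure.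
Qed.

Lemma rho_singE : rho_sing t f g = nu1 X.
Proof.
apply/eqP; rewrite eq_le; apply/andP; split.
  apply: ge_ereal_sup => _ [mu [nu [nuh [psi [hf ->]]]]].
  by rewrite integral_mass; exact: lp_feasible_le hf _ _.
apply: ereal_sup_ubound; exists mustar, nu1, lp_nuhat, lp_psi.
by split; [exact: lp_feasible_star|rewrite integral_mass].
Qed.

Lemma lp_optimal_star : lp_optimal t f g mustar nu1 lp_nuhat lp_psi.
Proof.
by split; [exact: lp_feasible_star|rewrite rho_singE integral_mass].
Qed.

Lemma lp_optimal_unique mu nu nuh psi : lp_optimal t f g mu nu nuh psi ->
  [/\ same_measure mu mustar, same_measure nu nu1,
      same_measure nuh lp_nuhat & same_measure psi lp_psi].
Proof.
move=> [hf]; rewrite rho_singE integral_mass => nuX.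
have muE := lp_feasible_mu hf.
have nu_le := lp_feasible_le hf.
have [[_ nuC _ _] _ _ numu nulam] := hf.
have nu1C : supported_on X nu1 by have [[]] := lp_feasible_star.
have nuE : same_measure nu nu1.
  by apply: le_measure_eq => //; rewrite -!supported_mass.
split=> // A mA.
- by rewrite lp_nuhatE// -nulam// -nuE// addeAC subee ?add0e// fin_num_measure.
- by rewrite lp_psiE// -muE// -numu// -nuE// addeAC subee ?add0e// fin_num_measure.
Qed.

End linear_program.

(** * Invariance in terms of moments *)

Section polynomials_are_C1.
Context {R : realType} {n : nat}.
Local Notation e i := (delta_mx ord0 i : 'rV[R]_n).

Let good (p : mpoly n R) := forall x,
  differentiable (peval p) x /\
  forall i, 'D_(e i) (peval p) x = peval (mderiv i p) x.

Let goodC c : good (mpolyC n c).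
Proof.
move=> x; have E : peval (mpolyC n c) = cst c by apply/funext => y; rewrite pevalC.
rewrite E; split; first exact: differentiable_cst.
by move=> i; rewrite derive_cst mderivC /peval rmorph0.
Qed.

Let goodD p q : good p -> good q -> good (p + q).
Proof.
move=> gp gq x; have [dp Dp] := gp x; have [dq Dq] := gq x.
have E : peval (p + q) = peval p + peval q by apply/funext => y; rewrite pevalD.
rewrite E; split; first exact: differentiableD.
move=> i; rewrite deriveD; [|exact: diff_derivable..].
by rewrite Dp Dq mderivD pevalD.
Qed.

Let goodM p q : good p -> good q -> good (p * q).
Proof.
move=> gp gq x; have [dp Dp] := gp x; have [dq Dq] := gq x.
have E : peval (p * q) = peval p * peval q by apply/funext => y; rewrite pevalM.
rewrite E; split; first exact: differentiableM.
move=> i; rewrite deriveM; [|exact: diff_derivable..].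
by rewrite Dp Dq mderivM pevalD !pevalM addrC [peval q x *: _]mulrC.
Qed.

Let goodX j : good (mpolyX R (mnm1 j)).
Proof.
move=> x; have E : peval (mpolyX R (mnm1 j)) = (fun y => y ord0 j).
  by apply/funext => y; rewrite peval_coord.
rewrite E; split; first exact: differentiable_coord.
move=> i; have -> : peval (mderiv i (mpolyX R (mnm1 j))) x = (j == i)%:R.
  rewrite mderivX mnm1E pevalZ.
  have [->|_] := eqVneq j i; last by rewrite mul0r.
  rewrite mul1r (_ : mnm_sub _ _ = mnm0) ?mpolyX0 ?peval1//.
  by apply/mnmP => k; rewrite mnmBE mnm0E subnn.
apply: cvg_lim => //; apply: cvg_near_cst; near=> h.
have h0 : h != 0 by near: h; exact: nbhs_dnbhs_neq.
rewrite /= !mxE eqxx /= eq_sym addrK.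
by rewrite /GRing.scale /= mulrA mulVf// mul1r.
Unshelve. all: by end_near. Qed.

Let good_all p : good p.
Proof.
have good1 : good 1 by rewrite -mpolyC1; exact: goodC.
rewrite (mpolyE p); elim/big_ind: _ => [||a _].
- by rewrite -(mpolyC0 n R); exact: goodC.
- exact: goodD.
- rewrite -mul_mpolyC; apply: (goodM (goodC _)); rewrite mpolyXE_id.
  elim/big_ind: _ => [||i _]; [exact: good1|exact: goodM|].
  elim: (a i) => [|k IH]; first by rewrite expr0.
  by rewrite exprS; exact: (goodM (goodX i)).
Qed.

Lemma derive_peval p i x : 'D_(e i) (peval p) x = peval (mderiv i p) x.
Proof. by have [_] := good_all p x. Qed.

Lemma C1_peval (p : mpoly n R) : C1 (peval p).
Proof.
split; first by move=> x; have [] := good_all p x.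
move=> i; rewrite (_ : 'D__ _ = peval (mderiv i p)); first exact: peval_continuous.
by apply/funext => x; rewrite derive_peval.
Qed.

End polynomials_are_C1.

Section invariance.
Context {R : realType} {n : nat} (t : time) (f : n.-tuple (mpoly n R)).
Variables (X : set 'rV[R]_n) (mu : {finite_measure set 'rV[R]_n -> \bar R}).
Hypotheses (mX : measurable X) (muC : supported_on X mu) (mub : bounded_support mu).

Let mf : measurable_fun setT (poly_map f).
Proof.
apply: measurable_matrixP => i j; under eq_fun do rewrite mxE.
exact: measurable_peval.
Qed.

Let mupf A : measurable A -> measurable (poly_map f @^-1` A).
Proof. by move=> mA; rewrite -[Y in measurable Y]setTI; exact: mf. Qed.

Let image_measure := finite_pushforward mu mf.

Let muIX A : measurable A -> mu (X `&` A) = mu A.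
Proof.
move=> mA; rewrite (measureDI mu mA mX) setIC [Y in (Y + _)%E](_ : _ = 0%E) ?add0e//.
apply: subset_measure0 muC; [exact: measurableD|exact: measurableC|].
by move=> x [].
Qed.

Let Rintegral_image p :
  \int[image_measure]_x peval p x = \int[mu]_x peval (comp_mpoly f p) x.
Proof.
rewrite (Rintegral_pushforward mf (measurable_peval p) _).2.
  by apply: eq_Rintegral => x _; rewrite peval_comp.
rewrite (_ : _ \o _ = EFin \o peval (comp_mpoly f p)); first exact: integrable_peval.
by apply/funext => x /=; rewrite peval_comp.
Qed.

Let integral_supported (h : 'rV[R]_n -> R) : mu.-integrable setT (EFin \o h) ->
  (\int[mu]_(x in X) (h x)%:E = (\int[mu]_x h x)%:E)%E.
Proof.
move=> hi; rewrite (supported_Rintegral mX muC hi) fineK//.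
apply: integrable_fin_num => //.
exact: (integrableS measurableT mX (@subsetT _ _) hi).
Qed.

Let transport_continuousE p x : peval (transport Defs.Continuous f p) x =
  \sum_(i < n) 'D_(delta_mx ord0 i) (peval p) x * peval (tnth f i) x.
Proof.
by rewrite peval_sum; apply: eq_bigr => i _; rewrite pevalM derive_peval.
Qed.

Lemma invariant_inv_func : invariant_measure t f X mu ->
  forall p, inv_func t f (moment mu) p = 0.
Proof.
case: t => inv p.
  rewrite /inv_func -!Rintegral_peval// -Rintegral_image.
  apply/eqP; rewrite subr_eq0; apply/eqP; congr fine.
  apply: eq_measure_integral => A mA _; rewrite /= /finite_pushforward /pushforward.
  have mXf B : measurable B -> mu (X `&` (poly_map f @^-1` (B `&` X))) = mu (B `&` X).
    move=> mB; have mBX : measurable (B `&` X) by exact: measurableI.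
    exact: (inv _ mBX (@subIsetr _ B X)).
  (* Invariance only speaks of subsets of X. Applied to X itself, it shows that almost no point of X
     leaves X, so the image measure can be compared with [mu] on every Borel set. *)
  have invX : mu (X `&` (poly_map f @^-1` ~` X)) = 0%E.
    have mXX : mu (X `&` (poly_map f @^-1` X)) = mu X.
      by have mXfT := mXf setT measurableT; rewrite !setTI in mXfT.
    have H : (mu (X `\` poly_map f @^-1` X) + mu X = mu X)%E.
      by rewrite -[Y in (_ + Y)%E]mXX; apply/esym/measureDI => //; exact: mupf.
    transitivity (mu (X `\` poly_map f @^-1` X)); first by [].
    rewrite -[LHS](@addeK _ (mu X)) ?fin_num_measure// H subee//.
    exact: fin_num_measure.
  rewrite -(muIX (mupf mA)) (measureDI mu _ (mupf mX)); last first.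
    by apply: measurableI => //; exact: mupf.
  rewrite [Y in (Y + _)%E](_ : _ = 0%E) ?add0e.
    transitivity (mu (A `&` X)); last by rewrite setIC; exact: muIX.
    by rewrite -(mXf A mA); congr (mu _); rewrite -setIA -preimage_setI.
  apply: subset_measure0 invX.
  - by apply: measurableD; [apply: measurableI => //|]; exact: mupf.
  - by apply: measurableI => //; apply: mupf; exact: measurableC.
  - by move=> x [[]].
rewrite /inv_func -Rintegral_peval//.
have := inv _ (C1_peval p).
under eq_integral do rewrite -transport_continuousE.
rewrite integral_supported; last exact: integrable_peval.
by case.
Qed.

(** In discrete time the image measure is boundedly supported, f being bounded on a box, and has the
    moments of [mu], so determinacy applies. In continuous time this is the density of
    polynomials. *)
Lemma inv_func_invariant :
  (forall p, inv_func t f (moment mu) p = 0) -> invariant_measure t f X mu.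
Proof.
case: t => inv.
  have imb : bounded_support image_measure.
    have [b bC boo] := mub; have [c cP] := choice (fun i => peval_bounded (tnth f i) b).
    exists (\sum_i `|c i|); last by apply: finite_measure_lty; exact: measurable_box.
    apply: subset_measure0 bC.
    - by apply: mupf; apply: measurableC; exact: measurable_box.
    - by apply: measurableC; exact: measurable_box.
    - move=> x /= + bx; apply => i; rewrite mxE (le_trans (cP i x bx))//.
      rewrite (le_trans (ler_norm _))// (bigD1 i)//= lerDl sumr_ge0//.
  have same : same_measure image_measure mu.
    apply: moment_determinacy => // a; rewrite /moment Rintegral_image.
    apply/eqP; rewrite -subr_eq0 !Rintegral_peval//; apply/eqP; exact: inv.
  move=> A mA AX; rewrite -(same A mA).
  exact: (muIX (mupf mA)).
move=> v vC1; rewrite integral_supported.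
  congr EFin; apply: C1_invariance => // p; rewrite Rintegral_peval//; exact: inv.
have ch := C1_flux_continuous (f := f) vC1.
apply: integrable_bounded_on => // [|b]; first exact: continuous_measurable_rV.
exact: continuous_box_bounded.
Qed.

End invariance.

(** * The semidefinite relaxations *)

Section truncation.
Context {R : realType} {n : nat}.
Implicit Types (p q : mpoly n R) (y : multinom n -> R).

Lemma ext_truncation d y a : (mdeg a <= d)%N ->
  ext (fun b : bmultinom n d.+1 => y (bmnm b)) a = y a.
Proof. by move=> ad; rewrite /ext insubT//= ltnS. Qed.

Lemma ext_bmnm d (y : @psm R n d) b : ext y (bmnm b) = y b.
Proof. by rewrite /ext -[bmnm b]/(val b) valK. Qed.

Lemma eq_riesz_deg d (y1 y2 : multinom n -> R) p :
  (forall a, (mdeg a <= d)%N -> y1 a = y2 a) -> (mpoly_deg p <= d)%N ->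
  riesz y1 p = riesz y2 p.
Proof.
move=> y12 pd; apply: eq_big_seq => a ap; congr (_ * _); apply: y12.
have := msize_mdeg_lt ap; rewrite /mpoly_deg in pd.
by case: (msize p) pd => // s sd; rewrite ltnS => /leq_trans; apply.
Qed.

Lemma riesz_truncation d y p : (mpoly_deg p <= d)%N ->
  riesz (ext (fun b : bmultinom n d.+1 => y (bmnm b))) p = riesz y p.
Proof. by apply: eq_riesz_deg => a; exact: ext_truncation. Qed.

Lemma mpoly_deg_mul p q : (mpoly_deg (p * q)%R <= mpoly_deg p + mpoly_deg q)%N.
Proof.
rewrite /mpoly_deg; have [->|p0] := eqVneq p 0; first by rewrite mul0r msize0.
have [->|q0] := eqVneq q 0; first by rewrite mulr0 msize0.
rewrite msizeM//.
have : (0 < msize q)%N by rewrite lt0n msize_poly_eq0.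
have : (0 < msize p)%N by rewrite lt0n msize_poly_eq0.
by move: (msize p) (msize q) => [|a] [|b] // _ _; rewrite addnS.
Qed.

Lemma leq_half_deg p : (mpoly_deg p <= 2 * half_deg p)%N.
Proof. by rewrite /half_deg; lia. Qed.

Lemma quadratic_form_loc_mx d q y (x : 'cV[R]_#|{: bmultinom n d.+1}|) :
  (x^T *m loc_mx d q y *m x) ord0 ord0 =
  riesz y (q * (\sum_i x i ord0 *: mpolyX R (bmnm (enum_val i))) ^+ 2).
Proof.
rewrite expr2 mulr_suml mulr_sumr linear_sum mxE.
under eq_bigr do rewrite mxE mulr_suml.
rewrite exchange_big; apply: eq_bigr => i _ /=.
rewrite mulr_sumr mulr_sumr linear_sum; apply: eq_bigr => j _ /=.
have -> : q * (x i ord0 *: mpolyX R (bmnm (enum_val i)) *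
      (x j ord0 *: mpolyX R (bmnm (enum_val j)))) =
    (x i ord0 * x j ord0) *:
      (q * (mpolyX R (bmnm (enum_val i)) * mpolyX R (bmnm (enum_val j)))).
  by rewrite -scalerAl -!scalerAr scalerA.
rewrite linearZ /= !mxE -mpolyXD addmC.
set z := riesz _ _; ring.
Qed.

Lemma loc_mx_sym d q y : (loc_mx d q y)^T = loc_mx d q y.
Proof. by apply/matrixP => i j; rewrite !mxE addmC. Qed.

Lemma mpolyE_bounded d p : (mpoly_deg p <= d)%N ->
  exists x : 'cV[R]_#|{: bmultinom n d.+1}|,
  p = \sum_i x i ord0 *: mpolyX R (bmnm (enum_val i)).
Proof.
move=> pd; exists (\col_i mcoeff (bmnm (enum_val i)) p).
rewrite [LHS](@mpolywE _ _ d.+1); last first.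
  by move: pd; rewrite /mpoly_deg; case: (msize p).
rewrite (reindex (fun i : 'I_#|{: bmultinom n d.+1}| => enum_val i)) /=; last first.
  exact/onW_bij/enum_val_bij.
by apply: eq_bigr => i _; rewrite mxE.
Qed.

(** Vectors indexed by the monomials of degree at most d are coefficient vectors, and the quadratic
    form is p -> [riesz y (q * p ^+ 2)]. Matrices are left behind from here on. *)
Lemma loc_mx_psdP d q y : psd (loc_mx d q y) <->
  forall p, (mpoly_deg p <= d)%N -> 0 <= riesz y (q * p ^+ 2).
Proof.
split=> [[_ H] p /mpolyE_bounded[x ->]|H].
  by rewrite -quadratic_form_loc_mx.
split=> [|x]; first exact: loc_mx_sym.
rewrite quadratic_form_loc_mx; apply: H.
elim/big_ind: _ => [|p1 p2 h1 h2|i _].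
- by rewrite /mpoly_deg msize0.
- rewrite /mpoly_deg; have := msizeD_le p1 p2; move: h1 h2; rewrite /mpoly_deg.
  by move: (msize (p1 + p2)) (msize p1) (msize p2) => a b c; lia.
- apply: leq_trans (_ : mdeg (bmnm (enum_val i)) <= d)%N; last first.
    by rewrite -ltnS bmdeg.
  rewrite /mpoly_deg.
  have := msizeZ_le (mpolyX R (bmnm (enum_val i))) (x i ord0).
  by rewrite msizeX; case: (msize _).
Qed.

End truncation.

Section moment_sequences.
Context {R : realType} {n : nat} (t : time) (f : n.-tuple (mpoly n R)).
Context {m : nat} (g : 'I_m -> mpoly n R).
Local Notation X := (semialgebraic_set g).
Hypothesis hball : exists (j : 'I_m) (N : int), g j = ball_poly N.

Lemma moment_add (m1 m2 m3 : {measure set 'rV[R]_n -> \bar R}) :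
  bounded_support m1 -> bounded_support m2 ->
  same_measure (fun A => m1 A + m2 A)%E m3 ->
  forall a, moment m1 a + moment m2 a = moment m3 a.
Proof.
move=> b1 b2 m12 a; have i1 := integrable_peval b1 (mpolyX R a).
have i2 := integrable_peval b2 (mpolyX R a).
rewrite /moment /Rintegral -fineD; [|exact: integrable_fin_num..].
rewrite -(integral_measure_add measurableT i1 i2).
congr fine; apply: eq_measure_integral => A mA _.
by rewrite -m12//; exact: measure_addE.
Qed.

Lemma eq_moment (m1 m2 : {measure set 'rV[R]_n -> \bar R}) :
  same_measure m1 m2 -> moment m1 =1 moment m2.
Proof.
move=> m12 a; rewrite /moment /Rintegral.
by congr fine; apply: eq_measure_integral => A mA _; exact: m12.
Qed.

Lemma moment_mass (mu : {finite_measure set 'rV[R]_n -> \bar R}) :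
  moment mu mnm0 = fine (mu setT).
Proof.
rewrite /moment mpolyX0; under eq_Rintegral do rewrite peval1.
by rewrite Rintegral_cst// mul1r.
Qed.

Definition moment_psm r (mu : {measure set 'rV[R]_n -> \bar R}) : @psm R n (2 * r) :=
  fun a => moment mu (bmnm a).

Lemma half_deg_r_min j r : (r_min g <= r)%N -> (half_deg (with_g0 g j) <= r)%N.
Proof.
move=> gr; rewrite /with_g0; case: unliftP => [i _|_].
  apply: leq_trans gr; rewrite /r_min leq_max; apply/orP; right.
  exact: (leq_bigmax i).
by rewrite /half_deg /mpoly_deg msize1.
Qed.

Lemma moment_loc_psd r (mu : {finite_measure set 'rV[R]_n -> \bar R}) :
  (r_min g <= r)%N -> supported_on X mu -> loc_psd g (moment_psm (r := r) mu).
Proof.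
move=> gr muC j; apply/loc_mx_psdP => p pd.
have hr := half_deg_r_min j gr.
have mub := supported_bounded hball muC.
set q := with_g0 g j in pd hr *.
rewrite riesz_truncation -?Rintegral_peval//; last first.
  apply: leq_trans (mpoly_deg_mul _ _) _.
  have := leq_half_deg q; have := mpoly_deg_mul p p; rewrite -expr2; lia.
rewrite (supported_Rintegral (measurable_semialgebraic_set g) muC); last first.
  exact: integrable_peval.
apply: Rintegral_ge0 => x gx; rewrite pevalM pevalXn mulr_ge0 ?sqr_ge0//.
rewrite /q /with_g0; case: unliftP => [i _|_]; first exact: gx.
by rewrite peval1.
Qed.

Lemma lp_sdp_feasible r (mu nu nuh psi : {finite_measure set 'rV[R]_n -> \bar R}) :
  (r_min g <= r)%N -> lp_feasible t f g mu nu nuh psi ->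
  sdp_feasible t f g (moment_psm (r := r) mu) (moment_psm (r := r) nu) (moment_psm (r := r) nuh)
    (moment_psm (r := r) psi).
Proof.
move=> gr [[muC nuC nuhC psiC] mu1 inv numu nulam].
have mub := supported_bounded hball muC.
split.
- rewrite ext_truncation ?mdeg0// moment_mass -(supported_mass muC).
  by rewrite -integral_mass mu1.
(* Membership in A_r keeps the transported monomial within the degrees where truncated and full
   moments agree. *)
- move=> a aA; have := invariant_inv_func (measurable_semialgebraic_set g) muC mub inv
    (mpolyX R (bmnm a)).
  rewrite /inv_func; move: aA; rewrite /in_A; case: t => /= aA <-.
    rewrite riesz_truncation//; congr (_ - _).
    by rewrite !rieszX ext_bmnm.
  by rewrite riesz_truncation.
- move=> a; apply: moment_add => //; first exact: supported_bounded hball _ nuC.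
  exact: supported_bounded hball _ psiC.
- move=> a; apply: (moment_add _ _ (m3 := finite_lebesgue_on hball)) => //.
    exact: supported_bounded hball _ nuC.
  exact: supported_bounded hball _ nuhC.
- by split; exact: moment_loc_psd.
Qed.

End moment_sequences.

(** * A priori bounds on pseudo-moments *)

Section moment_bounds.
Context {R : realType} {n : nat} (L : {scalar mpoly n R}) (N : int) (r : nat).
Hypothesis L_sqr : forall p, (mpoly_deg p <= r)%N -> 0 <= L (p ^+ 2).
Hypothesis L_ball : forall p, (mpoly_deg p < r)%N -> 0 <= L (ball_poly N * p ^+ 2).

Lemma mpoly_degX a : mpoly_deg (mpolyX R a : mpoly n R) = mdeg a.
Proof. by rewrite /mpoly_deg msizeX. Qed.

(** Induction on the degree: testing the ball constraint against x^b bounds the sum of all L (x_l^2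
    x^(2b)) by N L (x^(2b)), and every term of that sum is nonnegative. *)
Lemma square_moment_le (a : multinom n) : (mdeg a <= r)%N ->
  L (mpolyX R a ^+ 2) <= `|N|%:~R ^+ mdeg a * L 1.
Proof.
have [k] := ubnP (mdeg a); elim: k a => // k IH a; rewrite ltnS => ak ar.
have [/eqP|a0] := eqVneq (mdeg a) 0%N.
  by rewrite mdeg_eq0 => /eqP ->; rewrite mpolyX0 expr1n mdeg0 expr0 mul1r.
have [i ai] : exists i, a i != 0%N.
  apply/not_existsP => H; move/eqP: a0; apply; apply/eqP; rewrite mdeg_eq0.
  by apply/eqP/mnmP => i; rewrite mnm0E; apply/eqP; move: (H i) => /negP; rewrite negbK.
pose b := mnm_sub a (mnm1 i).
have ab : a = mnm_add b (mnm1 i) by rewrite /b submK// lep1mP.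
have ba : mdeg a = (mdeg b).+1 by rewrite ab mdegD mdeg1 addn1.
have IHb : L (mpolyX R b ^+ 2) <= `|N|%:~R ^+ mdeg b * L 1.
  by apply: IH; [rewrite -ltnS -ba ltnS|rewrite ltnW// -ba].
have bX : (mpoly_deg (mpolyX R b : mpoly n R) < r)%N by rewrite mpoly_degX -ba.
have b0 : 0 <= L (mpolyX R b ^+ 2) by apply: L_sqr; rewrite ltnW.
have sq l : 0 <= L (mpolyX R (mnm1 l) ^+ 2 * mpolyX R b ^+ 2).
  rewrite -exprMn -mpolyXD; apply: L_sqr.
  by rewrite mpoly_degX mdegD mdeg1 add1n -ba.
have N0 : 0 <= `|N|%:~R :> R by rewrite ler0z.
apply: (@le_trans _ _ (`|N|%:~R * L (mpolyX R b ^+ 2))); last first.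
  by rewrite ba [_ ^+ (mdeg b).+1]exprS -mulrA ler_wpM2l.
apply: (@le_trans _ _ (N%:~R * L (mpolyX R b ^+ 2))); last first.
  by rewrite ler_wpM2r// ler_int ler_norm.
have := L_ball bX; rewrite /ball_poly mulrBl mul_mpolyC linearB linearZ /=.
rewrite subr_ge0 => /(le_trans _); apply.
rewrite mulr_suml linear_sum (bigD1 i)//= {1}ab mpolyXD exprMn mulrC.
by rewrite lerDl sumr_ge0.
Qed.

(** From L ((x^a + s)^2) >= 0 for both signs s, which bounds twice the absolute moment by L (x^(2a))
    + L 1. *)
Lemma moment_bound (a : multinom n) : (mdeg a <= r)%N ->
  `|L (mpolyX R a)| <= (`|N|%:~R ^+ mdeg a + 1) * L 1.
Proof.
move=> ar; have N0 : 0 <= `|N|%:~R ^+ mdeg a :> R by rewrite exprn_ge0// ler0z.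
have := square_moment_le ar.
have L1 : 0 <= L 1.
  by rewrite -[1](expr1n _ 2); apply: L_sqr; rewrite /mpoly_deg msize1.
have H s : s ^+ 2 = 1 -> 0 <= L (mpolyX R a ^+ 2) + s * 2 * L (mpolyX R a) + L 1.
  move=> s1; have := @L_sqr (mpolyX R a + s *: 1).
  rewrite sqrrD -scalerAr mulr1 exprZn expr1n s1 scale1r -scaler_nat scalerA.
  rewrite mulrC !linearD linearZ /=; apply.
  apply: leq_trans ar; rewrite /mpoly_deg.
  have := msizeD_le (mpolyX R a) (s *: 1); have := msizeZ_le (1 : mpoly n R) s.
  rewrite msizeX msize1 => h1 h2; rewrite -subn1 leq_subLR add1n (leq_trans h2)//.
  by rewrite geq_max leqnn (leq_trans h1).
have := H 1 (expr1n _ 2); have := H (-1) ltac:(by rewrite sqrrN expr1n).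
set K := _ ^+ mdeg a in N0 *; set z := L (mpolyX R a).
have KL : 0 <= K * L 1 by rewrite mulr_ge0.
by move=> h1 h2 h3; rewrite ler_norml; apply/andP; split; lra.
Qed.

End moment_bounds.

(** * Limits of optimal pseudo-moment sequences *)

Lemma riesz1 {R : realType} {n : nat} (y : multinom n -> R) : riesz y 1 = y mnm0.
Proof. by rewrite -mpolyX0 rieszX. Qed.

Section pseudo_moments.
Context {R : realType} {n m : nat} (g : 'I_m -> mpoly n R) (j0 : 'I_m) (N : int).
Hypothesis gj0 : g j0 = ball_poly N.

Lemma half_deg_ball_poly : (half_deg (ball_poly N : mpoly n R) <= 1)%N.
Proof.
suff : (msize (ball_poly N : mpoly n R) <= 3)%N.
  by rewrite /half_deg /mpoly_deg; case: (msize _) => [|[|[|[|]]]].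
apply: leq_trans (msizeD_le _ _) _; rewrite geq_max msizeN msizeC.
apply/andP; split; first by case: (_ == _).
elim/big_ind: _ => [|p q p3 q3|i _]; first by rewrite msize0.
  by rewrite (leq_trans (msizeD_le _ _))// geq_max p3.
by rewrite expr2 -mpolyXD msizeX mdegD !mdeg1.
Qed.

Section order.
Variables (r : nat) (s : @psm R n (2 * r)).
Hypotheses (gr : (r_min g <= r)%N) (spsd : loc_psd g s).

Lemma loc_psd_g j p : (mpoly_deg p <= r - half_deg (g j))%N ->
  0 <= riesz (ext s) (g j * p ^+ 2).
Proof.
have := spsd (lift ord0 j); rewrite /with_g0 liftK => /loc_mx_psdP; exact.
Qed.

Lemma loc_psd_sqr p : (mpoly_deg p <= r)%N -> 0 <= riesz (ext s) (p ^+ 2).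
Proof.
have := spsd ord0; rewrite /with_g0 unlift_none => /loc_mx_psdP + pr => /(_ p).
rewrite mul1r; apply.
by rewrite /half_deg {2}/mpoly_deg msize1 subn0.
Qed.

Lemma pseudo_moment_bound a : (mdeg a <= r)%N ->
  `|ext s a| <= (`|N|%:~R ^+ mdeg a + 1) * ext s mnm0.
Proof.
move=> ar; rewrite -rieszX -riesz1.
apply: (moment_bound loc_psd_sqr _ ar) => p pr; rewrite -gj0.
apply: loc_psd_g; rewrite gj0; have := half_deg_ball_poly; lia.
Qed.

Lemma pseudo_mass_ge0 : 0 <= ext s mnm0.
Proof.
by rewrite -riesz1 -(expr1n _ 2); apply: loc_psd_sqr; rewrite /mpoly_deg msize1.
Qed.

End order.

Section limit.
Variables (U : set_system nat) (UU : UltraFilter U) (ooU : \oo `<=` U).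
Unset Implicit Arguments.
Variables (s : forall r, @psm R n (2 * r)) (c : R).
Set Implicit Arguments.
Hypothesis spsd : forall r, (r_min g <= r)%N -> loc_psd g (s r).
Hypothesis sc : forall r, (r_min g <= r)%N -> ext (s r) mnm0 <= c.

Definition pseudo_limit (a : multinom n) : R := lim (ext (s r) a @[r --> U]).

Let PU : ProperFilter U := ultra_proper.

Lemma pseudo_limit_cvg a : ext (s r) a @[r --> U] --> pseudo_limit a.
Proof.
apply: (@ultra_bounded_cvg _ _ _ UU _ ((`|N|%:~R ^+ mdeg a + 1) * c)).
apply: ooU; exists (maxn (r_min g) (mdeg a)) => // r /=.
rewrite geq_max => /andP[gr ar].
apply: le_trans (pseudo_moment_bound gr (spsd gr) ar) _.
by rewrite ler_wpM2l ?sc// addr_ge0// exprn_ge0// ler0z.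
Qed.

Lemma riesz_limit_cvg p : riesz (ext (s r)) p @[r --> U] --> riesz pseudo_limit p.
Proof.
apply: cvg_Rsum => a; apply: cvgM; [exact: cvg_cst|exact: pseudo_limit_cvg].
Qed.

(** For a fixed p, the inequality tested by g_j p^2 belongs to every relaxation of sufficiently
    large order, hence passes to the limit without a degree restriction. *)
Lemma pseudo_limit_measure : exists mu : {finite_measure set 'rV[R]_n -> \bar R},
  supported_on (semialgebraic_set g) mu /\ moment mu =1 pseudo_limit.
Proof.
have pos j : pos_mult (riesz pseudo_limit) (g j).
  move=> p; apply: (cvgr_to_ge (@riesz_limit_cvg (g j * p ^+ 2))).
  apply: ooU; exists (maxn (r_min g) (mpoly_deg p + half_deg (g j))) => // r /=.
  rewrite geq_max => /andP[gr pr]; apply: loc_psd_g (spsd gr) _ _ _; lia.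
have pos1 : pos_mult (riesz pseudo_limit) 1.
  move=> p; rewrite mul1r; apply: (cvgr_to_ge (@riesz_limit_cvg (p ^+ 2))).
  apply: ooU; exists (maxn (r_min g) (mpoly_deg p)) => // r /=.
  rewrite geq_max => /andP[gr pr]; exact: loc_psd_sqr (spsd gr) _ _.
have [mu [muC _ muE]] := representing_measure gj0 pos1 pos.
by exists mu; split=> // a; rewrite /moment muE; exact: rieszX.
Qed.

End limit.
End pseudo_moments.

Section finite_sum.
Context {R : realType} {n : nat}.
Variables m1 m2 : {finite_measure set 'rV[R]_n -> \bar R}.

Definition finite_add : set 'rV[R]_n -> \bar R := measure_add m1 m2.

HB.instance Definition _ := Measure.on finite_add.

Let finite_add_fin : fin_num_fun finite_add.
Proof. by move=> A mA; rewrite /finite_add measure_addE fin_numD !fin_num_measure. Qed.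

HB.instance Definition _ := Measure_isFinite.Build _ _ _ finite_add finite_add_fin.

Lemma moment_determinacy_add (m3 : {finite_measure set 'rV[R]_n -> \bar R}) :
  bounded_support m1 -> bounded_support m2 -> bounded_support m3 ->
  (forall a, moment m1 a + moment m2 a = moment m3 a) ->
  same_measure (fun A => m1 A + m2 A)%E m3.
Proof.
move=> b1 b2 b3 m12 A mA; rewrite -measure_addE.
have b12 : bounded_support finite_add.
  have [c1 c1C _] := b1; have [c2 c2C _] := b2; exists (Num.max c1 c2).
    rewrite /finite_add measure_addE.
    have H (mu : {finite_measure set 'rV[R]_n -> \bar R}) c :
        c <= Num.max c1 c2 -> mu (~` box c) = 0%E -> mu (~` box (Num.max c1 c2)) = 0%E.
      move=> cm; apply: subset_measure0; [| |exact/subsetC/le_box];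
        by apply: measurableC; exact: measurable_box.
    rewrite -[RHS]adde0; congr adde.
      by apply: (H m1 c1); rewrite ?le_max ?lexx.
    by apply: (H m2 c2); rewrite ?le_max ?lexx ?orbT.
  by apply: finite_measure_lty; exact: measurable_box.
apply: (moment_determinacy b12 b3) => // a.
by rewrite -m12; apply/esym/moment_add => // B mB; rewrite -measure_addE.
Qed.

End finite_sum.

Lemma inv_func_mpolyX {R : realType} {n : nat} t (f : n.-tuple (mpoly n R))
    (y : multinom n -> R) :
  (forall a, inv_func t f y (mpolyX R a) = 0) -> forall p, inv_func t f y p = 0.
Proof.
move=> yX p.
have trD (c : R) q1 q2 : transport t f (c *: q1 + q2) =
    c *: transport t f q1 + transport t f q2.
  case: (t) => /=; first by rewrite linearP.
  rewrite scaler_sumr -big_split; apply: eq_bigr => i _ /=.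
  by rewrite linearP mulrDl scalerAl.
have rD c q1 q2 : riesz y (c *: q1 + q2) = c * riesz y q1 + riesz y q2.
  exact: linearP.
have invD (c : R) q1 q2 : inv_func t f y (c *: q1 + q2) =
    c * inv_func t f y q1 + inv_func t f y q2.
  by move: trD; rewrite /inv_func; case: (t) => ->; rewrite !rD//; ring.
have inv0 : inv_func t f y 0 = 0.
  by have := invD 1 0 0; rewrite scale1r addr0 mul1r; lra.
rewrite [p]mpolyE; elim/big_ind: _ => [//|q1 q2 h1 h2|a _].
  by rewrite -[q1]scale1r invD h1 h2 mulr0 addr0.
by rewrite -[X in inv_func _ _ _ X]addr0 invD yX inv0 mulr0 addr0.
Qed.

Lemma extD {R : realType} {n : nat} d (y1 y2 y3 : @psm R n d) :
  (forall a, y1 a + y2 a = y3 a) -> forall a, ext y1 a + ext y2 a = ext y3 a.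
Proof.
by move=> y12 a; rewrite /ext; case: insubP => [b _ _|_] /=; rewrite ?y12// addr0.
Qed.

Section convergence.
Context {R : realType} {n : nat} (t : time) (f : n.-tuple (mpoly n R)).
Context {m : nat} (g : 'I_m -> mpoly n R).
Local Notation X := (semialgebraic_set g).
Hypothesis hball : exists (j : 'I_m) (N : int), g j = ball_poly N.

(** The masses are nonnegative and add up in pairs, to 1 and to the Lebesgue mass of X. This is what
    makes the bounds uniform in r. *)
Lemma sdp_feasible_mass r (u v vh y : psm (2 * r)) :
  sdp_feasible t f g u v vh y ->
  [/\ ext u mnm0 <= 1, ext v mnm0 <= 1, ext y mnm0 <= 1 &
      ext vh mnm0 <= moment (lebesgue_on g) mnm0].
Proof.
move=> [u1 _ uE zE [_ pv pvh py]].
have := pseudo_mass_ge0 pv; have := pseudo_mass_ge0 pvh; have := pseudo_mass_ge0 py.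
have := extD uE mnm0; rewrite u1.
have <- : ext v mnm0 + ext vh mnm0 = moment (lebesgue_on g) mnm0.
  rewrite (extD (y3 := fun b => v b + vh b))//.
  rewrite -[RHS](@ext_truncation _ _ (2 * r)) ?mdeg0//; congr (ext _ _).
  by apply/funext.
by move=> *; split; lra.
Qed.

Variable mustar : probability 'rV[R]_n R.
Hypothesis huniq : forall mu : probability 'rV[R]_n R,
  invariant_probability t f X mu -> same_measure mu mustar.
Variables nustar sigma nu1 : {finite_measure set 'rV[R]_n -> \bar R}.
Hypothesis hdec : lebesgue_decomposition (lebesgue_on g) mustar nustar sigma.
Hypothesis hmin : is_min1 (lebesgue_on g) nustar nu1.
Hypothesis hinv : invariant_probability t f X mustar.

Unset Implicit Arguments.
Variables (u v vh y : forall r, @psm R n (2 * r)) (eps : nat -> R).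
Set Implicit Arguments.
Hypothesis feas : forall r, (r_min g <= r)%N ->
  sdp_feasible t f g (u r) (v r) (vh r) (y r).
Hypothesis eps0 : eps r @[r --> \oo] --> 0.
Hypothesis near_optimal : forall r, (r_min g <= r)%N ->
  moment nu1 mnm0 - eps r <= ext (v r) mnm0.

(** The slack [eps] is 0 for optimal solutions and 1 / (r + 1) in the proof that the values
    converge. *)
Lemma ultra_sdp_limit (U : set_system nat) : UltraFilter U -> \oo `<=` U ->
  forall a, [/\ ext (u r) a @[r --> U] --> moment mustar a,
    ext (v r) a @[r --> U] --> moment nu1 a,
    ext (vh r) a @[r --> U] --> moment (lp_nuhat hmin hball) a &
    ext (y r) a @[r --> U] --> moment (lp_psi hdec hmin) a].
Proof.
move=> UU ooU; have PU : ProperFilter U := ultra_proper.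
have [j0 [N gj0]] := hball.
have pu r : (r_min g <= r)%N -> loc_psd g (u r) by move=> /feas[_ _ _ _ []].
have pv r : (r_min g <= r)%N -> loc_psd g (v r) by move=> /feas[_ _ _ _ []].
have pvh r : (r_min g <= r)%N -> loc_psd g (vh r) by move=> /feas[_ _ _ _ []].
have py r : (r_min g <= r)%N -> loc_psd g (y r) by move=> /feas[_ _ _ _ []].
have mu_ r : (r_min g <= r)%N -> ext (u r) mnm0 <= 1.
  by move=> /feas /sdp_feasible_mass[].
have mv r : (r_min g <= r)%N -> ext (v r) mnm0 <= 1.
  by move=> /feas /sdp_feasible_mass[].
have mvh r : (r_min g <= r)%N -> ext (vh r) mnm0 <= moment (lebesgue_on g) mnm0.
  by move=> /feas /sdp_feasible_mass[].
have my r : (r_min g <= r)%N -> ext (y r) mnm0 <= 1.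
  by move=> /feas /sdp_feasible_mass[].
have [mu [muC muE]] := pseudo_limit_measure gj0 UU ooU pu mu_.
have [nu [nuC nuE]] := pseudo_limit_measure gj0 UU ooU pv mv.
have [nuh [nuhC nuhE]] := pseudo_limit_measure gj0 UU ooU pvh mvh.
have [psi [psiC psiE]] := pseudo_limit_measure gj0 UU ooU py my.
have cu a : ext (u r) a @[r --> U] --> moment mu a.
  by rewrite muE; exact: (pseudo_limit_cvg gj0 UU ooU pu mu_).
have cv a : ext (v r) a @[r --> U] --> moment nu a.
  by rewrite nuE; exact: (pseudo_limit_cvg gj0 UU ooU pv mv).
have cvh a : ext (vh r) a @[r --> U] --> moment nuh a.
  by rewrite nuhE; exact: (pseudo_limit_cvg gj0 UU ooU pvh mvh).
have cy a : ext (y r) a @[r --> U] --> moment psi a.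
  by rewrite psiE; exact: (pseudo_limit_cvg gj0 UU ooU py my).
have cru p : riesz (ext (u r)) p @[r --> U] --> riesz (moment mu) p.
  by apply: cvg_Rsum => a; apply: cvgM => //; exact: cvg_cst.
have uniq_lim (x : nat -> R) (l1 l2 : R) : x k @[k --> U] --> l1 ->
    (\forall k \near \oo, x k = l2) -> l1 = l2.
  move=> xl /ooU xE; apply: (cvg_unique _ xl); first exact: Rhausdorff.
  by apply: cvg_near_cst.
have near_feas (P : nat -> Prop) k : (forall r, (k <= r)%N -> (r_min g <= r)%N -> P r) ->
    \forall r \near \oo, P r.
  move=> kP; exists (maxn k (r_min g)) => // r /=.
  by rewrite geq_max => /andP[kr gr]; exact: kP.
have mbd := supported_bounded hball muC.
have mX := measurable_semialgebraic_set g.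
have hfeas : lp_feasible t f g mu nu nuh psi.
  split => //.
  - have : moment mu mnm0 = 1.
      apply: uniq_lim (cu _) _; apply: (near_feas _ 0%N) => r _ /feas[]//.
    rewrite moment_mass -(supported_mass muC) -integral_mass => m1.
    rewrite -[LHS]fineK ?m1// integral_mass fin_num_measure//.
  - apply: inv_func_invariant => //; apply: inv_func_mpolyX => a.
    (* A fixed monomial lies in A_r once 2 r exceeds both its degree and that of its transport, so
       each invariance constraint is eventually imposed. *)
    pose d := mpoly_deg (transport t f (mpolyX R a)).
    have inv0 : \forall r \near \oo, inv_func t f (ext (u r)) (mpolyX R a) = 0.
      apply: (near_feas _ (maxn d (mdeg a))) => r.
      rewrite geq_max => /andP[dr ar] /feas[_ iu _ _ _].
      have ar2 : (mdeg a < (2 * r).+1)%N by lia.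
      apply: (iu (BMultinom ar2)); rewrite /in_A /=; apply: leq_trans dr _; lia.
    apply: uniq_lim inv0; rewrite /inv_func; case: (t) => //=.
    exact: cvgB.
  - apply: moment_determinacy_add; [exact: supported_bounded hball _ _..|].
    move=> a; apply/eqP; rewrite -subr_eq0; apply/eqP.
    apply: uniq_lim (cvgB (cvgD (cv a) (cy a)) (cu a)) _.
    apply: (near_feas _ 0%N) => r _ /feas[_ _ uE _ _].
    by rewrite -[LHS]/(ext (v r) a + ext (y r) a - ext (u r) a) (extD uE) subrr.
  - have mlam := supported_bounded hball (mu := finite_lebesgue_on hball)
      (lebesgue_on_supported g).
    apply: (moment_determinacy_add (m3 := finite_lebesgue_on hball)) => //;
      [exact: supported_bounded hball _ _..|].
    move=> a; apply: uniq_lim (cvgD (cv a) (cvh a)) _.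
    apply: (near_feas _ (mdeg a)) => r ar /feas[_ _ _ vE _].
    rewrite -[LHS]/(ext (v r) a + ext (vh r) a) (extD (y3 := fun b => v r b + vh r b))//.
    rewrite -[RHS](@ext_truncation _ _ (2 * r)); last by lia.
    by congr (ext _ _); apply/funext => b; exact: vE.
have opt : lp_optimal t f g mu nu nuh psi.
  split=> //; rewrite (rho_singE huniq hdec hmin hball hinv) integral_mass.
  apply/eqP; rewrite eq_le (lp_feasible_le huniq hdec hmin hfeas)//=.
  have nu1C : supported_on X nu1.
    by have [[]] := lp_feasible_star hdec hmin hball hinv.
  rewrite !supported_mass// -[leLHS]fineK ?fin_num_measure//.
  rewrite -[leRHS]fineK ?fin_num_measure// lee_fin -!moment_mass.
  have ceps : moment nu1 mnm0 - eps r @[r --> U] --> moment nu1 mnm0 - 0.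
    by apply: cvgB; [exact: cvg_cst|move=> V /eps0 /ooU].
  rewrite -[leLHS]subr0; apply: ler_cvg_to ceps (cv mnm0) _.
  by apply: ooU; apply: (near_feas _ 0%N) => r _ /near_optimal.
have [muS nuS nuhS psiS] := lp_optimal_unique huniq hdec hmin hball hinv opt.
by move=> a; rewrite -(eq_moment muS) -(eq_moment nuS) -(eq_moment nuhS) -(eq_moment psiS).
Qed.

Lemma sdp_limit a : [/\ ext (u r) a @[r --> \oo] --> moment mustar a,
  ext (v r) a @[r --> \oo] --> moment nu1 a,
  ext (vh r) a @[r --> \oo] --> moment (lp_nuhat hmin hball) a &
  ext (y r) a @[r --> \oo] --> moment (lp_psi hdec hmin) a].
Proof.
by split; apply: cvg_ultra => U UU ooU; have [] := ultra_sdp_limit UU ooU a.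
Qed.

End convergence.

(** * Convergence of the optimal values *)

Section relaxation_values.
Context {R : realType} {n : nat} (t : time) (f : n.-tuple (mpoly n R)).
Context {m : nat} (g : 'I_m -> mpoly n R).
Local Notation X := (semialgebraic_set g).
Hypothesis hball : exists (j : 'I_m) (N : int), g j = ball_poly N.
Variable mustar : probability 'rV[R]_n R.
Hypothesis huniq : forall mu : probability 'rV[R]_n R,
  invariant_probability t f X mu -> same_measure mu mustar.
Variables nustar sigma nu1 : {finite_measure set 'rV[R]_n -> \bar R}.
Hypothesis hdec : lebesgue_decomposition (lebesgue_on g) mustar nustar sigma.
Hypothesis hmin : is_min1 (lebesgue_on g) nustar nu1.
Hypothesis hinv : invariant_probability t f X mustar.

Lemma rho_sing_moment : rho_sing t f g = (moment nu1 mnm0)%:E.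
Proof.
have [[_ nu1C _ _] _ _ _ _] := lp_feasible_star hdec hmin hball hinv.
by rewrite (rho_singE huniq hdec hmin hball hinv) moment_mass supported_mass//
  fineK ?fin_num_measure.
Qed.

Lemma rho_sdp_ge r : (r_min g <= r)%N -> ((moment nu1 mnm0)%:E <= rho_sdp t f g r)%E.
Proof.
move=> gr; apply: ereal_sup_ubound.
have := lp_sdp_feasible hball gr (lp_feasible_star hdec hmin hball hinv).
move=> sf; do 4 eexists; split; first exact: sf.
by rewrite ext_truncation ?mdeg0.
Qed.

Lemma rho_sdp_le1 r : (rho_sdp t f g r <= 1)%E.
Proof.
apply: ge_ereal_sup => _ [u [v [vh [y [sf ->]]]]].
by have [_ v1 _ _] := sdp_feasible_mass sf; rewrite lee_fin.
Qed.

Lemma rho_sdp_fin r : (r_min g <= r)%N -> rho_sdp t f g r \is a fin_num.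
Proof.
move=> gr; rewrite fin_real// (lt_le_trans (ltNyr _) (rho_sdp_ge gr))/=.
by rewrite (le_lt_trans (rho_sdp_le1 r))// ltry.
Qed.

(** Solutions within 1 / (r + 1) of the supremum exist even if it is not attained. Their masses
    converge to that of [nu1], which squeezes the values from above; feasibility of the optimal
    measures bounds them from below. *)
Lemma rho_sdp_cvg : rho_sdp t f g r @[r --> \oo] --> rho_sing t f g.
Proof.
rewrite rho_sing_moment.
have near_opt r : exists s : psm (2 * r) * psm (2 * r) * psm (2 * r) * psm (2 * r),
    (r_min g <= r)%N ->
    sdp_feasible t f g s.1.1.1 s.1.1.2 s.1.2 s.2 /\
    (rho_sdp t f g r <= (ext s.1.1.2 mnm0 + r.+1%:R^-1)%:E)%E.
  (* Below [r_min] nothing is claimed; zero sequences are a default that makes the choice total. *)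
  have [gr|_] := boolP (r_min g <= r)%N; last first.
    by exists ((fun=> 0), (fun=> 0), (fun=> 0), (fun=> 0)).
  have r0 : 0 < r.+1%:R^-1 :> R by rewrite invr_gt0.
  have [_ [u [v [vh [y [sf ->]]]]] vr] := ub_ereal_sup_adherent r0 (rho_sdp_fin gr).
  exists (u, v, vh, y) => _; split=> //=.
  by rewrite EFinD -leeBlDr// ltW.
pose s r := sval (cid (near_opt r)); have sP r := svalP (cid (near_opt r)).
have eps0 : (r.+1%:R^-1 : R) @[r --> \oo] --> (0 : R) by exact: cvg_harmonic.
have cv : ext (s r).1.1.2 mnm0 @[r --> \oo] --> moment nu1 mnm0.
  have [] := @sdp_limit _ _ t f _ g hball _ huniq _ _ _ hdec hmin hinv
    (fun r => (s r).1.1.1) (fun r => (s r).1.1.2) (fun r => (s r).1.2)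
    (fun r => (s r).2) (fun r => r.+1%:R^-1) _ eps0 _ mnm0 => //.
    by move=> r /sP[].
  move=> r gr; have [_ sr] := sP r gr.
  by rewrite lerBlDr -lee_fin (le_trans (rho_sdp_ge gr)).
apply: (@squeeze_cvge _ _ _ _ (fun=> (moment nu1 mnm0)%:E) _
    (fun r => (ext (s r).1.1.2 mnm0 + r.+1%:R^-1)%:E)).
- exists (r_min g) => // r /= gr; rewrite rho_sdp_ge//=.
  by have [_ ->] := sP r gr.
- exact: cvg_cst.
- rewrite -[X in (X)%:E]addr0; apply: cvg_EFin; first exact: nearW.
  exact: cvgD.
Qed.

End relaxation_values.

Theorem theorem4p4 (R : realType) (n : nat) (t : time)
    (f : n.-tuple (mpoly n R)) (m : nat) (g : 'I_m -> mpoly n R)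
    (hcompact : compact (semialgebraic_set g))
    (hball : exists (j : 'I_m) (N : int), g j = ball_poly N)
    (mustar : probability 'rV[R]_n R)
    (hinv : invariant_probability t f (semialgebraic_set g) mustar)
    (huniq : forall mu : probability 'rV[R]_n R,
      invariant_probability t f (semialgebraic_set g) mu -> same_measure mu mustar)
    (nustar sigma nu1 : {finite_measure set 'rV[R]_n -> \bar R})
    (hdec : lebesgue_decomposition (lebesgue_on g) mustar nustar sigma)
    (hmin : is_min1 (lebesgue_on g) nustar nu1) :
  exists nuhat psi : {finite_measure set 'rV[R]_n -> \bar R},
    [/\ same_measure nuhat (fun A => lebesgue_on g A - nu1 A)%E,
        same_measure psi (fun A => mustar A - nu1 A)%E,
        lp_optimal t f g mustar nu1 nuhat psi /\
        (forall mu' nu' nuhat' psi' : {finite_measure set 'rV[R]_n -> \bar R},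
          lp_optimal t f g mu' nu' nuhat' psi' ->
          [/\ same_measure mu' mustar, same_measure nu' nu1,
              same_measure nuhat' nuhat & same_measure psi' psi]),
        (forall u v vhat y : forall r : nat, psm (2 * r),
          (forall r : nat, (r_min g <= r)%N ->
             sdp_optimal t f g (u r) (v r) (vhat r) (y r)) ->
          exists ustar vstar vhatstar ystar : multinom n -> R,
            (forall a : multinom n,
              [/\ ext (u r) a @[r --> \oo] --> ustar a,
                  ext (v r) a @[r --> \oo] --> vstar a,
                  ext (vhat r) a @[r --> \oo] --> vhatstar a /\
                  vhatstar a = moment (lebesgue_on g) a - vstar a &
                  ext (y r) a @[r --> \oo] --> ystar a /\
                  ystar a = ustar a - vstar a]) /\
            (forall a : multinom n,
              [/\ ustar a = moment mustar a, vstar a = moment nu1 a,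
                  vhatstar a = moment nuhat a & ystar a = moment psi a])) &
        rho_sdp t f g r @[r --> \oo] --> rho_sing t f g].
Proof.
have star := lp_feasible_star hdec hmin hball hinv.
have [[muC nu1C nuhC psiC] _ _ numu nulam] := star.
exists (lp_nuhat hmin hball), (lp_psi hdec hmin); split.
- exact: lp_nuhatE.
- exact: lp_psiE.
- split; first exact: lp_optimal_star.
  by move=> mu nu nuh psi; exact: lp_optimal_unique.
- move=> u v vh y opt.
  exists (moment mustar), (moment nu1), (moment (lp_nuhat hmin hball)),
    (moment (lp_psi hdec hmin)); split=> // a.
  have feas r (gr : (r_min g <= r)%N) := (opt r gr).1.
  (* Optimal solutions are near-optimal with slack 0, since each relaxation is worth at least the
     mass of [nu1]. *)
  have near r : (r_min g <= r)%N -> moment nu1 mnm0 - 0 <= ext (v r) mnm0.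
    move=> gr; have [_ vr] := opt r gr.
    by rewrite subr0 -lee_fin vr; exact: (rho_sdp_ge hball hdec hmin hinv gr).
  have [cu cv cvh cy] := sdp_limit hball huniq hdec hmin hinv feas (cvg_cst 0) near a.
  split=> //; split=> //.
  + apply/eqP; rewrite eq_sym subr_eq addrC; apply/eqP/esym.
    apply: (moment_add _ _ (m3 := finite_lebesgue_on hball)) => //.
      exact: (supported_bounded hball nu1C).
    exact: (supported_bounded hball nuhC).
  + apply/eqP; rewrite eq_sym subr_eq addrC; apply/eqP/esym.
    apply: moment_add => //; first exact: (supported_bounded hball nu1C).
    exact: (supported_bounded hball psiC).
- exact: (rho_sdp_cvg hball huniq hdec hmin hinv).
Qed.
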